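(* Let $r_2\in\mathbb{N}$, $t\in\mathbb{N}^{r_2}$, $d\in\mathbb{N}^{r_2+1}$, $\beta_1\ge 0$, $\beta_2=(\beta_{2,1},\dots,\beta_{2,r_2})\in\mathbb{R}^{r_2}$ and $B_1,B_2>0$ with $\beta_{2,i}>0$ for $i=1,\dots,r_2$ and $d_{r_2+1}=1$. Additionally let $t_1<d_1$ and $t_i\le d_i$ for $i\ne 1$. Define $d'\in\mathbb{N}^{r_2+1}$ by $d'_1=d_1-1$, $d'_i=d_i$ for $i\ne 1$, and $$\rho:=\max_{i=1,\dots,r_2}\frac{t_i}{\beta^*_{2,i}},\qquad \beta_{2,i}^*:=\beta_{2,i}\prod_{k=i+1}^{r_2}\min\{\beta_{2,k},1\}.$$ Define $\kappa:=1+\beta_1$ and let $\mathfrak{Q}$ be a class of probability distributions $\mathbb{Q}$ of $(X,Y)$ on $[0,1]^{d_1}\times\{0,1\}$ such that: (a) There is a constant $M>1$ such that for all $\mathbb{Q}\in\mathfrak{Q}$ the marginal distribution $\mathbb{Q}_X$ has a Lebesgue density bounded by $M$. (b) There are constants $r_1\in\mathbb{N}$ and $\epsilon_1,\epsilon_2>0$ such that for all $\mathbb{Q}\in\mathfrak{Q}$ the Bayes rule satisfies $G^*_{\mathbb{Q}}\in\mathcal{K}^{\mathcal{F}}_{\mathbb{Q},\beta_1,B_1,\epsilon_1,\epsilon_2,r_1,d_1}$ with $\mathcal{F}:=\mathcal{G}_{r_2,t,\beta_2,B_2,d'}$. (c) There is a constant $c_1>0$ such that $d_{f_{\mathbb{Q}}}(G,G^*_{\mathbb{Q}})\ge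 c_1 d_\Delta^{\kappa}(G,G^*_{\mathbb{Q}})$ for all $G\in\mathcal{N}:=\bigcup_{n\in\mathbb{N}}\mathcal{N}_{n,n,n}$ and all $\mathbb{Q}\in\mathfrak{Q}$. Let $$\tau_n:=\frac{n^{\frac{1}{2\kappa+\rho-1}}}{\log^{\frac{2}{\rho}}(n)}.$$ Let $L_0(\epsilon)=a_1\lceil\log(\epsilon^{-1})\rceil$, $s_0(\epsilon)=a_2\epsilon^{-\rho}\log(\epsilon^{-1})$, $c_0(\epsilon)=a_3+a_4\lceil\log(\epsilon^{-1})\rceil$, where $a_1,a_2>0$, $a_3,a_4\in\mathbb{N}$ are constants (which exist) such that for some $\epsilon_0>0$ every $\gamma\in\mathcal{G}_{r_2,t,\beta_2,B_2,d'}$ can, for every $\epsilon\in(0,\epsilon_0)$, be approximated as $\|R(\Phi)-\gamma\|_\infty\le\epsilon$ by a ReLU network $\Phi$ with at most $L_0(\epsilon)$ layers, sparsity at most $s_0(\epsilon)$ and weights in $\mathcal{W}_{c_0(\epsilon)}$. Then there exist constants $C_1',C_2'>0$ and $C_3'\in\mathbb{N}$ such that for all $p\ge 1$ $$\limsup_{n\to\infty}\ \sup_{\mathbb{Q}\in\mathfrak{Q}}\ \tau_n^{p\kappa}\,\mathbb{E}\big[d^p_{f_{\mathbb{Q}}}(\hat G_n,G^*_{\mathbb{Q}})\big]<\infty,\qquad \limsup_{n\to\infty}\ \sup_{\mathbb{Q}\in\mathfrak{Q}}\ \tau_n^{p}\,\mathbb{E}\big[d^p_{\Delta}(\hat G_n,G^*_{\mathbb{Q}})\big]<\infty,$$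 where $\hat G_n:=\arg\min_{G\in\mathcal{N}_n}R_n(G)$ with $\mathcal{N}_n=\mathcal{N}_{C_1'L_0(\tau_n^{-1}),\,C_2's_0(\tau_n^{-1}),\,C_3'c_0(\tau_n^{-1})}$ (networks with input dimension $d_1$).
   Context: **Classification setup.** $(X_i,Y_i)_{i=1}^n$ are i.i.d. with distribution $\mathbb{Q}$ on $[0,1]^{d_1}\times\{0,1\}$; $\mathbb{E}$ is expectation under this sampling. $\mathbb{Q}_X$ is the marginal of $X$, $f_{\mathbb{Q}}(x):=\mathbb{Q}(Y=1\mid X=x)$ (a fixed version), and the Bayes rule is $G^*_{\mathbb{Q}}:=\{x : f_{\mathbb{Q}}(x)\ge \tfrac12\}$. For measurable sets $G_1,G_2$, $d_{f_{\mathbb{Q}}}(G_1,G_2):=\int_{G_1\Delta G_2}|2f_{\mathbb{Q}}(x)-1|\,\mathbb{Q}_X(\mathrm{d}x)$ and $d_\Delta(G_1,G_2):=\mathbb{Q}_X(G_1\Delta G_2)$; powers are $d^p(\cdot,\cdot)=(d(\cdot,\cdot))^p$. The empirical risk is $R_n(G):=\frac1n\sum_{i=1}^n \mathbf{1}\big(Y_i\ne \mathbf{1}(X_i\in G)\big)$; $\arg\min$ denotes a minimizer over the finite class. **Neural networks.** A ReLU network with $L$ (hidden) layers and dimensions $m_0,\dots,m_{L+1}$ is a sequence $\Phi=(W_1,b_1,\dots,W_L,b_L,W_{L+1})$ with $W_s\in\mathbb{R}^{m_s\times m_{s-1}}$, $b_s\in\mathbb{R}^{m_s}$. Its realization is $R(\Phi)(x)=W_{L+1}\sigma_{b_L}W_L\cdots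 W_2\sigma_{b_1}W_1x$, where $\sigma_b(y)=(\sigma(y_1-b_1),\dots,\sigma(y_k-b_k))$ and $\sigma(t)=\max\{t,0\}$; for $L=0$, $R(\Phi)(x)=W_1x$. The domain is $[0,1]^{m_0}$. The weights of $\Phi$ are all entries of the $W_s$ and $b_s$; the sparsity is the number of nonzero weights. For $c\in\mathbb{N}$, $\mathcal{W}_c:=\{k2^{-c} : k\in\{-2^c,-2^c+1,\dots,2^c\}\}$. $\mathcal{N}_{L_0,s_0,c}$ is the collection of all sets $\{x\in[0,1]^{d_1} : R(\Phi)(x)=1\}$ where $\Phi$ is a ReLU network with input dimension $d_1$, output dimension $1$, at most $L_0$ layers, sparsity at most $s_0$, and all weights in $\mathcal{W}_c$ (hidden dimensions arbitrary; $L_0$, $s_0$ may be real numbers). **Hölder classes.** For $\beta>0$ let $m$ be the largest integer $k\ge0$ with $k<\beta$ and $\omega:=\beta-m$. For continuous $f:[0,1]^s\to\mathbb{R}$, $\|f\|_{\mathcal{C}^\beta}:=\sum_{|\alpha|\le m}\|\partial^\alpha f\|_\infty+\sum_{|\alpha|=m}\sup_{x\ne y}\frac{|\partial^\alpha f(x)-\partial^\alpha f(y)|}{\|x-y\|_\infty^\omega}$, and $\mathcal{F}_{\beta,B,s}:=\{f : \|f\|_{\mathcal{C}^\beta}\le B\}$. For $\beta>0$, $\mathcal{H}_{\beta,B}:=\{g\in\mathcal{F}_{\beta,B,1} : \partial^\alpha g(0)=0 \text{ for all integers } 0\le\alpha<\beta\}$. **Composition class.** For $r\in\mathbb{N}$,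 $t\in\mathbb{N}^r$, $d\in\mathbb{N}^{r+1}$, $\beta\in\mathbb{R}^r$, $B>0$ with $t_i\le d_i$, $\beta_i>0$ for $i=1,\dots,r$ and $d_{r+1}=1$, $\mathcal{G}_{r,t,\beta,B,d}$ is the set of all $\gamma=\gamma_r\circ\dots\circ\gamma_1$ with $\gamma_i=(\gamma_{ij}\circ\iota_{ij})_{j=1}^{d_{i+1}}$, where $\gamma_{ij}\in\mathcal{F}_{\beta_i,B,t_i}$, $\gamma_{ij}:[0,1]^{t_i}\to[0,1]$ for $i=1,\dots,r-1$, $\gamma_{r1}:[0,1]^{t_r}\to\mathbb{R}$, and each $\iota_{ij}:[0,1]^{d_i}\to[0,1]^{t_i}$ is of the form $\iota(x)=(x_{i_1},\dots,x_{i_{t_i}})$ with indices in $\{1,\dots,d_i\}$. **The class $\mathcal{K}^{\mathcal{F}}_{\mathbb{Q},\beta,B,\epsilon_1,\epsilon_2,r,d}$ (here $d$ is a single integer).** For $x\in\mathbb{R}^d$, $x_{-j}$ denotes $x$ with the $j$-th coordinate removed; $\lambda$ is Lebesgue measure. Given $\beta\ge0$, $B>0$, $d\ge2$, $r\in\mathbb{N}$, $\epsilon_1,\epsilon_2>0$, a probability measure $\mathbb{Q}$ on $[0,1]^d\times\{0,1\}$, and a class $\mathcal{F}$ of functions $[0,1]^{d-1}\to\mathbb{R}$, it is the class of all $H=H_1\cup\dots\cup H_u\subseteq[0,1]^d$ with $u\in\{0,\dots,r\}$ such that for $\nu=1,\dots,u$ there exist $(j_\nu,\iota_\nu)\in\{1,\dots,d\}\times\{-1,1\}$,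 $\gamma_\nu\in\mathcal{F}$ and $D_\nu=\prod_{i=1}^d[a_i^\nu,b_i^\nu]$ with $0\le a_i^\nu<b_i^\nu\le1$ satisfying: 1. $H_\nu=D_\nu\cap\{x\in[0,1]^d : \iota_\nu x_{j_\nu}\le\gamma_\nu(x_{-j_\nu})\}$ for all $\nu$. 2. $\lambda(D_{\nu_1}\cap D_{\nu_2})=0$ for $\nu_1\ne\nu_2$. 3. If $\beta>0$: for every $\nu$ and every $x\in D_\nu\cap\partial H$ (with $\partial H$ the topological boundary of $H$ as a subset of $[0,1]^d$) there is $g_{\nu,x}\in\mathcal{H}_{\beta,B}$ such that for all $y_{j_\nu}\in[\max\{0,x_{j_\nu}-\epsilon_1\},\min\{1,x_{j_\nu}+\epsilon_1\}]$, with $y=(x_1,\dots,x_{j_\nu-1},y_{j_\nu},x_{j_\nu+1},\dots,x_d)$, one has $|2f_{\mathbb{Q}}(y)-1|\le g_{\nu,x}(|y_{j_\nu}-x_{j_\nu}|)$. 4. $b^\nu_{j_\nu}-a^\nu_{j_\nu}\ge\epsilon_2$ for all $\nu$. *)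

(* Defs.v *)
From HB Require Import structures.
From mathcomp Require Import all_boot all_order all_algebra.
From mathcomp Require Import all_classical all_reals all_analysis.

Set Implicit Arguments.
Unset Strict Implicit.
Unset Printing Implicit Defensive.

Import Order.TTheory GRing.Theory Num.Theory.
Import numFieldNormedType.Exports.

Local Open Scope classical_set_scope.
Local Open Scope ring_scope.

(** Points of R^n are column vectors, with the supremum norm and topology of
    MathComp-Analysis; functions on [0,1]^n are functions on R^n of which only
    the values on [unit_cube n] matter. *)

Section matrix_measurable.
Context (R : realType) (m n : nat).

(* The product sigma-algebra on R^(m x n), generated by the entries. *)
Definition mx_cylinders : set (set 'M[R]_(m, n)) :=
  [set B | exists i j, exists2 A : set R, measurable A &
     B = (fun M : 'M[R]_(m, n) => M i j) @^-1` A].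

HB.instance Definition _ := @isMeasurable.Build (sigma_display mx_cylinders)
  'M[R]_(m, n) <<s mx_cylinders >>
  (@sigma_algebra0 _ setT mx_cylinders)
  (@sigma_algebraC _ mx_cylinders)
  (@sigma_algebra_bigcup _ setT mx_cylinders).

Lemma measurable_entry i j :
  measurable_fun setT (fun M : 'M[R]_(m, n) => M i j).
Proof.
move=> _ A mA; rewrite setTI; apply: sub_sigma_algebra.
by exists i, j, A.
Qed.

Lemma measurable_fun_mx d (T : measurableType d) (f : T -> 'M[R]_(m, n)) :
  (forall i j, measurable_fun setT (fun x => f x i j)) ->
  measurable_fun setT f.
Proof.
move=> mf; apply: (@measurability _ _ _ _ setT f mx_cylinders) => //.
move=> _ [_ [i [j [A mA ->]]] <-].
exact: (mf i j).
Qed.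

End matrix_measurable.

Lemma product_sigma_finite d1 d2 (T1 : measurableType d1)
    (T2 : measurableType d2) (R : realType)
    (m1 : {sigma_finite_measure set T1 -> \bar R})
    (m2 : {sigma_finite_measure set T2 -> \bar R}) :
  sigma_finite setT (m1 \x m2)%E.
Proof.
have /sigma_finiteP[F [TF ndF Foo]] := sigma_finiteT m1.
have /sigma_finiteP[G [TG ndG Goo]] := sigma_finiteT m2.
exists (fun n => F n `*` G n).
  rewrite -setXTT TF TG predeqE => -[x y]; split.
    move=> [/= [n _ Fnx] [k _ Gky]]; exists (maxn n k) => //; split.
      by move: x Fnx; exact/subsetPset/ndF/leq_maxl.
    by move: y Gky; exact/subsetPset/ndG/leq_maxr.
  by move=> [n _ []/= ? ?]; split; exists n.
move=> k; have [? ?] := Foo k; have [? ?] := Goo k.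
split; first exact: measurableX.
by rewrite product_measure1E// lte_mul_pinfty// ge0_fin_numE.
Qed.

Section power_measure.
Context d (T : measurableType d) (R : realType).

Definition cons_pair n (p : T * n.-tuple T) : n.+1.-tuple T :=
  [the n.+1.-tuple T of p.1 :: p.2].

(* The n-fold product of mu with itself, on n-tuples. *)
Fixpoint power_measure (mu : set T -> \bar R) (n : nat) :
    set (n.-tuple T) -> \bar R :=
  match n with
  | 0 => \d_([tuple] : 0.-tuple T)
  | n'.+1 => pushforward (mu \x @power_measure mu n')%E (@cons_pair n')
  end.
Arguments power_measure mu n A : clear implicits.

Lemma measurable_cons_pair n : measurable_fun setT (@cons_pair n).
Proof. exact: measurable_cons. Qed.

Lemma measurable_uncons n : measurable_fun setT
  (fun z : n.+1.-tuple T => (thead z, [tuple of behead z])).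
Proof.
apply: measurable_fun_pair; last exact: measurable_behead.
exact: measurable_tnth.
Qed.

Lemma pushforward_sigma_finite n
    (m : set (T * n.-tuple T)%type -> \bar R) :
  sigma_finite setT m -> sigma_finite setT (pushforward m (@cons_pair n)).
Proof.
move=> [F FT mF].
exists (fun k =>
  (fun z : n.+1.-tuple T => (thead z, [tuple of behead z])) @^-1` F k).
  by rewrite -preimage_bigcup -FT preimage_setT.
move=> k; have [mFk Fk] := mF k; split.
  by rewrite -[X in measurable X]setTI; exact: measurable_uncons.
rewrite /pushforward -comp_preimage (_ : _ \o _ = id) ?preimage_id//.
by apply/funext => -[x z]; congr pair; exact: val_inj.
Qed.

Lemma power_measure_sigma_finite
    (mu : {sigma_finite_measure set T -> \bar R}) n :
  exists nu : {sigma_finite_measure set (n.-tuple T) -> \bar R},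
    power_measure mu n = nu.
Proof.
elim: n => [|n [nu /= ->]].
  by exists (\d_([tuple] : 0.-tuple T)).
pose m : {measure set (n.+1.-tuple T) -> \bar R} :=
  measure_function_pushforward__canonical__measure_function_Measure
    (mu \x nu)%E (measurable_cons_pair (n:=n)).
have m_sf : sigma_finite setT m.
  apply: pushforward_sigma_finite.
  exact: product_sigma_finite.
pose C := Measure_isSigmaFinite.Build _ _ _ m m_sf.
pose m2 : {sigma_finite_measure set (n.+1.-tuple T) -> \bar R} :=
  HB.pack (Measure.sort m) C.
by exists m2.
Qed.

Section power_measure_instances.
Context (mu : {sigma_finite_measure set T -> \bar R}) (n : nat).

Let pm0 : power_measure mu n set0 = 0%E.
Proof. by have [nu ->] := power_measure_sigma_finite mu n; rewrite measure0. Qed.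

Let pm_ge0 A : (0 <= power_measure mu n A)%E.
Proof. by have [nu ->] := power_measure_sigma_finite mu n; exact: measure_ge0. Qed.

Let pm_sigma_additive : semi_sigma_additive (power_measure mu n).
Proof.
have [nu ->] := power_measure_sigma_finite mu n.
exact: measure_semi_sigma_additive.
Qed.

HB.instance Definition _ :=
  isMeasure.Build _ _ _ (power_measure mu n) pm0 pm_ge0 pm_sigma_additive.

Let pm_sigma_finite : sigma_finite setT (power_measure mu n).
Proof.
by have [nu ->] := power_measure_sigma_finite mu n; exact: sigma_finiteT.
Qed.

HB.instance Definition _ := Measure_isSigmaFinite.Build _ _ _
  (power_measure mu n) pm_sigma_finite.

End power_measure_instances.

Lemma power_measure_box (mu : {sigma_finite_measure set T -> \bar R}) n
    (A : 'I_n -> set T) : (forall i, measurable (A i)) ->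
  power_measure mu n [set z | forall i, A i (tnth z i)] =
  (\prod_(i < n) mu (A i))%E.
Proof.
elim: n A => [|n IHn] A mA.
  rewrite big_ord0 /= diracE mem_set//; by case.
rewrite big_ord_recl /= /pushforward.
rewrite (_ : _ @^-1` _ =
    A ord0 `*` [set z : n.-tuple T | forall i, A (lift ord0 i) (tnth z i)]); last first.
  apply/seteqP; split => -[x z] /=.
    move=> Az; split; first exact: (Az ord0).
    by move=> i; have := Az (lift ord0 i); rewrite tnthS.
  move=> [Ax Az] i; have [->//|] := eqVneq i ord0.
  by case: (unliftP ord0 i) => [j ->|->]; rewrite ?eqxx// tnthS.
rewrite product_measure1E//; first by congr (_ * _)%E; exact: IHn.
rewrite (_ : mkset _ = \bigcap_(i in [set: 'I_n])
    ((fun z : n.-tuple T => tnth z i) @^-1` A (lift ord0 i))); last first.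
  apply/seteqP; split => z Az i; first by move=> _; exact: Az.
  exact: (Az i I).
apply: fin_bigcap_measurable => // i _.
by rewrite -[X in measurable X]setTI; exact: measurable_tnth.
Qed.

Section power_probability.
Context (P : probability T R) (n : nat).

Let power_setT : power_measure P n setT = 1%E.
Proof.
have := @power_measure_box P n (fun=> setT) (fun=> measurableT).
rewrite (_ : mkset _ = setT) => [->|]; last by apply/seteqP; split.
by rewrite big1// => i _; exact: probability_setT.
Qed.

HB.instance Definition _ := Measure_isProbability.Build _ _ _
  (power_measure P n) power_setT.

End power_probability.

End power_measure.
Arguments power_measure {d T R} mu n A.

Section lebesgue_cV.
Context (R : realType) (n : nat).

Definition col_of_tuple (z : n.-tuple R) : 'cV[R]_n := \col_i tnth z i.

Lemma measurable_col_of_tuple : measurable_fun setT col_of_tuple.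
Proof.
apply: measurable_fun_mx => i j.
rewrite (_ : (fun x => _) = fun z : n.-tuple R => tnth z i).
  exact: measurable_tnth.
by apply/funext => z; rewrite mxE.
Qed.

Definition lebesgue_cV : set 'cV[R]_n -> \bar R :=
  pushforward (power_measure (@lebesgue_measure R) n) col_of_tuple.

Let lebesgue_cV0 : lebesgue_cV set0 = 0%E.
Proof. by rewrite /lebesgue_cV /pushforward preimage_set0 measure0. Qed.

Let lebesgue_cV_ge0 A : (0 <= lebesgue_cV A)%E.
Proof. exact: (measure_ge0 (power_measure (@lebesgue_measure R) n)). Qed.

Let lebesgue_cV_sigma_additive : semi_sigma_additive lebesgue_cV.
Proof.
exact: (@measure_semi_sigma_additive _ _ _
  (measure_function_pushforward__canonical__measure_function_Measure
    (power_measure (@lebesgue_measure R) n) measurable_col_of_tuple)).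
Qed.

HB.instance Definition _ := isMeasure.Build _ _ _
  lebesgue_cV lebesgue_cV0 lebesgue_cV_ge0 lebesgue_cV_sigma_additive.

Lemma lebesgue_cV_box (A : 'I_n -> set R) : (forall i, measurable (A i)) ->
  lebesgue_cV [set x | forall i, A i (x i 0)] =
  (\prod_(i < n) (@lebesgue_measure R) (A i))%E.
Proof.
move=> mA; rewrite -power_measure_box// /lebesgue_cV /pushforward.
by congr power_measure; apply/seteqP; split => z /= Az i; move: (Az i);
  rewrite mxE.
Qed.

End lebesgue_cV.

Section cube.
Context (R : realType).

Definition unit_cube n : set 'cV[R]_n := [set x | forall i, 0 <= x i 0 <= 1].
Arguments unit_cube {n} _.

Definition box n (a b : 'cV[R]_n) : set 'cV[R]_n :=
  [set x | forall i, a i 0 <= x i 0 <= b i 0].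

(* x with its i-th coordinate replaced by v; the point x_{-i} is [row' i x]. *)
Definition set_coord n (x : 'cV[R]_n) (i : 'I_n) (v : R) : 'cV[R]_n :=
  \col_k (if k == i then v else x k 0).

(* The topological boundary of H relative to the unit cube. *)
Definition cube_boundary n (H : set 'cV[R]_n) : set 'cV[R]_n :=
  unit_cube `&` closure (unit_cube `&` H) `&` closure (unit_cube `\` H).

Definition cube_sup n (g : 'cV[R]_n -> R) : \bar R :=
  ereal_sup [set `|g x|%:E | x in unit_cube].

End cube.
Arguments unit_cube {R n} _.

Section holder.
Context (R : realType).

Definition holder_order (beta : R) : nat := `|Num.ceil beta|%N.-1.

Lemma holder_orderP (beta : R) : 0 < beta ->
  (holder_order beta)%:R < beta <= (holder_order beta).+1%:R.
Proof.
move=> beta0; rewrite /holder_order.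
have c0 : (0 < Num.ceil beta)%R by rewrite -ceil_gt0 in beta0 *.
case: (Num.ceil beta) (ceil_itv beta) c0 => [[|k]|k]//= + _.
by rewrite intrB (_ : k.+1%:~R = k.+1%:R :> R)// -natr1 addrK natr1.
Qed.

Definition multi_index s := {ffun 'I_s -> nat}.

Definition mi_order s (a : multi_index s) : nat := (\sum_i a i)%N.

Definition mi_incr s (a : multi_index s) (i : 'I_s) : multi_index s :=
  [ffun k => (a k + (k == i))%N].

(* g is the i-th partial derivative of f on the unit cube, one-sided where
   x i 0 is 0 or 1. *)
Definition is_partial s (i : 'I_s) (f g : 'cV[R]_s -> R) : Prop :=
  forall x, unit_cube x ->
    (f (set_coord x i v) - f x) / (v - x i 0)
      @[v --> within `[0, 1] (x i 0)^'] --> g x.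

(* D a is the partial derivative of f of multi-index a, for all |a| <= m.  On
   the unit cube D is determined by f, since [0, 1] has no isolated point. *)
Definition partial_derivatives s (m : nat) (f : 'cV[R]_s -> R)
    (D : multi_index s -> 'cV[R]_s -> R) : Prop :=
  (forall x, unit_cube x -> D [ffun=> 0%N] x = f x) /\
  (forall a i, (mi_order a < m)%N -> is_partial i (D a) (D (mi_incr a i))).

(* `|x - y| is the supremum norm of 'cV[R]_s *)
Definition holder_seminorm s (w : R) (g : 'cV[R]_s -> R) : \bar R :=
  ereal_sup [set (`|g p.1 - g p.2| / `|p.1 - p.2| `^ w)%:E |
    p in [set p : 'cV[R]_s * 'cV[R]_s |
      [/\ unit_cube p.1, unit_cube p.2 & p.1 <> p.2]]].

Definition small_index s m (a : {ffun 'I_s -> 'I_m.+1}) : multi_index s :=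
  [ffun i => a i : nat].

(* The multi-indices of order at most m have entries in {0, ..., m}, which
   makes the two sums below finite. *)
Definition holder_norm s (beta : R) (D : multi_index s -> 'cV[R]_s -> R) :
    \bar R :=
  let m := holder_order beta in
  (\sum_(a : {ffun 'I_s -> 'I_m.+1} | (mi_order (small_index a) <= m)%N)
      cube_sup (D (small_index a)) +
   \sum_(a : {ffun 'I_s -> 'I_m.+1} | mi_order (small_index a) == m)
      holder_seminorm (beta - m%:R) (D (small_index a)))%E.

Definition holder_with s (beta B : R) (f : 'cV[R]_s -> R)
    (D : multi_index s -> 'cV[R]_s -> R) : Prop :=
  [/\ {within unit_cube, continuous f},
      partial_derivatives (holder_order beta) f D &
      (holder_norm beta D <= B%:E)%E].

Definition holder_class (beta B : R) s : set ('cV[R]_s -> R) :=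
  [set f | exists D, holder_with beta B f D].

Definition flat_class (beta B : R) : set ('cV[R]_1 -> R) :=
  [set g | exists D, holder_with beta B g D /\
     forall a : multi_index 1, (mi_order a)%:R < beta -> D a 0 = 0].

End holder.

Section composition.
Context (R : realType).

(* The maps from [0,1]^d1 to R^d2 with components [h j] depending on the [t]
   coordinates [iota j]; [inner] requires the h j to take values in [0,1]. *)
Definition layer_class (t : nat) (beta B : R) (inner : bool)
    d1 d2 : set ('cV[R]_d1 -> 'cV[R]_d2) :=
  [set g | exists (h : 'I_d2 -> 'cV[R]_t -> R) (iota : 'I_d2 -> 'I_t -> 'I_d1),
    [/\ forall j, holder_class beta B (h j),
        inner -> forall j x, unit_cube x -> 0 <= h j x <= 1 &
        forall x : 'cV[R]_d1, g x = \col_j h j (\col_k x (iota j k) 0)]].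
Arguments layer_class t beta B inner {d1 d2} _.

Fixpoint comp_layers (d : nat -> nat)
    (g : forall i, 'cV[R]_(d i) -> 'cV[R]_(d i.+1)) (k : nat) :
    'cV[R]_(d 0%N) -> 'cV[R]_(d k) :=
  match k with
  | 0 => id
  | k'.+1 => fun x => g k' (@comp_layers d g k' x)
  end.

(* Layers are indexed from 0: layer i goes from dimension d i to d i.+1.  Only
   t i, beta i for i < r and d i for i <= r matter, and when d r = 1 the index j
   of the output takes a single value. *)
Definition comp_class (r : nat) (t : nat -> nat) (beta : nat -> R) (B : R)
    (d : nat -> nat) : set ('cV[R]_(d 0%N) -> R) :=
  [set gamma | exists g : forall i, 'cV[R]_(d i) -> 'cV[R]_(d i.+1),
    (forall i, (i < r)%N -> layer_class (t i) (beta i) B (i.+1 < r)%N (g i)) /\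
    (forall x, unit_cube x -> forall j : 'I_(d r),
       gamma x = comp_layers g r x j 0)].

End composition.
Arguments comp_class {R} r t beta B d _.

Section relu_networks.
Context (R : realType).

(* ReLU networks with q outputs, indexed by the input dimension. *)
Inductive relu_net (q : nat) : nat -> Type :=
| Output p of 'M[R]_(q, p) : relu_net q p
| Layer p k of 'M[R]_(k, p) & 'cV[R]_k & relu_net q k : relu_net q p.

Definition shifted_relu k (b y : 'cV[R]_k) : 'cV[R]_k :=
  \col_i Num.max (y i 0 - b i 0) 0.

Fixpoint realization q p (Phi : relu_net q p) : 'cV[R]_p -> 'cV[R]_q :=
  match Phi with
  | Output _ W => fun x => W *m x
  | Layer _ _ W b Psi => fun x => realization Psi (shifted_relu b (W *m x))
  end.

(* the number of hidden layers *)
Fixpoint depth q p (Phi : relu_net q p) : nat :=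
  match Phi with
  | Output _ _ => 0
  | Layer _ _ _ _ Psi => (depth Psi).+1
  end.

Definition nonzeros m n (A : 'M[R]_(m, n)) : nat :=
  (\sum_i \sum_j (A i j != 0%R))%N.

Fixpoint sparsity q p (Phi : relu_net q p) : nat :=
  match Phi with
  | Output _ W => nonzeros W
  | Layer _ _ W b Psi => (nonzeros W + nonzeros b + sparsity Psi)%N
  end.

Fixpoint weights_in (S : set R) q p (Phi : relu_net q p) : Prop :=
  match Phi with
  | Output _ W => forall i j, S (W i j)
  | Layer _ _ W b Psi =>
      [/\ forall i j, S (W i j), forall i j, S (b i j) & weights_in S Psi]
  end.

Definition dyadic_weights (c : nat) : set R :=
  [set w | exists2 k : int, (`|k| <= 2 ^ c)%N & w = k%:~R / 2 ^+ c].

Definition bounded_net (L0 s0 : R) (c : nat) p (Phi : relu_net 1 p) : Prop :=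
  [/\ (depth Phi)%:R <= L0, (sparsity Phi)%:R <= s0 &
      weights_in (dyadic_weights c) Phi].

Definition net_sets p (L0 s0 : R) (c : nat) : set (set 'cV[R]_p) :=
  [set G | exists2 Phi : relu_net 1 p, bounded_net L0 s0 c Phi &
     G = [set x | unit_cube x /\ realization Phi x 0 0 = 1]].

End relu_networks.

Section classification.
Context (R : realType).

(* f is a version of x |-> Q(Y = 1 | X = x); [true] encodes the label 1. *)
Definition regression_function n (Q : probability ('cV[R]_n * bool)%type R)
    (f : 'cV[R]_n -> R) : Prop :=
  measurable_fun setT f /\
  forall A, measurable A ->
    Q (A `*` [set true]) = (\int[pushforward Q fst]_(x in A) (f x)%:E)%E.

Definition bayes_rule n (f : 'cV[R]_n -> R) : set 'cV[R]_n :=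
  [set x | unit_cube x /\ 1 / 2 <= f x].

Definition dist_f n (Q : probability ('cV[R]_n * bool)%type R)
    (f : 'cV[R]_n -> R) (G1 G2 : set 'cV[R]_n) : \bar R :=
  (\int[pushforward Q fst]_(x in G1 `+` G2) `|2 * f x - 1|%:E)%E.

Definition dist_sd n (Q : probability ('cV[R]_n * bool)%type R)
    (G1 G2 : set 'cV[R]_n) : \bar R :=
  pushforward Q fst (G1 `+` G2).

Definition density_bounded n (Q : probability ('cV[R]_n * bool)%type R)
    (M : R) : Prop :=
  exists p : 'cV[R]_n -> R,
    [/\ measurable_fun setT p, forall x, 0 <= p x <= M &
        forall A, measurable A ->
          pushforward Q fst A = (\int[@lebesgue_cV R n]_(x in A) (p x)%:E)%E].

Definition emp_risk p n (z : n.-tuple ('cV[R]_p * bool)) (G : set 'cV[R]_p) :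
    R :=
  n%:R^-1 * \sum_(i < n) ((tnth z i).2 != ((tnth z i).1 \in G))%:R.

(* Ghat is a measurable choice of a minimizer of the empirical risk over NN. *)
Definition empirical_minimizer p n (NN : set (set 'cV[R]_p))
    (Ghat : n.-tuple ('cV[R]_p * bool) -> set 'cV[R]_p) : Prop :=
  (forall z, NN (Ghat z) /\
     forall G, NN G -> emp_risk z (Ghat z) <= emp_risk z G) /\
  (forall G, NN G -> measurable [set z | Ghat z = G]).

(* The class of piecewise boundary-fragment sets H, which depends on Q only
   through f; the sign iota_nu of the piece nu is (-1) ^+ sgn nu. *)
Definition boundary_class n (F : set ('cV[R]_n.-1 -> R)) (f : 'cV[R]_n -> R)
    (beta B eps1 eps2 : R) (r : nat) : set (set 'cV[R]_n) :=
  [set H | exists (u : nat) (j : 'I_u -> 'I_n) (sgn : 'I_u -> bool)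
      (gamma : 'I_u -> 'cV[R]_n.-1 -> R) (a b : 'I_u -> 'cV[R]_n)
      (Hpart : 'I_u -> set 'cV[R]_n),
    [/\ (u <= r)%N,
        H = \bigcup_nu Hpart nu,
        forall nu, F (gamma nu) /\
          forall i, 0 <= a nu i 0 /\ a nu i 0 < b nu i 0 <= 1,
        forall nu, Hpart nu = box (a nu) (b nu) `&`
          [set x | unit_cube x /\
             (-1) ^+ sgn nu * x (j nu) 0 <= gamma nu (row' (j nu) x)] &
        [/\ forall nu1 nu2, nu1 <> nu2 ->
              lebesgue_cV (box (a nu1) (b nu1) `&` box (a nu2) (b nu2)) = 0%E,
            0 < beta -> forall nu x,
              box (a nu) (b nu) x -> cube_boundary H x ->
              exists2 g, flat_class beta B g &
                forall v : R, Num.max 0 (x (j nu) 0 - eps1) <= v <=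
                          Num.min 1 (x (j nu) 0 + eps1) ->
                  `|2 * f (set_coord x (j nu) v) - 1| <=
                  g (const_mx `|v - x (j nu) 0|) &
            forall nu, eps2 <= b nu (j nu) 0 - a nu (j nu) 0]]].

End classification.

Section rates.
Context (R : realType).

Definition beta_star (r : nat) (beta : nat -> R) (i : nat) : R :=
  beta i * \prod_(i.+1 <= k < r) Num.min (beta k) 1.

Definition rho_max (r : nat) (t : nat -> nat) (beta : nat -> R) : R :=
  \big[Num.max/0]_(i < r) ((t i)%:R / beta_star r beta i).

Definition pred_head (d : nat -> nat) (i : nat) : nat :=
  if i is 0 then (d 0%N).-1 else d i.

Definition tau (kappa rho : R) (n : nat) : R :=
  n%:R `^ (1 / (2 * kappa + rho - 1)) / ln n%:R `^ (2 / rho).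

Definition net_depth (a1 eps : R) : R := a1 * (Num.ceil (ln eps^-1))%:~R.

Definition net_sparsity (a2 rho eps : R) : R :=
  a2 * eps `^ (- rho) * ln eps^-1.

(* The absolute value only makes the result a natural number: the ceiling is
   nonnegative as soon as eps <= 1. *)
Definition net_precision (a3 a4 : nat) (eps : R) : nat :=
  (a3 + a4 * `|Num.ceil (ln eps^-1)|)%N.

End rates.

(* Main.v *)
(** The sets cut out by sparse networks with dyadic weights form a finite class
    N_n: neurons without incoming weights are constant zero, so a network is a
    list of at most s entries (layer, target, source, weight), and
    log #N_n <= C n^(rho / (2 kappa + rho - 1)).

    Bias: replace each boundary function gamma by a network within eps and the
    box corners by dyadic numbers.  The points this misclassifies lie close to
    the faces of the boxes, or within C eps of a boundary point of the Bayes
    rule along one coordinate, where |2f - 1| <= B (C eps)^beta1; together they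
    contribute at most C eps^kappa to d_f.

    Variance: d_f is the excess risk, and by the margin condition the loss of G
    relative to a competitor has variance at most C d_f(G)^(1/kappa).  A Chernoff
    bound gives P(Ghat = G) <= exp(-c n d_f(G)^(2 - 1/kappa)).  For
    d_f(G) >= (K / tau_n)^kappa and K large this beats #N_n, so all moments of
    d_f(Ghat) have the rate, and the margin condition turns it into the one for
    d_Delta. *)

Require Import Defs.
From mathcomp Require Import all_boot all_order all_algebra.
From mathcomp Require Import all_classical all_reals all_analysis.
From mathcomp Require Import measurable_realfun.
From mathcomp Require Import ring lra zify.

Set Implicit Arguments.
Unset Strict Implicit.
Unset Printing Implicit Defensive.

Import Order.TTheory GRing.Theory Num.Theory.
Import numFieldNormedType.Exports.

Local Open Scope classical_set_scope.
Local Open Scope ring_scope.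

(** * Counting sparse networks *)

(** The flatness condition bounds |2f - 1| only along coordinate lines through boundary points of
    the Bayes rule, and two kinds of error get no help from it. Rounded box corners are wrong on
    strips around the faces, whose mass is of the order of their width; the factor [C3] in the
    precision makes this width at most eps^kappa instead of eps. On a line where gamma leaves the
    box no boundary point is at hand, and a network error eps could flip points next to a face; the
    oriented coordinate is therefore contracted slightly before the comparison, so that off the
    strips no point of such a line is flipped. Sets are cut out by an equation, output equal to 1,
    so the union network must hit 1 exactly; it takes minima of hinge sums, which vanish exactly on
    the fragments. The Bayes rule need not be cut out by a network, so deviations compare a
    candidate with the approximating network, whose excess risk is at most half the threshold. The
    power 2 / rho of the logarithm in tau_n is chosen so that tau_n^rho log(n)^2, which is sparsity
    times bits per entry up to a constant, equals n^(rho / (2 kappa + rho - 1)). *)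

Section run_code.
Context (R : realType) (N : nat).

Definition entry := (nat * nat * nat * R)%type.

Definition preactivation (c : seq entry) (l i : nat) (v : nat -> R) : R :=
  \sum_(e <- c | e.1.1 == (l, i)) e.2 * v e.1.2.

(* Slot N of the state always holds -1, so that an entry with source N subtracts
   a bias. *)
Fixpoint run (c : seq entry) (l D : nat) (v : nat -> R) : R :=
  match D with
  | 0 => preactivation c l 0 v
  | D'.+1 => run c l.+1 D' (fun i =>
      if i == N then -1 else Num.max (preactivation c l i v) 0)
  end.

Lemma preactivation_cat c1 c2 l i v :
  preactivation (c1 ++ c2) l i v = preactivation c1 l i v + preactivation c2 l i v.
Proof. exact: big_cat. Qed.

Lemma preactivation_out c l i v :
  all (fun e : entry => e.1.1.1 != l) c -> preactivation c l i v = 0.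
Proof.
move=> /allP cl; rewrite /preactivation big_seq_cond big1// => e /andP[ec /eqP eli].
by have := cl _ ec; rewrite eli eqxx.
Qed.

(** A run started at layer [l] never reads entries of earlier layers. This lets the code of one
    layer be concatenated with the code of all later ones. *)
Lemma run_cat_below c1 c2 l D v :
  all (fun e : entry => (e.1.1.1 < l)%N) c1 ->
  run (c1 ++ c2) l D v = run c2 l D v.
Proof.
elim: D l v => [|D IHD] l v c1l /=.
  rewrite preactivation_cat preactivation_out ?add0r//.
  by apply: sub_all c1l => e el; lia.
rewrite IHD; last by apply: sub_all c1l => e el; lia.
congr run; apply/funext => i; case: ifP => // _.
rewrite preactivation_cat preactivation_out ?add0r//.
by apply: sub_all c1l => e el; lia.
Qed.

Lemma nonzerosE m n (A : 'M[R]_(m, n)) :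
  nonzeros A = #|[pred ij : 'I_m * 'I_n | A ij.1 ij.2 != 0]|.
Proof.
rewrite /nonzeros pair_bigA /= -sum1_card [RHS]big_mkcond /=.
by apply: eq_bigr => ij _; rewrite inE; case: (_ != _).
Qed.

Definition matrix_entries m n (W : 'M[R]_(m, n)) (A : pred 'I_n) l
    (e' : 'I_m -> nat) (e : 'I_n -> nat) : seq entry :=
  [seq (l, e' ij.1, e ij.2, W ij.1 ij.2) |
    ij <- enum [pred ij : 'I_m * 'I_n | (W ij.1 ij.2 != 0) && A ij.2]].

Lemma size_matrix_entries m n (W : 'M[R]_(m, n)) A l e' e :
  (size (matrix_entries W A l e' e) <= nonzeros W)%N.
Proof.
rewrite size_map -cardE nonzerosE; apply: subset_leq_card.
by apply/fintype.subsetP => ij; rewrite !inE => /andP[].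
Qed.

(** The entries left out of the code contribute nothing, since the weight or the input vanishes.
    Injectivity of [e'] on [B], which contains every row with a nonzero weight, keeps two such rows
    from being merged. *)
Lemma preactivation_matrix_entries m n (W : 'M[R]_(m, n)) (A : pred 'I_n) l
    (B : pred 'I_m) (e' : 'I_m -> nat) (e : 'I_n -> nat) (i : 'I_m) v (x : 'cV_n) :
  (forall i j, W i j != 0 -> B i) -> {in B &, injective e'} -> B i ->
  (forall j, ~~ A j -> x j 0 = 0) -> (forall j, A j -> v (e j) = x j 0) ->
  preactivation (matrix_entries W A l e' e) l (e' i) v = (W *m x) i 0.
Proof.
move=> WB e'_inj Bi xA vA.
rewrite /preactivation /matrix_entries big_map big_enum_cond/= mxE.
transitivity (\sum_a \sum_b if [&& W a b != 0, A b & (l, e' a) == (l, e' i)]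
   then W a b * v (e b) else 0).
  rewrite pair_bigA /= big_mkcond /=; apply: eq_bigr => -[a b] _ /=.
  by rewrite andbA.
rewrite (bigD1 i)//= [X in _ + X]big1 ?addr0; last first.
  move=> a ai; rewrite big1// => b _; rewrite xpair_eqE eqxx/=.
  case: ifP => // /and3P[Wab _ /eqP ee]; move: ai.
  by rewrite (e'_inj _ _ (WB _ _ Wab) Bi ee) eqxx.
apply: eq_bigr => b _; rewrite eqxx andbT.
case: eqP => [->|_] /=; first by rewrite mul0r.
by case: ifPn => [Ab|Ab]; [rewrite vA|rewrite xA// mulr0].
Qed.

(** Targets stay strictly below [N], whereas a source may be [N] itself, the bias slot. *)
Definition code_ok (S : set R) (l D : nat) (c : seq entry) :=
  forall e, e \in c ->
    [/\ (l <= e.1.1.1 <= l + D)%N, (e.1.1.2 < N)%N, (e.1.2 <= N)%N & S e.2].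

(* Only the neurons with a nonzero incoming weight or bias are active; there are
   at most N of them in each layer, so they can be renumbered below N.  A is the
   set of active inputs and e their numbering. *)
Lemma net_code (S : set R) p (Phi : relu_net R 1 p) (A : pred 'I_p)
    (e : 'I_p -> nat) (l : nat) :
  (0 < N)%N -> (sparsity Phi <= N)%N -> weights_in S Phi ->
  (forall i, A i -> (e i < N)%N) ->
  exists c : seq entry, [/\ (size c <= sparsity Phi)%N, code_ok S l (depth Phi) c &
    forall (x : 'cV_p) v, (forall i, ~~ A i -> x i 0 = 0) ->
      (forall i, A i -> v (e i) = x i 0) -> v N = -1 ->
      realization Phi x 0 0 = run c l (depth Phi) v].
Proof.
move=> N0; elim: Phi A e l => {p} [p W|p k W b Psi IH] A e l /=.
  move=> WN SW eN; exists (matrix_entries W A l (fun=> 0%N) e); split.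
  - exact: size_matrix_entries.
  - move=> f /mapP[[i j]]; rewrite mem_enum inE /= => /andP[_ Aj] -> /=.
    by split => //; [lia|exact/ltnW/eN].
  - move=> x v xA vA _.
    rewrite (@preactivation_matrix_entries _ _ _ _ _ predT (fun=> 0%N) _ 0 _ x)//.
    by move=> i j _ _ _; rewrite !ord1.
move=> WN [SW Sb SPsi] eN.
pose A' : pred 'I_k := fun i => [exists j, W i j != 0] || (b i 0 != 0).
pose e' i := index i (enum A').
(* Every active neuron is the row index of some nonzero entry of [W] or [b]. *)
have A'le : (#|A'| <= nonzeros W + nonzeros b)%N.
  have /leq_trans : (#|A'| <= #|[set ij.1 | ij : 'I_k * 'I_p in [pred ij | W ij.1 ij.2 != 0%R]]%SET
      :|: [set ij.1 | ij : 'I_k * 'I_1 in [pred ij | b ij.1 ij.2 != 0%R]]%SET|)%N.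
    apply: subset_leq_card; apply/fintype.subsetP => i; rewrite !inE /A' unfold_in => /orP[/existsP[j Wij]|bi].
      by apply/orP; left; apply/imsetP; exists (i, j).
    by apply/orP; right; apply/imsetP; exists (i, 0).
  apply; rewrite (leq_trans (leq_card_setU _ _).1)// !nonzerosE.
  by rewrite leq_add// leq_imset_card.
have e'N i : A' i -> (e' i < N)%N.
  move=> A'i; have : (e' i < #|A'|)%N by rewrite cardE index_mem mem_enum.
  by lia.
have e'_inj : {in A' &, injective e'}.
  move=> i j A'i A'j ee.
  have e'K k' : A' k' -> nth i (enum A') (e' k') = k'.
    by move=> A'k; rewrite nth_index// mem_enum.
  by rewrite -(e'K _ A'j) -ee e'K.
have [|c [cs cok cE]] := IH A' e' l.+1 _ SPsi e'N; first by lia.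
pose c1 := matrix_entries W A l e' e.
pose c2 := matrix_entries b predT l e' (fun=> N).
exists ((c1 ++ c2) ++ c); split.
- rewrite !size_cat; have := size_matrix_entries W A l e' e.
  by have := size_matrix_entries b predT l e' (fun=> N); rewrite -/c1 -/c2; lia.
- move=> f; rewrite !mem_cat => /orP[/orP[]|].
  + move=> /mapP[[i j]]; rewrite mem_enum inE /= => /andP[Wij Aj] -> /=; split => //.
    * by lia.
    * by apply: e'N; apply/orP; left; apply/existsP; exists j.
    * exact/ltnW/eN.
  + move=> /mapP[[i j]]; rewrite mem_enum inE /= => /andP[bij _] -> /=; split => //.
    * by lia.
    * by apply: e'N; apply/orP; right; rewrite (ord1 j) in bij.
  + by move=> /cok[? ? ? ?]; split => //; lia.
- move=> x v xA vA vN.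
  have lc1 : all (fun e : entry => e.1.1.1 == l) (c1 ++ c2).
    by rewrite all_cat; apply/andP; split; apply/allP => f /mapP[ij _ ->] /=.
  rewrite run_cat_below; last by apply: sub_all lc1 => f /eqP ->.
  apply: cE.
  + move=> i; rewrite /A' negb_or negb_exists => /andP[/forallP Wi /negPn/eqP bi].
    rewrite !mxE bi big1 ?subr0 ?maxxx// => j _.
    by have /negPn/eqP -> := Wi j; rewrite mul0r.
  + move=> i A'i; rewrite ifF; last by apply/negbTE; have := e'N _ A'i; lia.
    rewrite !preactivation_cat (@preactivation_matrix_entries _ _ _ _ _ A' _ _ _ _ x)//; last first.
      by move=> a j Waj; apply/orP; left; apply/existsP; exists j.
    (* The bias is treated as the one-column matrix [b] applied to the scalar -1 kept in slot
       [N]. *)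
    rewrite (@preactivation_matrix_entries _ _ _ _ _ A' _ _ _ _ (-1)%:M)//; last 2 first.
      by move=> a j; rewrite (ord1 j) => baj; apply/orP; right.
      by move=> j _; rewrite (ord1 j) mxE eqxx mulr1n.
    rewrite preactivation_out ?addr0; last first.
      by apply/allP => f /cok[] + _ _ _ => /andP[lf _]; rewrite gtn_eqF.
    by rewrite mul_mx_scalar !mxE mulN1r.
  + by rewrite eqxx.
Qed.

End run_code.

(** * Finite codes for the sets cut out by bounded networks *)

Section counting.
Context (R : realType).

Lemma seq_preimage (A B : Type) (g : A -> B) (s : seq B) :
  (forall i, (i < size s)%N -> forall b0, exists a, g a = nth b0 s i) ->
  exists t, map g t = s.
Proof.
elim: s => [|b s IH] gs; first by exists [::].
have [a ga] := gs 0%N isT b.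
have [t gt] := IH (fun i si => gs i.+1 si).
by exists (a :: t); rewrite /= ga gt.
Qed.

(** An entry of weight zero is invisible wherever it points, so all codes can be padded to one
    length and live in a finite tuple type. *)
Lemma run_pad N (c : seq (entry R)) k l D v :
  run N (c ++ nseq k (0%N, 0%N, 0%N, 0)) l D v = run N c l D v.
Proof.
have pre l' i w : preactivation (c ++ nseq k (0%N, 0%N, 0%N, 0)) l' i w =
    preactivation c l' i w.
  rewrite preactivation_cat [X in _ + X](_ : _ = 0) ?addr0//.
  rewrite /preactivation big_seq_cond big1// => e /andP[].
  by rewrite mem_nseq => /andP[_ /eqP ->] _; rewrite mul0r.
elim: D l v => [|D IHD] l v /=; first exact: pre.
by rewrite IHD; congr run; apply/funext => i; rewrite pre.
Qed.

Definition code_index (L N c : nat) : finType :=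
  ('I_L.+1 * 'I_N * 'I_N.+1 * 'I_(2 ^ c.+1).+1)%type.

(** Numerators of dyadic weights run from -2^c to 2^c; the index is shifted by 2^c to make it an
    ordinal. *)
Definition entry_of_index L N c (e : code_index L N c) : entry R :=
  (nat_of_ord e.1.1.1, nat_of_ord e.1.1.2, nat_of_ord e.1.2,
   ((e.2 : nat)%:Z - (2 ^ c)%:Z)%:~R / 2 ^+ c).

(** The default -1 beyond the coordinates serves the bias slot [N], as p <= N wherever a network is
    encoded. *)
Definition state_of_point p (x : 'cV[R]_p) (i : nat) : R :=
  if insub i is Some j then x j 0 else -1.

(** The first component is the depth: a list of entries does not tell at which layer the output is
    read. *)
Definition code_type L N c S : finType :=
  ('I_L.+1 * S.-tuple (code_index L N c))%type.

Definition decode p L N c S (cd : code_type L N c S) : set 'cV[R]_p :=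
  [set x | unit_cube x /\
    run N (map (@entry_of_index L N c) cd.2) 0 cd.1 (state_of_point x) = 1].

Lemma entry_preimage L N c (e : entry R) :
  (e.1.1.1 <= L)%N -> (e.1.1.2 < N)%N -> (e.1.2 <= N)%N ->
  dyadic_weights c e.2 -> exists a, entry_of_index (a : code_index L N c) = e.
Proof.
case: e => [[[l i] j] w] /= lL iN jN [k kc wE].
have k0 : (0 <= k + (2 ^ c)%:Z)%R by lia.
have kK : (absz (k + (2 ^ c)%:Z)%R < (2 ^ c.+1).+1)%N.
  by rewrite expnS; lia.
exists (Ordinal (lL : (l < L.+1)%N), Ordinal iN, Ordinal (jN : (j < N.+1)%N), Ordinal kK).
rewrite /entry_of_index /= wE; congr (_, _ / _).
by rewrite gez0_abs// addrK.
Qed.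

(** [N] has to bound the input dimension, because all coordinates occupy slots of the initial state,
    and the sparsity, which bounds the active neurons of a layer. *)
Lemma net_sets_decode p L S N c (Phi : relu_net R 1 p) :
  (depth Phi <= L)%N -> (sparsity Phi <= S)%N -> (p <= N)%N -> (S <= N)%N ->
  (0 < N)%N -> weights_in (dyadic_weights c) Phi ->
  exists cd : code_type L N c S,
    [set x | unit_cube x /\ realization Phi x 0 0 = 1] = decode cd.
Proof.
move=> dL sS pN SN N0 wc.
have [|//|//||cs [csS csok csE]] := @net_code R N (dyadic_weights c) p Phi predT
  (@nat_of_ord p) 0%N; [by []|by lia|by move=> i _; have := ltn_ord i; lia|].
have dy0 : dyadic_weights c (0 : R) by exists 0; rewrite ?mul0r// normr0.
have [t tE] : exists t, map (@entry_of_index L N c) t =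
    cs ++ nseq (S - size cs) (0%N, 0%N, 0%N, 0).
  apply: seq_preimage => i si b0.
  have := mem_nth b0 si; rewrite mem_cat => /orP[/csok[l1 l2 l3 l4]|].
    by apply: entry_preimage => //; case/andP: l1 => _ /leq_trans; apply.
  by rewrite mem_nseq => /andP[_ /eqP ->]; exact: entry_preimage.
have st : size t == S.
  by rewrite -(size_map (@entry_of_index L N c)) tE size_cat size_nseq; lia.
exists (Ordinal (dL : (depth Phi < L.+1)%N), Tuple st).
have runE x : run N cs 0 (depth Phi) (state_of_point x) = realization Phi x 0 0.
  symmetry; apply: csE => //; first by move=> i _; rewrite /state_of_point valK.
  by rewrite /state_of_point insubF//; lia.
by apply/seteqP; split => x [x1 Px]; split => //; move: Px => /=;
  rewrite tE run_pad runE.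
Qed.

Lemma card_code_type L N c S : #|code_type L N c S| =
  (L.+1 * (L.+1 * N * N.+1 * (2 ^ c.+1).+1) ^ S)%N.
Proof. by rewrite card_prod card_ord card_tuple !card_prod !card_ord. Qed.

End counting.

(** * Networks for unions of boundary fragments *)

Section network_blocks.
Context (R : realType).

Lemma nonzeros_col_mx m1 m2 n (A : 'M[R]_(m1, n)) (B : 'M[R]_(m2, n)) :
  nonzeros (col_mx A B) = (nonzeros A + nonzeros B)%N.
Proof.
rewrite /nonzeros big_split_ord /=; congr addn; apply: eq_bigr => i _;
  by apply: eq_bigr => j _; rewrite ?col_mxEu ?col_mxEd.
Qed.

Lemma nonzeros_row_mx m n1 n2 (A : 'M[R]_(m, n1)) (B : 'M[R]_(m, n2)) :
  nonzeros (row_mx A B) = (nonzeros A + nonzeros B)%N.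
Proof.
rewrite /nonzeros -big_split /=; apply: eq_bigr => i _.
by rewrite big_split_ord /=; congr addn; apply: eq_bigr => j _;
  rewrite ?row_mxEl ?row_mxEr.
Qed.

Lemma nonzeros_le m n (A : 'M[R]_(m, n)) : (nonzeros A <= m * n)%N.
Proof.
rewrite /nonzeros -[leqRHS](_ : \sum_(i < m) \sum_(j < n) 1 = _)%N; last first.
  by rewrite !sum_nat_const !card_ord muln1.
by apply: leq_sum => i _; apply: leq_sum => j _; exact: leq_b1.
Qed.

Lemma nonzeros0 m n : nonzeros (0 : 'M[R]_(m, n)) = 0%N.
Proof. by rewrite /nonzeros big1// => i _; rewrite big1// => j _; rewrite mxE eqxx. Qed.

Lemma nonzerosN m n (A : 'M[R]_(m, n)) : nonzeros (- A) = nonzeros A.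
Proof.
by apply: eq_bigr => i _; apply: eq_bigr => j _; rewrite mxE oppr_eq0.
Qed.

Definition entries_in (S : set R) m n (A : 'M[R]_(m, n)) := forall i j, S (A i j).

Lemma entries_in_col (S : set R) m1 m2 n (A : 'M[R]_(m1, n)) (B : 'M[R]_(m2, n)) :
  entries_in S A -> entries_in S B -> entries_in S (col_mx A B).
Proof. by move=> SA SB i j; rewrite mxE; case: splitP => k _. Qed.

Lemma entries_in_row (S : set R) m n1 n2 (A : 'M[R]_(m, n1)) (B : 'M[R]_(m, n2)) :
  entries_in S A -> entries_in S B -> entries_in S (row_mx A B).
Proof. by move=> SA SB i j; rewrite mxE; case: splitP => k _. Qed.

Lemma entries_in0 (S : set R) m n : S 0 -> entries_in S (0 : 'M[R]_(m, n)).
Proof. by move=> S0 i j; rewrite mxE. Qed.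

Lemma entries_in_const (S : set R) m n a : S a -> entries_in S (const_mx a : 'M[R]_(m, n)).
Proof. by move=> Sa i j; rewrite mxE. Qed.

Lemma entries_in1 (S : set R) n : S 0 -> S 1 -> entries_in S (1%:M : 'M[R]_n).
Proof. by move=> S0 S1 i j; rewrite mxE; case: eqP => _. Qed.

Lemma entries_inN (S : set R) m n (A : 'M[R]_(m, n)) : (forall w, S w -> S (- w)) ->
  entries_in S A -> entries_in S (- A).
Proof. by move=> SN SA i j; rewrite mxE; exact: SN. Qed.

Lemma entries_in_delta (S : set R) m n i0 j0 a : S 0 -> S a ->
  entries_in S (a *: delta_mx i0 j0 : 'M[R]_(m, n)).
Proof. by move=> S0 Sa i j; rewrite !mxE; case: (_ && _); rewrite ?mulr1 ?mulr0. Qed.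

Lemma shifted_relu_col m n (b1 y1 : 'cV[R]_m) (b2 y2 : 'cV[R]_n) :
  shifted_relu (col_mx b1 b2) (col_mx y1 y2) =
  col_mx (shifted_relu b1 y1) (shifted_relu b2 y2).
Proof. by apply/colP => i; rewrite !mxE; case: splitP => j _; rewrite mxE. Qed.

Definition nonneg_mx m n (z : 'M[R]_(m, n)) := forall i j, 0 <= z i j.

Lemma shifted_relu_id n (z : 'cV[R]_n) : nonneg_mx z -> shifted_relu 0 z = z.
Proof. by move=> z0; apply/colP => i; rewrite !mxE subr0; apply: max_idPl. Qed.

Lemma shifted_relu_ge0 n (b z : 'cV[R]_n) : nonneg_mx (shifted_relu b z).
Proof. by move=> i j; rewrite mxE le_max lexx orbT. Qed.

Section carry.
Context (k q : nat) (A : 'M[R]_(1 + q, k)) (c : 'cV[R]_(1 + q)).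

(* Runs Phi on y while z is passed along, then feeds cont with z and the
   hinges of A z, the first of which is lowered by the output of Phi. *)
Fixpoint carry (cont : relu_net R 1 ((1 + q) + k)) p (Phi : relu_net R 1 p) :
    relu_net R 1 (p + k) :=
  match Phi with
  | Output _ W =>
      Layer (block_mx (col_mx (- W) 0) A 0 1%:M) (col_mx c 0) cont
  | Layer _ _ W b Psi =>
      Layer (block_mx W 0 0 1%:M) (col_mx b 0) (carry cont Psi)
  end.

Lemma realization_carry cont p (Phi : relu_net R 1 p) y z : nonneg_mx z ->
  realization (carry cont Phi) (col_mx y z) =
  realization cont (col_mx
    (shifted_relu c (A *m z - col_mx (realization Phi y) 0)) z).
Proof.
move=> z0; elim: Phi y => {p} [p W|p m W b Psi IH] y /=.
  rewrite mul_block_col shifted_relu_col !mul0mx !mul1mx add0r shifted_relu_id//.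
  congr (realization cont (col_mx (shifted_relu _ _) _)).
  by rewrite mul_col_mx mulNmx mul0mx addrC opp_col_mx oppr0.
rewrite mul_block_col shifted_relu_col !mul0mx !mul1mx addr0 add0r.
by rewrite (shifted_relu_id z0) IH.
Qed.

Lemma depth_carry cont p (Phi : relu_net R 1 p) :
  depth (carry cont Phi) = (depth Phi + 1 + depth cont)%N.
Proof. by elim: Phi => //= {}p m W b Psi ->. Qed.

Lemma sparsity_carry cont p (Phi : relu_net R 1 p) :
  (sparsity (carry cont Phi) <= sparsity Phi + depth Phi * (k * k) +
     ((1 + q) * k + k * k + (1 + q)) + sparsity cont)%N.
Proof.
elim: Phi => [{}p W|{}p m W b Psi IH] /=;
  rewrite !nonzeros_col_mx !nonzeros_row_mx ?nonzeros_col_mx !nonzeros0.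
  rewrite nonzerosN; have := nonzeros_le A; have := nonzeros_le c.
  by have := nonzeros_le (1%:M : 'M[R]_k); lia.
by have := nonzeros_le (1%:M : 'M[R]_k); lia.
Qed.

Lemma weights_in_carry (S : set R) cont p (Phi : relu_net R 1 p) :
  S 0 -> S 1 -> (forall w, S w -> S (- w)) ->
  entries_in S A -> entries_in S c -> weights_in S cont ->
  weights_in S Phi -> weights_in S (carry cont Phi).
Proof.
move=> S0 S1 SN SA Sc Scont; elim: Phi => [{}p W|{}p m W b Psi IH] /=.
  move=> SW; split => //; last exact: entries_in_col (entries_in0 _).
  apply: entries_in_col; apply: entries_in_row => //.
  - by apply: entries_in_col; [exact: entries_inN|exact: entries_in0].
  - exact: entries_in0.
  - exact: entries_in1.
move=> [SW Sb SPsi]; split; last exact: IH.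
- apply: entries_in_col; apply: entries_in_row => //; try exact: entries_in0.
  exact: entries_in1.
- exact: entries_in_col (entries_in0 _).
Qed.

End carry.

Section min_step.
Context (k q p : nat) (A : 'M[R]_(1 + q, k)) (c : 'cV[R]_(1 + q))
  (sel : 'M[R]_(p, k)) (e : 'rV[R]_k) (Phi : relu_net R 1 p).

(** With memory m read by [e] and hinge sum s, the layers after [carry] compute max(m - s, 0) and
    subtract it along [e^T], since min(m, s) = m - max(m - s, 0). *)
Definition min_step (Psi : relu_net R 1 k) : relu_net R 1 k :=
  Layer (col_mx sel 1%:M) 0
    (carry A c
      (Layer (block_mx (const_mx (-1)) e 0 1%:M) (0 : 'cV_(1 + k))
        (Layer (row_mx (- e^T) 1%:M) 0 Psi)) Phi).

Definition hinge_sum (z : 'cV[R]_k) : R :=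
  \sum_i shifted_relu c (A *m z - col_mx (realization Phi (sel *m z)) 0) i 0.

Lemma hinge_sum_ge0 z : 0 <= hinge_sum z.
Proof. by apply: sumr_ge0 => i _; exact: shifted_relu_ge0. Qed.

Lemma realization_min_step Psi z : nonneg_mx z -> nonneg_mx (sel *m z) ->
  realization (min_step Psi) z = realization Psi
    (shifted_relu 0 (z - (Num.max ((e *m z) 0 0 - hinge_sum z) 0) *: e^T)).
Proof.
move=> z0 sz0; rewrite /= mul_col_mx mul1mx -[X in shifted_relu X _]col_mx0.
rewrite shifted_relu_col (shifted_relu_id z0) (shifted_relu_id sz0) realization_carry//=.
rewrite mul_block_col -[X in shifted_relu X (col_mx _ _)]col_mx0 shifted_relu_col.
rewrite mul0mx mul1mx add0r (shifted_relu_id z0) mul_row_col mul1mx addrC mulNmx.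
congr (realization Psi (shifted_relu 0 (z - _))).
apply/colP => i; rewrite !mxE big_ord1 !mxE mulrC subr0; congr (Num.max _ _ * _).
rewrite addrC; congr (_ + _); rewrite /hinge_sum -sumrN.
by apply: eq_bigr => j _; rewrite mxE mulN1r.
Qed.

Lemma depth_min_step Psi : depth (min_step Psi) = (depth Phi + 4 + depth Psi)%N.
Proof. by rewrite /= depth_carry /=; lia. Qed.

Lemma sparsity_min_step Psi :
  (sparsity (min_step Psi) <= sparsity Phi +
    (p + q + k + 2) ^ 2 * 16 * (depth Phi).+1 + sparsity Psi)%N.
Proof.
rewrite /=; set cont := Layer _ _ _.
have := sparsity_carry A c cont Phi; rewrite {2}/cont /=.
rewrite !nonzeros_col_mx !nonzeros_row_mx !nonzeros0.
have := nonzeros_le (1%:M : 'M[R]_k); have := nonzeros_le sel.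
have := nonzeros_le (const_mx (-1) : 'M[R]_(1, 1 + q)); have := nonzeros_le e.
have := nonzeros_le (- e^T).
set M := ((_ + _) ^ 2)%N.
have leM a b : (a <= p + q + k + 2)%N -> (b <= p + q + k + 2)%N -> (a * b <= M)%N.
  by move=> aM bM; rewrite /M -mulnn leq_mul.
have kk : (k * k <= M)%N by apply: leM; lia.
have pk : (p * k <= M)%N by apply: leM; lia.
have qk : ((1 + q) * k <= M)%N by apply: leM; lia.
have k1 : (k * 1 <= M)%N by apply: leM; lia.
have q1 : (1 * (1 + q) <= M)%N by apply: leM; lia.
have dk : (depth Phi * (k * k) <= depth Phi * M)%N by rewrite leq_mul2l kk orbT.
have -> : (M * 16 * (depth Phi).+1 = 16 * (depth Phi * M) + 16 * M)%N by ring.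
move: dk kk pk qk k1 q1; set dM := (depth Phi * M)%N; set dk := (depth Phi * (k * k))%N.
set k2 := (k * k)%N; set k3 := (p * k)%N; set k4 := ((1 + q) * k)%N.
set nI := nonzeros 1%:M; set ne := nonzeros e; set nS := nonzeros sel.
set nT := nonzeros (- e^T); set nC := nonzeros (const_mx (-1)).
set sc := sparsity (carry _ _ _ _).
by clearbody dM dk k2 k3 k4 M nI ne nS nT nC sc; lia.
Qed.

Lemma weights_in_min_step (S : set R) Psi :
  S 0 -> S 1 -> (forall w, S w -> S (- w)) ->
  entries_in S A -> entries_in S c -> entries_in S sel -> entries_in S e ->
  weights_in S Phi -> weights_in S Psi -> weights_in S (min_step Psi).
Proof.
move=> S0 S1 SN SA Sc Ssel Se SPhi SPsi /=; split.
- by apply: entries_in_col => //; exact: entries_in1.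
- exact: entries_in0.
apply: weights_in_carry => //=; split.
- apply: entries_in_col; apply: entries_in_row => //.
  + by apply: entries_in_const; exact: SN.
  + exact: entries_in0.
  + exact: entries_in1.
- exact: entries_in0.
split => //; last exact: entries_in0.
apply: entries_in_row; last exact: entries_in1.
by apply: entries_inN => // i j; rewrite mxE.
Qed.

End min_step.

End network_blocks.

Section union_network.
Context (R : realType) (n : nat) (I : eqType) (theta : R)
  (j : I -> 'I_n) (sgn : I -> bool) (Phi : I -> relu_net R 1 n.-1)
  (a b : I -> 'cV[R]_n) (c0 : I -> R).

Definition fragment nu : set 'cV[R]_n :=
  box (a nu) (b nu) `&` [set x : 'cV[R]_n | theta * ((-1) ^+ sgn nu * x (j nu) 0) + c0 nu <=
    realization (Phi nu) (row' (j nu) x) 0 0].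

(** Together with [hinge_bias], one hinge for each inequality that defines the fragment: the
    comparison with [Phi nu], then x <= b, then a <= x. A hinge is zero exactly when its inequality
    holds. *)
Definition hinge_matrix nu : 'M[R]_(1 + (n + n), n + 1) :=
  col_mx (row_mx ((theta * (-1) ^+ sgn nu) *: delta_mx 0 (j nu)) 0)
    (row_mx (col_mx 1%:M (- 1%:M)) 0).

Definition hinge_bias nu : 'cV[R]_(1 + (n + n)) :=
  col_mx (const_mx (- c0 nu)) (col_mx (b nu) (- a nu)).

Definition selection nu : 'M[R]_(n.-1, n + 1) := row_mx (row' (j nu) 1%:M) 0.

Definition memory : 'rV[R]_(n + 1) := row_mx 0 1%:M.

(* memory reads the last coordinate m of the state (x, m); min_step replaces it by
   min(m, s), where s >= 0 vanishes exactly on one fragment.  Starting from m = 1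
   and ending with max(1 - m, 0), the output is 1 exactly on the union. *)
Definition union_tail : relu_net R 1 (n + 1) :=
  Layer (- memory) (const_mx (-1)) (Output 1%:M).

Definition union_steps (l : seq I) : relu_net R 1 (n + 1) :=
  foldr (fun nu => min_step (hinge_matrix nu) (hinge_bias nu) (selection nu)
    memory (Phi nu)) union_tail l.

(** A zero row with bias -1 produces the initial memory 1, although networks have no constant
    input. *)
Definition union_net (l : seq I) : relu_net R 1 n :=
  Layer (col_mx 1%:M 0) (col_mx 0 (const_mx (-1))) (union_steps l).

Definition state (x : 'cV[R]_n) (m : R) : 'cV[R]_(n + 1) := col_mx x (const_mx m).

Lemma memory_state x m : (memory *m state x m) 0 0 = m.
Proof. by rewrite mul_row_col mul0mx mul1mx add0r mxE. Qed.

Lemma selection_state nu x m : selection nu *m state x m = row' (j nu) x.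
Proof.
by rewrite mul_row_col mul0mx addr0 !row'Esub mul_rowsub_mx mul1mx.
Qed.

Lemma hinge_sum_state nu x m :
  hinge_sum (hinge_matrix nu) (hinge_bias nu) (selection nu) (Phi nu) (state x m) =
  Num.max (theta * ((-1) ^+ sgn nu * x (j nu) 0) + c0 nu -
    realization (Phi nu) (row' (j nu) x) 0 0) 0 +
  (\sum_i Num.max (x i 0 - b nu i 0) 0 + \sum_i Num.max (a nu i 0 - x i 0) 0).
Proof.
rewrite /hinge_sum selection_state mul_col_mx !mul_row_col !mul0mx !addr0.
rewrite mul_col_mx mulNmx !mul1mx -scalemxAl -rowE opp_col_mx oppr0 add_col_mx addr0.
rewrite shifted_relu_col shifted_relu_col big_split_ord big_ord1 /=; congr (_ + _).
  rewrite col_mxEu !mxE; congr (Num.max _ _); ring.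
by rewrite big_split_ord /=; congr (_ + _); apply: eq_bigr => i _;
  rewrite col_mxEd ?col_mxEu ?col_mxEd !mxE// opprK addrC.
Qed.

Lemma hinge_sum_eq0 nu x m :
  (hinge_sum (hinge_matrix nu) (hinge_bias nu) (selection nu) (Phi nu)
     (state x m) = 0) <-> fragment nu x.
Proof.
have max0 (u : R) : (Num.max u 0 == 0) = (u <= 0) by rewrite eq_maxr.
have max_ge0 (u : R) : 0 <= Num.max u 0 by rewrite le_max lexx orbT.
rewrite hinge_sum_state; split.
  move=> /eqP; rewrite !paddr_eq0 ?addr_ge0 ?sumr_ge0// max0 subr_le0.
  move=> /and3P[h1]; rewrite !psumr_eq0// => /allP hb /allP ha; split => // i.
  have := ha i (mem_index_enum _); have := hb i (mem_index_enum _).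
  by rewrite /= !max0 !subr_le0 => -> ->.
move=> [xab h1]; rewrite (max_idPr _) ?subr_le0// add0r.
by rewrite !big1 ?addr0// => i _; apply/max_idPr; rewrite subr_le0;
  have /andP[] := xab i.
Qed.

(** Induction needs an arbitrary memory [m]: it becomes the minimum of [m] and the hinge sums met so
    far, and is zero as soon as one of them is. *)
Lemma realization_union_steps l x m : unit_cube x -> 0 <= m ->
  (realization (union_steps l) (state x m) 0 0 = 1 <->
   m = 0 \/ exists2 nu, nu \in l & fragment nu x).
Proof.
move=> x01; elim: l m => [|nu l IHl] m m0.
  rewrite /= mul1mx mxE mulNmx [X in X - _]mxE memory_state mxE opprK.
  split=> [|[->|[]//]]; last by rewrite oppr0 add0r; apply/max_idPl.
  by have [_|_ E] := leP (- m + 1) 0; [lra|left; lra].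
have xm0 : nonneg_mx (state x m).
  by move=> i k; rewrite (ord1 k) mxE; case: splitP => i' _; rewrite ?mxE//; have /andP[] := x01 i'.
rewrite [union_steps _]/= realization_min_step//; last first.
  by rewrite selection_state => i k; rewrite (ord1 k) mxE; have /andP[] := x01 (lift (j nu) i).
set s := hinge_sum _ _ _ _ _.
have s0 : 0 <= s by exact: hinge_sum_ge0.
have -> : shifted_relu 0 (state x m - Num.max ((memory *m state x m) 0 0 - s) 0 *: memory^T) =
    state x (Num.min m s).
  rewrite memory_state /memory tr_row_mx trmx0 trmx1 scale_col_mx scaler0 opp_col_mx oppr0.
  rewrite add_col_mx addr0 -[X in shifted_relu X _]col_mx0 shifted_relu_col; congr col_mx.
    by rewrite shifted_relu_id// => i k; rewrite (ord1 k); have /andP[] := x01 i.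
  apply/colP => i; rewrite (ord1 i) !mxE eqxx mulr1 subr0.
  have [ms|ms] := leP m s.
    have /max_idPr -> : m - s <= 0 by rewrite subr_le0.
    by rewrite subr0; apply/max_idPl.
  have /max_idPl -> : 0 <= m - s by rewrite subr_ge0 ltW.
  by rewrite subKr; apply/max_idPl.
rewrite IHl ?le_min ?m0 ?s0//; split.
  move=> [|[mu mul fmu]]; last by right; exists mu; rewrite ?inE ?mul ?orbT.
  case: (leP m s) => [_ ->|_ s_eq0]; first by left.
  by right; exists nu; [rewrite inE eqxx|exact/(hinge_sum_eq0 _ _ m)].
move=> [->|[mu]]; first by left; apply/min_idPl.
rewrite inE => /orP[/eqP ->|mul fmu]; last by right; exists mu.
by move=> /hinge_sum_eq0 -/(_ m); rewrite -/s => ->; left; apply/min_idPr.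
Qed.

Lemma union_netP l x : unit_cube x ->
  (realization (union_net l) x 0 0 = 1 <-> exists2 nu, nu \in l & fragment nu x).
Proof.
move=> x01; rewrite /= mul_col_mx mul1mx mul0mx shifted_relu_col shifted_relu_id; last first.
  by move=> i k; rewrite (ord1 k); have /andP[] := x01 i.
have -> : shifted_relu (const_mx (-1)) 0 = const_mx 1 :> 'cV[R]_1.
  by apply/colP => i; rewrite !mxE opprK add0r; apply/max_idPl.
rewrite realization_union_steps//; split; last by right.
by move=> [/eqP|//]; rewrite oner_eq0.
Qed.

Lemma depth_union_net l : depth (union_net l) = (\sum_(nu <- l) (depth (Phi nu) + 4) + 2)%N.
Proof.
rewrite /=; elim: l => [|nu l IHl]; first by rewrite big_nil.
by rewrite big_cons [union_steps _]/= depth_min_step; lia.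
Qed.

Lemma sparsity_union_net l : (sparsity (union_net l) <=
  \sum_(nu <- l) (sparsity (Phi nu) +
      (n.-1 + (n + n) + (n + 1) + 2) ^ 2 * 16 * (depth (Phi nu)).+1) +
    ((n + 1) * n + 2 * n + 4))%N.
Proof.
rewrite /= nonzeros_col_mx nonzeros_col_mx !nonzeros0.
have := nonzeros_le (1%:M : 'M[R]_n); have := nonzeros_le (const_mx (-1) : 'cV[R]_1).
set u := nonzeros _; set v := nonzeros _ => u1 v1.
suff : (sparsity (union_steps l) <= \sum_(nu <- l) (sparsity (Phi nu) +
      (n.-1 + (n + n) + (n + 1) + 2) ^ 2 * 16 * (depth (Phi nu)).+1) + (n + 3))%N.
  by clearbody u v; lia.
clear; elim: l => [|nu l IHl].
  rewrite big_nil /= nonzerosN; have := nonzeros_le memory.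
  have := nonzeros_le (1%:M : 'M[R]_1); have := nonzeros_le (const_mx (-1) : 'cV[R]_1).
  by set u := nonzeros _; set v := nonzeros _; set w := nonzeros _; clearbody u v w; lia.
rewrite big_cons [union_steps _]/=.
apply: leq_trans (sparsity_min_step _ _ _ _ _ _) _.
by rewrite -/(union_steps l) -[leqRHS]addnA leq_add2l.
Qed.

Lemma weights_in_union_net (S : set R) l : S 0 -> S 1 ->
  (forall w, S w -> S (- w)) -> S theta ->
  (forall nu, nu \in l -> [/\ weights_in S (Phi nu), entries_in S (a nu),
     entries_in S (b nu) & S (c0 nu)]) ->
  weights_in S (union_net l).
Proof.
move=> S0 S1 SN Sth Sl /=; split.
- by apply: entries_in_col; [exact: entries_in1|exact: entries_in0].
- by apply: entries_in_col; [exact: entries_in0|apply: entries_in_const; exact: SN].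
have Smem : entries_in S memory.
  by apply: entries_in_row; [exact: entries_in0|exact: entries_in1].
elim: l Sl => [|nu l IHl] Sl /=.
  split; first exact: entries_inN.
    by apply: entries_in_const; exact: SN.
  exact: entries_in1.
have [SPhi Sa Sb Sc] := Sl nu (mem_head _ _).
apply: weights_in_min_step => //.
- apply: entries_in_col; apply: entries_in_row; try exact: entries_in0.
    by apply: entries_in_delta => //; case: (sgn nu); rewrite ?expr1 ?expr0 ?mulrN mulr1//; exact: SN.
  apply: entries_in_col; first exact: entries_in1.
  by apply: entries_inN => //; exact: entries_in1.
- apply: entries_in_col; first by apply: entries_in_const; exact: SN.
  by apply: entries_in_col => //; exact: entries_inN.
- apply: entries_in_row; last exact: entries_in0.
  by move=> i k; rewrite mxE; exact: entries_in1.
- by apply: IHl => mu mul; apply: Sl; rewrite inE mul orbT.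
Qed.

End union_network.

(** * Flat Hoelder functions *)

Section flat.
Context (R : realType).

Lemma within_quotient_ball (F : R -> R) (l u e : R) :
  (F v - F u) / (v - u) @[v --> within `[0, 1] u^'] --> l -> 0 < e ->
  exists2 delta : R, 0 < delta & forall v, 0 <= v <= 1 -> v != u ->
    `|u - v| < delta -> `|l - (F v - F u) / (v - u)| < e.
Proof.
move=> /cvgrPdist_lt /[apply]; rewrite near_withinE => /nbhs_ballP[delta /= d0 Hd].
exists delta => // v v01 vu uv; exact: (Hd v).
Qed.

(** Derivatives are known only through quotients within [0, 1], one-sided at the ends. Bounded
    quotients near a point give continuity on [0, h]; at interior points the restriction is
    invisible, so the usual mean value theorem applies. *)
Lemma within_quotient_MVT (F F' : R -> R) :
  (forall u, 0 <= u <= 1 ->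
     (F v - F u) / (v - u) @[v --> within `[0, 1] u^'] --> F' u) ->
  forall h, 0 < h <= 1 -> exists2 c, 0 < c < h & F h - F 0 = F' c * h.
Proof.
move=> FF' h /andP[h0 h1].
have cF : {within `[0, h], continuous F}.
  apply/subspace_continuousP => u /=; rewrite in_itv/= => /andP[u0 uh].
  have u01 : 0 <= u <= 1 by rewrite u0 (le_trans uh).
  have [delta d0 Hd] := within_quotient_ball (FF' u u01) ltr01.
  apply/cvgrPdist_lt => e e0; rewrite near_withinE.
  pose K := `|F' u| + 1.
  have K0 : 0 < K by rewrite ltr_wpDl.
  apply/nbhs_ballP; exists (Num.min delta (e / K)) => /=.
    by rewrite lt_min d0 divr_gt0.
  move=> v; rewrite /ball/= lt_min => /andP[uvd uve]; rewrite in_itv/= => /andP[v0 vh].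
  have [->|vu] := eqVneq v u; first by rewrite subrr normr0.
  have v01 : 0 <= v <= 1 by rewrite v0 (le_trans vh).
  have := Hd v v01 vu uvd => q1.
  have qK : `|(F v - F u) / (v - u)| < K.
    have := ler_distD 0 ((F v - F u) / (v - u)) (F' u).
    rewrite -[X in `|X| < K](subrK (F' u)) /K => _.
    by rewrite (le_lt_trans (ler_normD _ _))// addrC ltrD2l distrC.
  have vu0 : 0 < `|v - u| by rewrite normr_gt0 subr_eq0.
  rewrite distrC; move: qK; rewrite normrM normfV ltr_pdivrMr// => /lt_le_trans; apply.
  by rewrite mulrC -ler_pdivlMr// distrC ltW.
suff drv x : x \in `]0, h[ -> is_derive x 1 F (F' x).
  have [c] := MVT h0 drv cF; rewrite in_itv/= => c0h E.
  by exists c => //; rewrite E subr0.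
rewrite in_itv/= => /andP[x0 xh].
have x01 : 0 <= x <= 1 by rewrite !ltW// (lt_le_trans xh).
have x1 : x < 1 by rewrite (lt_le_trans xh).
have lim : k^-1 *: ((F \o shift x) (k *: (1 : R)) - F x) @[k --> 0^'] --> F' x.
  apply/cvgrPdist_lt => e e0; have [delta d0 Hd] := within_quotient_ball (FF' x x01) e0.
  apply/nbhs_ballP; exists (Num.min delta (Num.min x (1 - x))) => /=.
    by rewrite !lt_min d0 x0 subr_gt0.
  move=> k; rewrite /ball/= sub0r normrN !lt_min => /and3P[kd kx k1] k0.
  have /= := Hd (k + x); rewrite addrK [k *: 1]mulr1 [_^-1 *: _]mulrC; apply.
  - move: kx k1; rewrite !ltr_norml => /andP[? ?] /andP[? ?].
    by apply/andP; split; lra.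
  - by rewrite -subr_eq0 addrK.
  - by rewrite opprD addrCA subrr addr0 normrN.
by apply: DeriveDef; [apply/cvg_ex; exists (F' x)|exact/cvg_lim].
Qed.

Lemma const_mx_norm1 (u : R) : `|const_mx u : 'cV[R]_1| = `|u|.
Proof.
rewrite [LHS]mx_normrE; apply/eqP; rewrite eq_le; apply/andP; split.
  by apply: bigmax_le => // -[i j] _; rewrite mxE.
have := le_bigmax 0 (fun ij : 'I_1 * 'I_1 => `|(const_mx u : 'cV[R]_1) ij.1 ij.2|) (0, 0).
by rewrite mxE.
Qed.

(** A summand is bounded by the sum once the others are nonnegative. Here 0 < s supplies two
    distinct points of the cube; otherwise the seminorm would be the supremum of the empty set,
    which is -oo. *)
Lemma holder_norm_seminorm s (beta B : R) (D : multi_index s -> 'cV[R]_s -> R)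
    (a : {ffun 'I_s -> 'I_(holder_order beta).+1}) :
  (0 < s)%N -> mi_order (small_index a) = holder_order beta ->
  (holder_norm beta D <= B%:E)%E ->
  (holder_seminorm (beta - (holder_order beta)%:R) (D (small_index a)) <= B%:E)%E.
Proof.
move=> s0 am; apply: le_trans; rewrite /holder_norm.
have semi0 (b : multi_index s) :
    (0 <= holder_seminorm (beta - (holder_order beta)%:R) (D b))%E.
  have p01 (u : R) : 0 <= u <= 1 -> unit_cube (const_mx u : 'cV[R]_s).
    by move=> u01 i; rewrite mxE.
  apply: le_trans (ereal_sup_ubound _); last first.
    exists (const_mx 0, const_mx 1) => //=; split.
    - by apply: p01; rewrite lexx ler01.
    - by apply: p01; rewrite lexx ler01.
    - move=> /matrixP/(_ (Ordinal s0) 0); rewrite !mxE => /eqP.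
      by rewrite eq_sym oner_eq0.
  by rewrite lee_fin divr_ge0// powR_ge0.
rewrite [X in (_ + X)%E](bigD1 a)/=; last by rewrite am.
rewrite addeCA leeDl// adde_ge0//; last exact: sume_ge0.
apply: sume_ge0 => b _; apply: le_trans (ereal_sup_ubound _); last first.
  by exists 0 => //= i; rewrite mxE lexx ler01.
by rewrite lee_fin.
Qed.

(* Descending induction on the order of the derivative: the top one is Hoelder and
   all of them vanish at 0. *)
Lemma flat_class_bound (beta B : R) (g : 'cV[R]_1 -> R) (h : R) :
  0 < beta -> flat_class beta B g -> 0 <= h <= 1 ->
  g (const_mx h) <= B * h `^ beta.
Proof.
move=> beta0 [D [[_ [D0 Dpart] DB] Dflat]].
set m := holder_order beta in D0 Dpart DB Dflat.
have /andP[mb bm] := holder_orderP beta0; rewrite -/m in mb bm.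
pose idx k : multi_index 1 := [ffun=> k].
have idx_order k : mi_order (idx k) = k by rewrite /mi_order big_ord1 ffunE.
pose F k (u : R) := D (idx k) (const_mx u).
have cubeC u : 0 <= u <= 1 -> unit_cube (const_mx u : 'cV[R]_1).
  by move=> u01 i; rewrite mxE.
have F0 k : (k <= m)%N -> F k 0 = 0.
  move=> km; rewrite /F (_ : const_mx 0 = 0); last by apply/matrixP => i j; rewrite !mxE.
  by apply: Dflat; rewrite idx_order (le_lt_trans _ mb)// ler_nat.
have Fpart k : (k < m)%N -> forall u, 0 <= u <= 1 ->
    (F k v - F k u) / (v - u) @[v --> within `[0, 1] u^'] --> F k.+1 u.
  move=> km u u01; have := Dpart (idx k) 0; rewrite idx_order => /(_ km) /(_ (const_mx u) (cubeC u u01)).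
  rewrite (_ : mi_incr _ _ = idx k.+1); last first.
    by apply/ffunP => i; rewrite !ffunE (ord1 i) eqxx addn1.
  rewrite mxE -/(F k.+1 u); apply: cvg_trans; apply: near_eq_cvg.
  apply: nearW => v; congr ((D _ _ - _) / _).
  by apply/matrixP => i j; rewrite !mxE (ord1 i) eqxx.
have Fm u : 0 <= u <= 1 -> `|F m u| <= B * u `^ (beta - m%:R).
  move=> /andP[u0 u1]; have [->|un0] := eqVneq u 0.
    by rewrite F0// normr0 powR0 ?mulr0// subr_eq0 gt_eqF.
  pose a : {ffun 'I_1 -> 'I_m.+1} := [ffun=> ord_max].
  have aE : small_index a = idx m by apply/ffunP => i; rewrite !ffunE.
  have := @holder_norm_seminorm 1 beta B D a isT; rewrite aE => /(_ (idx_order m) DB).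
  move=> semi; have : ((`|F m u - F m 0| / `|u| `^ (beta - m%:R))%:E <= B%:E)%E.
    apply: le_trans semi; apply: ereal_sup_ubound; exists (const_mx u, const_mx 0) => /=.
      split; [by apply: cubeC; rewrite u0|by apply: cubeC; rewrite lexx ler01|].
      by move=> /matrixP/(_ 0 0); rewrite !mxE => /eqP; rewrite (negPf un0).
    congr (_ / _ `^ _)%:E; rewrite -const_mx_norm1; congr `|_|.
    by apply/matrixP => i j; rewrite !mxE subr0.
  rewrite lee_fin F0// subr0 (ger0_norm u0) ler_pdivrMr// powR_gt0//.
  by rewrite lt_def un0.
have Fk k : (k <= m)%N -> forall u, 0 <= u <= 1 ->
    `|F (m - k)%N u| <= B * u `^ (beta - (m - k)%:R).
  elim: k => [|k IHk] km u u01; first by rewrite subn0; exact: Fm.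
  have mk : (m - k = (m - k.+1).+1)%N by lia.
  have [->|un0] := eqVneq u 0.
    rewrite F0 ?leq_subr// normr0 powR0 ?mulr0// subr_eq0 gt_eqF//.
    by rewrite (le_lt_trans _ mb)// ler_nat leq_subr.
  have u0 : 0 < u by rewrite lt_def un0; case/andP: u01.
  have FF' v : 0 <= v <= 1 -> (F (m - k.+1)%N w - F (m - k.+1)%N v) / (w - v)
      @[w --> within `[0, 1] v^'] --> F (m - k)%N v.
    by move=> v01; rewrite mk; apply: Fpart => //; lia.
  have u0' : 0 < u <= 1 by rewrite u0; case/andP: u01.
  have [c /andP[c0 cu]] := within_quotient_MVT FF' u0'.
  rewrite F0 ?leq_subr// subr0 => ->; rewrite normrM (gtr0_norm u0).
  have c01 : 0 <= c <= 1 by rewrite ltW//= (le_trans (ltW cu))//; case/andP: u01.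
  have B0 : 0 <= B.
    have := le_trans (normr_ge0 _) (Fm 1 _); rewrite powR1 mulr1; apply.
    by rewrite ler01 lexx.
  have kb : (m - k)%:R <= beta by rewrite (le_trans _ (ltW mb))// ler_nat leq_subr.
  have -> : beta - (m - k.+1)%:R = (beta - (m - k)%:R) + 1.
    by rewrite mk -natr1; ring.
  rewrite powRD; last by rewrite un0 implybT.
  rewrite (powRr1 (ltW u0)) mulrA ler_wpM2r ?(ltW u0)//.
  rewrite (le_trans (IHk _ _ c01)) ?(ltnW km)// ler_wpM2l//.
  by rewrite ge0_ler_powR ?subr_ge0 ?nnegrE ?(ltW c0) ?(ltW u0) ?(ltW cu).
move=> h01; have := Fk m (leqnn m) h h01; rewrite subnn subr0.
apply: le_trans; rewrite /F (_ : idx 0%N = [ffun=> 0%N])// D0; last exact: cubeC.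
exact: ler_norm.
Qed.

End flat.

(** * Lebesgue measure of thin sets *)

Section sections.
Context (R : realType).
Local Notation leb := (@lebesgue_measure R).

(** Tonelli for indicators: it permits integrating over the second factor last, which is needed when
    the thin coordinate is the first one. *)
Lemma product_measureE d1 d2 (T1 : measurableType d1) (T2 : measurableType d2)
    (m1 : {sigma_finite_measure set T1 -> \bar R})
    (m2 : {sigma_finite_measure set T2 -> \bar R}) (A : set (T1 * T2)) :
  measurable A -> ((m1 \x m2) A = (m1 \x^ m2) A)%E.
Proof.
move=> mA; rewrite /product_measure1 /product_measure2.
by rewrite -indic_fubini_tonelli_FE// -indic_fubini_tonelli_GE//; exact: indic_fubini_tonelli.
Qed.

Lemma integral_le_support d (T : measurableType d)
    (mu : {measure set T -> \bar R}) (D : set T) (g : T -> \bar R) (c : R) :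
  measurable D -> measurable_fun setT g -> (forall x, 0 <= g x)%E ->
  (forall x, D x -> g x <= c%:E)%E -> (forall x, ~ D x -> g x = 0)%E ->
  (\int[mu]_x g x <= c%:E * mu D)%E.
Proof.
move=> mD mg g0 gc gD; rewrite -integral_cst// [leRHS]integral_mkcond.
apply: ge0_le_integral => //; first exact/(measurable_restrictT _ _).1.
move=> x _; rewrite /patch.
by case: ifPn => [/set_mem Dx|/negP Dx]; [exact: gc|rewrite gD// => /mem_set].
Qed.

Definition unit_tuples n : set (n.-tuple R) := [set z | forall i, 0 <= tnth z i <= 1].

Lemma measurable_unit_tuples n : measurable (@unit_tuples n).
Proof.
rewrite (_ : @unit_tuples n = \bigcap_(i in [set: 'I_n])
    ((fun z : n.-tuple R => tnth z i) @^-1` `[0, 1]%classic)); last first.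
  apply/seteqP; split => z zi i; first by move=> _ /=; rewrite in_itv/=; exact: zi.
  by have := zi i I; rewrite /= in_itv.
apply: fin_bigcap_measurable => // i _.
by rewrite -[X in measurable X]setTI; exact: measurable_tnth.
Qed.

Lemma power_lebesgue_unit n : power_measure leb n (@unit_tuples n) = 1%E.
Proof.
rewrite (_ : @unit_tuples n = [set z | forall i, `[0, 1]%classic (tnth z i)]); last first.
  by apply/seteqP; split => z zi i; have := zi i; rewrite /= in_itv.
rewrite (@power_measure_box _ _ _ leb n (fun=> `[0, 1]%classic))//.
rewrite big1//= => i _; rewrite lebesgue_measure_itv/=.
by rewrite lte_fin ltr01 oppr0 adde0.
Qed.

(** [A] lies in the interval of radius [w] around any of its points; the lost factor 2 only affects
    constants. *)
Lemma lebesgue_diameter (A : set R) w : measurable A -> 0 <= w ->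
  (forall x y, A x -> A y -> `|x - y| <= w) -> (leb A <= (2 * w)%:E)%E.
Proof.
move=> mA w0 Aw; have [->|/set0P[x Ax]] := eqVneq A set0.
  by rewrite measure0 lee_fin mulr_ge0.
apply: (@le_trans _ _ (leb `[x - w, x + w]%classic)).
  apply: le_measure; rewrite ?inE// => y Ay /=.
  by rewrite in_itv/= -ler_distlC; apply: Aw.
rewrite lebesgue_measure_itv/= lte_fin; case: ifPn => _.
  by rewrite -EFinD lee_fin; lra.
by rewrite lee_fin mulr_ge0.
Qed.

(** Induction peels off the head coordinate. If it is the thin one, its sections have measure at
    most 2w and are integrated over a unit cube; otherwise the induction hypothesis bounds the
    sections over it. *)
Lemma power_lebesgue_section n (j : 'I_n) (A : set (n.-tuple R)) (w : R) :
  measurable A -> A `<=` @unit_tuples n -> 0 <= w ->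
  (forall z z', A z -> A z' -> (forall i, i != j -> tnth z i = tnth z' i) ->
     `|tnth z j - tnth z' j| <= w) ->
  (power_measure leb n A <= (2 * w)%:E)%E.
Proof.
move=> + + w0; elim: n j A => [[]//|n IHn] j A mA A1 Aw.
rewrite /= /pushforward; set B := _ @^-1` A.
have mB : measurable B.
  by rewrite -[X in measurable X]setTI; exact: measurable_cons_pair.
have B1 x z : B (x, z) -> 0 <= x <= 1 /\ unit_tuples z.
  move=> /A1 Axz; split; first by have := Axz ord0.
  by move=> i; have := Axz (lift ord0 i); rewrite tnthS.
case: (unliftP ord0 j) Aw => [k ->|->] Aw; last first.
  rewrite product_measureE// /product_measure2.
  rewrite -[leRHS]mule1 -(power_lebesgue_unit n).
  apply: integral_le_support => //.
  - exact: measurable_unit_tuples.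
  - exact: measurable_fun_ysection.
  - move=> z _ /=; apply: lebesgue_diameter => //; first exact: measurable_ysection.
    move=> x y; rewrite /ysection/= !inE => Bx By.
    have := Aw _ _ Bx By; rewrite /cons_pair !tnth0; apply => i.
    by case: (unliftP ord0 i) => [k ->|->]; rewrite ?eqxx// !tnthS.
  - move=> z zU /=; rewrite (_ : ysection B z = set0) ?measure0// -subset0 => x.
    by rewrite /ysection/= inE => /B1[].
rewrite /product_measure1 -[leRHS]mule1.
have -> : 1%E = leb `[0, 1]%classic :> \bar R.
  by rewrite lebesgue_measure_itv/= lte_fin ltr01 oppr0 adde0.
apply: integral_le_support => //.
- exact: measurable_fun_xsection.
- move=> x _ /=; apply: (IHn k) => //; first exact: measurable_xsection.
    by move=> z; rewrite /xsection/= inE => /B1[].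
  move=> z z'; rewrite /xsection/= !inE => Bz Bz' zz'.
  have := Aw _ _ Bz Bz'; rewrite /cons_pair !tnthS; apply => i.
  case: (unliftP ord0 i) => [l ->|->]; last by rewrite !tnth0.
  by rewrite !tnthS => lk; apply: zz'; apply: contraNneq lk => ->.
- move=> x xU /=; rewrite (_ : xsection B x = set0) ?measure0// -subset0 => z.
  by rewrite /xsection/= inE => /B1[]; rewrite /= in_itv/= in xU *.
Qed.

Lemma lebesgue_cV_section n (j : 'I_n) (A : set 'cV[R]_n) (w : R) :
  measurable A -> A `<=` unit_cube -> 0 <= w ->
  (forall x y, A x -> A y -> (forall i, i != j -> x i 0 = y i 0) ->
     `|x j 0 - y j 0| <= w) ->
  (lebesgue_cV A <= (2 * w)%:E)%E.
Proof.
move=> mA A1 w0 Aw; rewrite /lebesgue_cV /pushforward.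
apply: (@power_lebesgue_section n j) => //.
- by rewrite -[X in measurable X]setTI; exact: measurable_col_of_tuple.
- by move=> z /A1 zA i; have := zA i; rewrite /col_of_tuple mxE.
- move=> z z' /= zA zA' zz'; have := Aw _ _ zA zA'; rewrite !mxE; apply => i ij.
  by rewrite !mxE zz'.
Qed.

(** The intersection is again a box, and the point [x] makes each of its sides nondegenerate, so its
    volume is positive. *)
Lemma boxes_overlap n (a1 b1 a2 b2 x : 'cV[R]_n) :
  (forall i, a2 i 0 < b2 i 0) -> (forall i, a1 i 0 < x i 0 < b1 i 0) ->
  box a2 b2 x -> lebesgue_cV (box a1 b1 `&` box a2 b2) <> 0%E.
Proof.
move=> ab2 x1 x2.
pose a i := Num.max (a1 i 0) (a2 i 0); pose b i := Num.min (b1 i 0) (b2 i 0).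
have ab i : a i < b i.
  rewrite /a /b gt_max !lt_min; have := ab2 i; have := x1 i; have := x2 i.
  by move=> /andP[? ?] /andP[? ?] ?; apply/andP; split; apply/andP; split; lra.
rewrite (_ : box a1 b1 `&` box a2 b2 = [set y : 'cV[R]_n | forall i, `[a i, b i]%classic (y i 0)]); last first.
  apply/seteqP; split => y.
    move=> [y1 y2] i; rewrite /= in_itv/= ge_max le_min.
    by have /andP[-> ->] := y1 i; have /andP[-> ->] := y2 i.
  by move=> yab; split => i; have := yab i; rewrite /= in_itv/= ge_max le_min =>
    /andP[/andP[? ?] /andP[? ?]]; apply/andP.
rewrite (@lebesgue_cV_box R n (fun i => `[a i, b i]%classic))//; apply/eqP; rewrite gt_eqF//.
under eq_bigr do rewrite lebesgue_measure_itv/= lte_fin ab -EFinB.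
by rewrite prodEFin lte_fin prodr_gt0// => i _; rewrite subr_gt0.
Qed.

End sections.

(** * Risk and excess risk *)

Lemma measurable_unit_cube (R : realType) n : measurable (@unit_cube R n).
Proof.
rewrite (_ : unit_cube = \bigcap_(i in [set: 'I_n])
    ((fun x : 'cV[R]_n => x i 0) @^-1` `[0, 1]%classic)); last first.
  apply/seteqP; split => x xi i; first by move=> _ /=; rewrite in_itv/=; exact: xi.
  by have := xi i I; rewrite /= in_itv.
apply: fin_bigcap_measurable => // i _.
by rewrite -[X in measurable X]setTI; exact: measurable_entry.
Qed.

Section regression.
Context (R : realType) (n : nat) (Q : probability ('cV[R]_n * bool)%type R)
  (f : 'cV[R]_n -> R) (Qf : regression_function Q f).

Definition marginal : {measure set 'cV[R]_n -> \bar R} :=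
  measure_function_pushforward__canonical__measure_function_Measure Q
    (@measurable_fst _ _ 'cV[R]_n bool).

Definition weighted (A : set 'cV[R]_n) : \bar R :=
  (\int[marginal]_(x in A) `|2 * f x - 1|%:E)%E.

Let measurable_f : measurable_fun setT f. Proof. exact: Qf.1. Qed.

Lemma marginal_fin_num A : measurable A -> marginal A \is a fin_num.
Proof.
move=> mA; apply: (@fin_num_measure _ _ _ Q).
by rewrite -[X in measurable X]setTI; exact: measurable_fst.
Qed.

Lemma measurable_labelled (A : set 'cV[R]_n) (B : set bool) :
  measurable A -> measurable (A `*` B).
Proof. by move=> mA; exact: measurableX. Qed.

Lemma marginal_split A : measurable A ->
  marginal A = (Q (A `*` [set true]) + Q (A `*` [set false]))%E.
Proof.
move=> mA; rewrite -measureU//; try exact: measurable_labelled.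
  congr (Q _); apply/seteqP; split=> [[x []] /= Ax|[x y] /= [[]|[]]//];
    by [left|right].
by rewrite -subset0 => -[x y] /= [[_ ->] []].
Qed.

Lemma measurable_weight A : measurable_fun A (fun x => `|2 * f x - 1|%:E).
Proof.
apply: measurable_funTS; apply/measurable_EFinP.
apply: measurableT_comp => //; apply: measurable_funB => //.
exact: measurable_funM.
Qed.

Lemma measurable_regression A : measurable_fun A (fun x => (f x)%:E).
Proof. by apply: measurable_funTS; apply/measurable_EFinP. Qed.

Lemma measurable_set_lt (c : R) : measurable [set x | f x < c].
Proof.
rewrite (_ : mkset _ = f @^-1` `]-oo, c[%classic); last first.
  by apply/seteqP; split => x; rewrite /= in_itv.
by rewrite -[X in measurable X]setTI; exact: measurable_f.
Qed.

(* f is only assumed to represent Q(Y = 1 | X), hence may leave [0, 1] on a null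
   set. *)
Lemma marginal_negative : marginal [set x | f x < 0] = 0%E.
Proof.
set N := mkset _; have mN : measurable N by exact: measurable_set_lt.
have NE := Qf.2 N mN; rewrite -/marginal in NE.
have g0 : (\int[marginal]_(x in N) `|(f x)%:E| = 0)%E.
  apply/eqP; rewrite eq_le; apply/andP; split; last exact: integral_ge0.
  rewrite -oppe_ge0 -integral_ge0N//.
  rewrite [leRHS](_ : _ = Q (N `*` [set true])) ?measure_ge0// NE.
  apply: eq_integral => x; rewrite inE => Nx.
  by rewrite lee0_abs ?oppeK// lee_fin ltW.
have [A [mA A0 NA]] := (ae_eq_integral_abs marginal mN (measurable_regression (A:=N))).1 g0.
apply: (subset_measure0 mN mA) => // x Nx; apply: NA => /= /(_ Nx) /eqP.
by rewrite eqe lt_eqF.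
Qed.

Lemma weighted_negative A : measurable A -> weighted (A `&` [set x | f x < 0]) = 0%E.
Proof.
move=> mA; have mN := measurable_set_lt 0.
apply: null_set_integral; [exact: measurableI|exact: measurable_weight|].
apply: (subset_measure0 _ mN) => //; first exact: measurableI.
exact: marginal_negative.
Qed.

Lemma weightedU A B : measurable A -> measurable B -> [disjoint A & B] ->
  weighted (A `|` B) = (weighted A + weighted B)%E.
Proof.
move=> mA mB AB; apply: ge0_integral_setU => //; exact: measurable_weight.
Qed.

(** On [A] the weight is 2f - 1, so adding the marginal gives twice the integral of [f], which is
    twice the mass of label 1. One copy of that mass, being finite, then cancels. *)
Lemma weighted_upper A : measurable A -> (forall x, A x -> 1 / 2 <= f x) ->
  (weighted A + Q (A `*` [set false]) = Q (A `*` [set true]))%E.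
Proof.
move=> mA Af; have QA := Qf.2 A mA; rewrite -/marginal in QA.
have QAfin b : Q (A `*` [set b]) \is a fin_num.
  by apply: fin_num_measure; exact: measurable_labelled.
suff E : (weighted A + marginal A = Q (A `*` [set true]) + Q (A `*` [set true]))%E.
  move: E; rewrite marginal_split// [X in (_ + X)%E]addeC addeA.
  by move/(congr1 (fun u => u - Q (A `*` [set true]))%E); rewrite !addeK.
rewrite QA -[marginal A]mul1e -integral_cst// -!ge0_integralD//.
- apply: eq_integral => x; rewrite inE => /Af fx.
  by rewrite /= -!EFinD ger0_norm; [congr EFin; lra|lra].
- by move=> x /Af fx; rewrite lee_fin; lra.
- exact: measurable_regression.
- by move=> x /Af fx; rewrite lee_fin; lra.
- exact: measurable_regression.
- exact: measurable_weight.
Qed.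

(** The weight is now 1 - 2f. Additivity of the integral wants f >= 0, so [A] is first reduced to
    [P], which removes only a null set. *)
Lemma weighted_lower A : measurable A -> (forall x, A x -> f x < 1 / 2) ->
  (weighted A + Q (A `*` [set true]) = Q (A `*` [set false]))%E.
Proof.
move=> mA Af.
have QAfin B b : measurable B -> Q (B `*` [set b]) \is a fin_num.
  by move=> mB; apply: fin_num_measure; exact: measurable_labelled.
pose N := [set x | f x < 0]; have mN : measurable N := measurable_set_lt 0.
pose P := A `\` N; have mP : measurable P by exact: measurableD.
have mAN : measurable (A `&` N) by exact: measurableI.
have wA : weighted A = weighted P.
  rewrite -[in LHS](setUIDK A N) weightedU//; last first.
    by apply/disj_setPS => x [[_ Nx] [_]].
  by rewrite weighted_negative// add0e.
have QAN b : Q ((A `&` N) `*` [set b]) = 0%E.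
  have : (marginal (A `&` N) = 0)%E.
    by apply: (subset_measure0 _ mN) => //; exact: marginal_negative.
  rewrite marginal_split// => /eqP; rewrite padde_eq0// => /andP[/eqP ? /eqP ?].
  by case: b.
have QAb b : Q (A `*` [set b]) = Q (P `*` [set b]).
  rewrite (_ : A `*` [set b] = ((A `&` N) `*` [set b]) `|` (P `*` [set b])); last first.
    rewrite -[in LHS](setUIDK A N); apply/seteqP; split => -[x y] /=.
      by move=> [[?|?] ?]; [left|right].
    by move=> [[? ?]|[? ?]]; split => //; [left|right].
  transitivity (Q ((A `&` N) `*` [set b]) + Q (P `*` [set b]))%E; last by rewrite QAN add0e.
  apply: measureU.
  - exact: measurable_labelled.
  - exact: measurable_labelled.
  - by rewrite -subset0 => -[x y] /= [[[_ Nx] _] [[_]]].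
rewrite wA !QAb; have QP := Qf.2 P mP; rewrite -/marginal in QP.
suff E : (weighted P + (Q (P `*` [set true]) + Q (P `*` [set true])) = marginal P)%E.
  move: E; rewrite marginal_split// [RHS]addeC addeA.
  by move/(congr1 (fun u => u - Q (P `*` [set true]))%E); rewrite !addeK// QAfin.
have P0 x : P x -> 0 <= f x by move=> [_] /negP; rewrite -leNgt.
rewrite QP -[marginal P]mul1e -integral_cst// -!ge0_integralD//.
- apply: eq_integral => x; rewrite inE => Px; have := P0 _ Px; have := Af _ Px.1.
  by move=> ? ?; rewrite /= -!EFinD ler0_norm; [congr EFin; lra|lra].
all: try exact: measurable_weight.
all: try exact: measurable_regression.
all: try by apply: emeasurable_funD; exact: measurable_regression.
all: by move=> x /P0 fx; rewrite -?EFinD lee_fin ?addr_ge0.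
Qed.

(** The pointwise bound |2f - 1| <= 1 may fail on a null set, so the inequality is read off from the
    two preceding identities after splitting at f = 1/2. *)
Lemma weighted_le_marginal A : measurable A -> (weighted A <= marginal A)%E.
Proof.
move=> mA; pose L := [set x | f x < 1 / 2].
have mL : measurable L by exact: measurable_set_lt.
have mAL : measurable (A `&` L) by exact: measurableI.
have mAD : measurable (A `\` L) by exact: measurableD.
rewrite -[A in leLHS](setUIDK A L) weightedU//; last first.
  by apply/disj_setPS => x [[_ Nx] [_]].
have -> : marginal A = (marginal (A `\` L) + marginal (A `&` L))%E by exact: measureDI.
rewrite addeC; apply: leeD.
  rewrite marginal_split// -weighted_upper//; last first.
    by move=> x [_] /negP; rewrite -leNgt.
  by rewrite -addeA leeDl// adde_ge0.
rewrite marginal_split// -weighted_lower//; last by move=> x [].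
by rewrite addeCA leeDl// adde_ge0.
Qed.

Definition error_set (G : set 'cV[R]_n) : set ('cV[R]_n * bool) :=
  (G `*` [set false]) `|` (~` G `*` [set true]).

Lemma measurable_error_set G : measurable G -> measurable (error_set G).
Proof.
move=> mG; apply: measurableU; apply: measurable_labelled => //.
exact: measurableC.
Qed.

Lemma measurable_bayes : measurable (bayes_rule f).
Proof.
rewrite (_ : bayes_rule f = unit_cube `\` [set x | f x < 1 / 2]).
  by apply: measurableD; [exact: measurable_unit_cube|exact: measurable_set_lt].
by apply/seteqP; split => x /= [x1 fx]; split => //;
  move: fx; rewrite leNgt => /negP.
Qed.

(** Both classifiers agree off the symmetric difference, and each half of it is covered by one of
    the two identities above. Inclusion in the cube gives f < 1/2 on G minus the Bayes rule, since
    that rule contains cube points only. *)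
Lemma excess_risk G : measurable G -> G `<=` unit_cube ->
  Q (error_set G) = (Q (error_set (bayes_rule f)) + dist_f Q f G (bayes_rule f))%E.
Proof.
move=> mG G1; set H := bayes_rule f; have mH : measurable H := measurable_bayes.
have mA : measurable (H `\` G) by exact: measurableD.
have mB : measurable (G `\` H) by exact: measurableD.
have QE b (C : set 'cV[R]_n) : measurable C -> Q (C `*` [set b]) \is a fin_num.
  by move=> mC; apply: fin_num_measure; exact: measurable_labelled.
have Q_error (K : set 'cV[R]_n) : measurable K ->
    Q (error_set K) = (Q (K `*` [set false]) + Q (~` K `*` [set true]))%E.
  move=> mK; rewrite measureU//; try apply: measurable_labelled => //.
    exact: measurableC.
  by rewrite -subset0 => -[x y] /= [[_ ->] []].
have Q_split b (C K : set 'cV[R]_n) : measurable C -> measurable K ->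
    Q (C `*` [set b]) = (Q ((C `\` K) `*` [set b]) + Q ((C `&` K) `*` [set b]))%E.
  move=> mC mK; rewrite (measureDI _ (measurable_labelled [set b] mC) (measurable_labelled setT mK)).
  by congr (_ + _)%E; congr (Q _); apply/seteqP; split => -[x y] /= => [[[? ?] ?]|[[? ?] ?]];
    do ?split => //; tauto.
have -> : dist_f Q f G H = (weighted (G `\` H) + weighted (H `\` G))%E.
  rewrite /dist_f setY_def -/marginal -weightedU//.
  by apply/disj_setPS => x [[Gx _] [_]].
have wA := @weighted_upper (H `\` G) mA (fun x xA => xA.1.2).
have wB := @weighted_lower (G `\` H) mB.
have {}wB : (weighted (G `\` H) + Q ((G `\` H) `*` [set true]) = Q ((G `\` H) `*` [set false]))%E.
  apply: wB => x [Gx nHx]; rewrite ltNge; apply/negP => fx; apply: nHx; split => //.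
  exact: G1.
rewrite !Q_error// (Q_split _ G H)// (Q_split _ (~` G) H)//; last exact: measurableC.
rewrite (Q_split _ H G)// (Q_split _ (~` H) G)//; last exact: measurableC.
have -> : ~` G `\` H = ~` H `\` G by rewrite !setDE setIC.
have -> : ~` G `&` H = H `\` G by rewrite setDE setIC.
have -> : ~` H `&` G = G `\` H by rewrite setDE setIC.
rewrite -wA -wB (setIC H G).
have wfin (C : set 'cV[R]_n) : measurable C -> weighted C \is a fin_num.
  move=> mC; rewrite ge0_fin_numE ?integral_ge0//.
  by rewrite (le_lt_trans (weighted_le_marginal mC))// ltey_eq marginal_fin_num.
have mCD : measurable (~` H `\` G) by apply: measurableD => //; exact: measurableC.
have mI : measurable (G `&` H) by exact: measurableI.
move: (wfin _ mA) (wfin _ mB) (QE true _ mB) (QE false _ mA) (QE false _ mI) (QE true _ mCD).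
move: (weighted _) (weighted _) (Q _) (Q _) (Q _) (Q _).
move=> [a| |]// [b| |]// [c| |]// [d| |]// [e| |]// [g| |]// _ _ _ _ _ _.
by rewrite -!EFinD; congr EFin; ring.
Qed.

End regression.

(** * Geometry of misclassified points *)

Section fragment_geometry.
Context (R : realType) (n u : nat) (j : 'I_u -> 'I_n) (sgn : 'I_u -> bool)
  (gamma N : 'I_u -> 'cV[R]_n.-1 -> R) (a b a' b' : 'I_u -> 'cV[R]_n)
  (theta eps eta width : R) (c0 : 'I_u -> R).
Local Notation oriented nu x := ((-1) ^+ sgn nu * x (j nu) 0).

(** Ends of the range of the oriented coordinate over the box; a negative orientation swaps and
    negates them. *)
Definition lower_end nu : R := if sgn nu then - b nu (j nu) 0 else a nu (j nu) 0.
Definition upper_end nu : R := if sgn nu then - a nu (j nu) 0 else b nu (j nu) 0.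

Definition exact_piece nu : set 'cV[R]_n := box (a nu) (b nu) `&`
  [set x | unit_cube x /\ oriented nu x <= gamma nu (row' (j nu) x)].

Definition exact_union : set 'cV[R]_n := \bigcup_nu exact_piece nu.

Definition approx_union : set 'cV[R]_n :=
  [set x | unit_cube x /\ exists nu, box (a' nu) (b' nu) x /\
     theta * oriented nu x + c0 nu <= N nu (row' (j nu) x)].

Definition face_strip : set 'cV[R]_n :=
  [set x | exists nu i, `|x i 0 - a nu i 0| <= eta \/ `|x i 0 - b nu i 0| <= eta].

Context (ab : forall nu i, 0 <= a nu i 0 /\ a nu i 0 < b nu i 0 <= 1)
  (boxes_disjoint : forall nu1 nu2, nu1 <> nu2 ->
     lebesgue_cV (box (a nu1) (b nu1) `&` box (a nu2) (b nu2)) = 0%E)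
  (aa' : forall nu i, `|a nu i 0 - a' nu i 0| <= eta)
  (bb' : forall nu i, `|b nu i 0 - b' nu i 0| <= eta)
  (gammaN : forall nu y, unit_cube y -> `|N nu y - gamma nu y| <= eps)
  (theta01 : 0 <= theta <= 1)
  (c0_lower : forall nu, lower_end nu + eps < theta * lower_end nu + c0 nu)
  (c0_upper : forall nu, theta * upper_end nu + c0 nu <= upper_end nu - eps)
  (theta_c0 : forall nu (s : R), `|s| <= 1 -> `|theta * s + c0 nu - s| + eps <= width).

Lemma sign_sqr nu (s : R) : (-1) ^+ sgn nu * ((-1) ^+ sgn nu * s) = s.
Proof. by rewrite mulrA -expr2 sqrr_sign mul1r. Qed.

Lemma sign_norm nu (s : R) : `|(-1) ^+ sgn nu * s| = `|s|.
Proof. by rewrite normrMsign. Qed.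

Lemma oriented_itv nu (x : 'cV[R]_n) : a nu (j nu) 0 < x (j nu) 0 < b nu (j nu) 0 <->
  lower_end nu < oriented nu x < upper_end nu.
Proof.
rewrite /lower_end /upper_end; case: (sgn nu); rewrite /= ?expr1 ?expr0 ?mulN1r ?mul1r//.
by rewrite !ltrN2 andbC.
Qed.

Lemma interior_box nu (x : 'cV[R]_n) : box (a nu) (b nu) x -> ~ face_strip x ->
  forall i, a nu i 0 < x i 0 < b nu i 0.
Proof.
move=> xab xS i; have /andP[xa xb] := xab i; have eta0 := le_trans (normr_ge0 _) (aa' nu i).
rewrite !lt_def xa xb !andbT; apply/andP; split; apply/eqP => E; apply: xS; exists nu, i.
  by left; rewrite E subrr normr0.
by right; rewrite E subrr normr0.
Qed.

Lemma interior_not_in_box nu mu (x : 'cV[R]_n) : (forall i, a nu i 0 < x i 0 < b nu i 0) ->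
  box (a mu) (b mu) x -> mu = nu.
Proof.
move=> xnu xmu; apply/eqP/negPn/negP => /eqP munu.
apply: (boxes_overlap _ xnu xmu (boxes_disjoint (nesym munu))) => i.
by have [_ /andP[]] := ab mu i.
Qed.

(** Off the strips [x] is farther than [eta] from every face, while rounding moves a face by at most
    [eta]. *)
Lemma box_approx nu (x : 'cV[R]_n) : ~ face_strip x -> box (a nu) (b nu) x <-> box (a' nu) (b' nu) x.
Proof.
move=> xS; split => xab i; have /andP[xa xb] := xab i.
  have [xa' xb'] : eta < `|x i 0 - a nu i 0| /\ eta < `|x i 0 - b nu i 0|.
    by split; rewrite ltNge; apply/negP => h; apply: xS; exists nu, i; [left|right].
  move: xa' xb' (aa' nu i) (bb' nu i).
  rewrite ger0_norm ?subr_ge0// ler0_norm ?subr_le0// !ler_norml.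
  by move=> ? ? /andP[? ?] /andP[? ?]; apply/andP; split; lra.
have [xa' xb'] : eta < `|x i 0 - a nu i 0| /\ eta < `|x i 0 - b nu i 0|.
  by split; rewrite ltNge; apply/negP => h; apply: xS; exists nu, i; [left|right].
move: xa' xb' (aa' nu i) (bb' nu i); rewrite !ler_norml !lter_normr => /orP h1 /orP h2.
by move=> /andP[? ?] /andP[? ?]; apply/andP; split; [case: h1|case: h2]; lra.
Qed.

(** Off the strips no other box interferes, and the two sets differ only by comparing s with g or
    theta s + c0 with the network. That g falls in the range of the box is what supplies a boundary
    point for the flatness condition. *)
Lemma misclassified nu (x : 'cV[R]_n) : unit_cube x -> ~ face_strip x -> box (a nu) (b nu) x ->
  (approx_union `+` exact_union) x ->
  let g := gamma nu (row' (j nu) x) in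
  lower_end nu <= g < upper_end nu /\ `|oriented nu x - g| <= width.
Proof.
move=> x01 xS xD xGH g; have xint := interior_box xD xS.
have /andP[lo hi] := (oriented_itv nu x).1 (xint (j nu)).
set s := oriented nu x in lo hi *.
have s1 : `|s| <= 1.
  by rewrite sign_norm ger0_norm; have /andP[] := x01 (j nu).
have inH : exact_union x <-> s <= g.
  split => [[mu _ [xmu [_ le_g]]]|sg]; last by exists nu.
  by rewrite (interior_not_in_box xint xmu) in le_g.
have inG : approx_union x <-> theta * s + c0 nu <= N nu (row' (j nu) x).
  split => [[_ [mu [xmu le_N]]]|sN].
    by rewrite (interior_not_in_box xint ((box_approx mu xS).2 xmu)) in le_N.
  by split => //; exists nu; split => //; exact: (box_approx nu xS).1.
have y01 : unit_cube (row' (j nu) x).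
  by move=> i; rewrite mxE; exact: x01.
have := gammaN nu y01; rewrite -/g ler_norml => /andP[gN1 gN2].
have := theta_c0 nu s1 => w_s.
have := ler_norm (theta * s + c0 nu - s) => w1.
have := ler_norm (- (theta * s + c0 nu - s)); rewrite normrN => w2.
have /andP[th0 th1] := theta01.
have ths_lo : theta * lower_end nu <= theta * s by rewrite ler_wpM2l// ltW.
have ths_hi : theta * s <= theta * upper_end nu by rewrite ler_wpM2l// ltW.
have cl := c0_lower nu; have cu := c0_upper nu.
move: (N nu (row' (j nu) x)) inG gN1 gN2 => Nx inG gN1 gN2.
move: xGH; rewrite setY_def => -[[/inG xG nH]|[/inH xH nG]].
  have sg : g < s by rewrite ltNge; apply/negP => /inH.
  split; last by rewrite gtr0_norm ?subr_gt0//; lra.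
  (* If g were below the lower end, the network value, at most g + eps, would be below theta lo + c0
     <= theta s + c0, and [x] would not be in the approximate set. *)
  by apply/andP; split; [|lra]; rewrite leNgt; apply/negP => g_lo; lra.
have sN : Nx < theta * s + c0 nu by rewrite ltNge; apply/negP => /inG.
split; last by rewrite ler0_norm ?subr_le0//; lra.
(* If g were at or above the upper end, the network value would be at least hi - eps >= theta hi +
   c0 >= theta s + c0, and [x] would be in the approximate set. *)
by apply/andP; split; [lra|]; rewrite ltNge; apply/negP => g_hi; lra.
Qed.

(** The point z on the graph belongs to the exact union. Slightly beyond it in the oriented
    direction one is outside the fragment but still interior to the box, so no other fragment can
    contain the point. The strict bound g < [upper_end nu] leaves room for this. *)
Lemma misclassified_boundary nu (x : 'cV[R]_n) : unit_cube x -> ~ face_strip x ->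
  box (a nu) (b nu) x ->
  let g := gamma nu (row' (j nu) x) in
  lower_end nu <= g < upper_end nu ->
  let z := set_coord x (j nu) ((-1) ^+ sgn nu * g) in
  box (a nu) (b nu) z /\ cube_boundary exact_union z.
Proof.
move=> x01 xS xD g /andP[lo hi] z; have xint := interior_box xD xS.
pose pt h := set_coord x (j nu) ((-1) ^+ sgn nu * (g + h)).
have zE : z = pt 0 by rewrite /pt addr0.
have row_pt h : row' (j nu) (pt h) = row' (j nu) x.
  by apply/colP => i; rewrite !mxE eq_sym (negPf (neq_lift _ _)).
have pt_j h : oriented nu (pt h) = g + h by rewrite mxE eqxx sign_sqr.
have pt_box h : 0 <= h -> g + h < upper_end nu -> box (a nu) (b nu) (pt h).
  move=> h0 gh i; rewrite mxE; case: eqP => [->|_]; last exact: xD.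
  move: lo gh; rewrite /lower_end /upper_end; case: (sgn nu); rewrite /= ?expr1 ?expr0 ?mulN1r ?mul1r => lo gh.
    by apply/andP; split; lra.
  by apply/andP; split; lra.
have pt01 h : box (a nu) (b nu) (pt h) -> unit_cube (pt h).
  move=> pth i; have /andP[h1 h2] := pth i; have [a0 /andP[_ b1]] := ab nu i.
  by rewrite (le_trans a0)//= (le_trans h2).
have pt_int h : 0 < h -> g + h < upper_end nu -> forall i, a nu i 0 < pt h i 0 < b nu i 0.
  move=> h0 gh i; have [->|ij] := eqVneq i (j nu); last by rewrite mxE (negPf ij).
  by apply/oriented_itv; rewrite pt_j gh andbT (le_lt_trans lo)// ltrDl.
have zD : box (a nu) (b nu) z by rewrite zE; apply: pt_box; rewrite ?addr0.
have z01 : unit_cube z by rewrite zE in zD *; exact: pt01.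
split => //; split; first split => //.
- apply: subset_closure; split => //; exists nu => //; split => //; split => //.
  by rewrite zE row_pt pt_j addr0.
- move=> V /nbhs_ballP[e /= e0 eV].
  (* Small enough to stay in the ball and strictly below the upper end of the box. *)
  pose h := Num.min (e / 2) ((upper_end nu - g) / 2).
  have ug0 : 0 < upper_end nu - g by rewrite subr_gt0.
  have h0 : 0 < h by rewrite lt_min !divr_gt0.
  have he : h < e by rewrite gt_min ltr_pdivrMr// ltr_pMr// ltr1n.
  have hg : g + h < upper_end nu.
    have : h <= (upper_end nu - g) / 2 by rewrite ge_min lexx orbT.
    lra.
  exists (pt h); split; last first.
    apply: eV; rewrite zE; split => // i k; rewrite (ord1 k) !mxE /ball/=; case: eqP => _.
      by rewrite -mulrBr sign_norm opprD addrACA subrr add0r sub0r normrN gtr0_norm// ltW.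
    by rewrite subrr normr0.
  split; first by apply: pt01; apply: pt_box => //; exact: ltW.
  move=> [mu _ [ptmu [_]]]; rewrite (interior_not_in_box (pt_int h h0 hg) ptmu).
  by rewrite row_pt pt_j gerDl leNgt h0.
Qed.

End fragment_geometry.

(** * Empirical risk minimization *)

Section chernoff.
Context d (T : measurableType d) (R : realType) (P : probability T R).

Lemma measurable_prod_tnth n (h : T -> R) : measurable_fun setT h ->
  measurable_fun setT (fun z : n.-tuple T => \prod_(i < n) h (tnth z i)).
Proof.
move=> mh; apply: measurable_prod => i _.
by apply: measurableT_comp => //; exact: measurable_tnth.
Qed.

(** Independence, obtained from Tonelli one coordinate at a time; a bound on the single factor is
    all that the Chernoff argument needs. *)
Lemma power_integral_prod n (h : T -> R) (b : R) : measurable_fun setT h ->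
  (forall x, 0 <= h x) -> 0 <= b -> (\int[P]_x (h x)%:E <= b%:E)%E ->
  (\int[power_measure P n]_z (\prod_(i < n) h (tnth z i))%:E <= (b ^+ n)%:E)%E.
Proof.
move=> mh h0 b0 hb; elim: n => [|n IHn].
  under eq_integral do rewrite big_ord0.
  by rewrite (integral_cst (power_measure P 0)) ?expr0//= probability_setT mul1e.
have prod0 k (z : k.-tuple T) : 0 <= \prod_(i < k) h (tnth z i) by exact: prodr_ge0.
rewrite /= (ge0_integral_pushforward (measurable_cons_pair (T:=T) (n:=n)) (P \x power_measure P n)%E)//.
- rewrite preimage_setT fubini_tonelli1/=.
  + have inner x : (\int[power_measure P n]_z ((fun z : n.+1.-tuple T =>
        (\prod_(i < n.+1) h (tnth z i))%:E) \o cons_pair (n:=n)) (x, z) <= (b ^+ n)%:E * (h x)%:E)%E.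
      rewrite [leLHS](_ : _ = (h x)%:E * \int[power_measure P n]_z (\prod_(i < n) h (tnth z i))%:E)%E.
        by rewrite muleC lee_wpmul2r// lee_fin.
      rewrite -ge0_integralZl_EFin//.
      * apply: eq_integral => z _ /=; rewrite big_ord_recl /cons_pair tnth0 -EFinM.
        by congr (_ * _)%:E; apply: eq_bigr => i _; rewrite tnthS.
      * by move=> z _; rewrite lee_fin.
      * by apply/measurable_EFinP; exact: measurable_prod_tnth.
    apply: (@le_trans _ _ (\int[P]_x ((b ^+ n)%:E * (h x)%:E))%E).
      apply: ge0_le_integral => //.
      * by move=> x _; rewrite /fubini_F; apply: integral_ge0 => z _ /=; rewrite lee_fin prodr_ge0.
      * apply: measurable_fun_fubini_tonelli_F => //=.
          apply: (measurableT_comp (f := fun z : n.+1.-tuple T => (\prod_(i < n.+1) h (tnth z i))%:E)).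
            by apply/measurable_EFinP; exact: measurable_prod_tnth.
          exact: measurable_cons_pair.
        by move=> xz /=; rewrite lee_fin prodr_ge0.
      * by apply: measurable_funeM; exact/measurable_EFinP.
      * by move=> x _; exact: inner.
    rewrite ge0_integralZl_EFin ?exprn_ge0//.
    * by rewrite exprSr EFinM lee_wpmul2l// lee_fin exprn_ge0.
    * by move=> x _; rewrite lee_fin.
    * exact/measurable_EFinP.
  + apply: (measurableT_comp (f := fun z : n.+1.-tuple T => (\prod_(i < n.+1) h (tnth z i))%:E)).
      by apply/measurable_EFinP; exact: measurable_prod_tnth.
    exact: measurable_cons_pair.
  + by move=> xz /=; rewrite lee_fin prodr_ge0.
- by apply/measurable_EFinP; exact: measurable_prod_tnth.
- by move=> z _; rewrite lee_fin prodr_ge0.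
Qed.

Lemma expR_le_quadratic (x : R) : 0 <= x <= 1 / 2 -> expR x <= 1 + x + 2 * x ^+ 2.
Proof.
move=> /andP[x0 x1]; have xN := expR_ge1Dx (- x).
have : expR x <= (1 - x)^-1.
  by rewrite -[x in expR x]opprK expRN lef_pV2 ?posrE ?expR_gt0//; lra.
move/le_trans; apply; rewrite -[_^-1]mul1r ler_pdivrMr; last by lra.
(* After multiplication by 1 - x the two sides differ by x^2 (1 - 2x), whence the range up to
   1/2. *)
have x2 : 0 <= 1 - 2 * x by lra.
by have := mulr_ge0 (mulr_ge0 x0 x0) x2; lra.
Qed.

Lemma expRN_le_quadratic (x : R) : 0 <= x -> expR (- x) <= 1 - x + 2 * x ^+ 2.
Proof.
move=> x0; have xN := expR_ge1Dx x.
have : expR (- x) <= (1 + x)^-1.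
  by rewrite expRN lef_pV2 ?posrE ?expR_gt0//; lra.
move/le_trans; apply; rewrite -[_^-1]mul1r ler_pdivrMr; last by lra.
have := mulr_ge0 x0 x0; have := mulr_ge0 x0 (mulr_ge0 x0 x0); lra.
Qed.

(** Exponential Markov inequality for a walk with independent steps 1, -1, 0 on [U], [V] and the
    rest. The step has mean u - v and second moment u + v, and the quadratic bounds on the
    exponential control its moment generating function. *)
Lemma power_chernoff n (U V : set T) (A : set (n.-tuple T)) (l u v : R) :
  measurable U -> measurable V -> U `&` V = set0 -> measurable A ->
  0 <= l <= 1 / 2 -> P U = u%:E -> P V = v%:E ->
  (forall z, A z -> 0 <= \sum_(i < n) (\1_U (tnth z i) - \1_V (tnth z i) : R)) ->
  (power_measure P n A <= (expR (n%:R * (l * (u - v) + 2 * l ^+ 2 * (u + v))))%:E)%E.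
Proof.
move=> mU mV UV mA l01 PU PV AUV.
have /andP[l0 _] := l01.
have u0 : 0 <= u by rewrite -lee_fin -PU.
have v0 : 0 <= v by rewrite -lee_fin -PV.
pose h x := expR (l * (\1_U x - \1_V x)).
have mh : measurable_fun setT h.
  apply: measurableT_comp => //; apply: measurable_funM => //.
  by apply: measurable_funB; exact: measurable_indic.
have mUV : measurable (U `|` V) by exact: measurableU.
pose W := ~` (U `|` V); have mW : measurable W by exact: measurableC.
have PW : P W = (1 - u - v)%:E.
  rewrite probability_setC//.
  have -> : P (U `|` V) = (P U + P V)%E by exact: measureU.
  by rewrite PU PV; congr EFin; ring.
have hE x : (h x)%:E = ((\1_W x)%:E + ((expR l)%:E * (\1_U x)%:E + (expR (- l))%:E * (\1_V x)%:E))%E.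
  rewrite /h !indicE; have [xU|xU] := boolP (x \in U).
    have xV : (x \in V) = false.
      by apply/negbTE/negP => /set_mem Vx; suff : set0 x by []; rewrite -UV; split => //; exact: set_mem.
    have xW : (x \in W) = false.
      by apply/negbTE/negP => /set_mem; apply; left; exact: set_mem.
    by rewrite xV xW /= subr0 mulr1 mule1 mule0 adde0 add0e.
  have [xV|xV] := boolP (x \in V).
    have xW : (x \in W) = false.
      by apply/negbTE/negP => /set_mem; apply; right; exact: set_mem.
    by rewrite xW /= sub0r mulrN1 mule1 mule0 !add0e.
  have xW : x \in W.
    by rewrite inE => -[/mem_set|/mem_set]; apply/negP.
  by rewrite xW /= subr0 mulr0 expR0 !mule0 !adde0.
have Ph : (\int[P]_x (h x)%:E <= (expR (l * (u - v) + 2 * l ^+ 2 * (u + v)))%:E)%E.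
  under eq_integral do rewrite hE.
  have m_indic (c : R) (B : set T) : measurable B ->
      measurable_fun setT (fun x => c%:E * (\1_B x)%:E)%E.
    by move=> mB; apply: measurable_funeM; exact/measurable_EFinP/measurable_indic.
  have ge0_indic (c : R) (B : set T) x : (0 <= (expR c)%:E * (\1_B x)%:E)%E.
    by rewrite mule_ge0// lee_fin expR_ge0.
  rewrite !ge0_integralD//.
  all: try by move=> x _; rewrite ?adde_ge0.
  all: try exact: m_indic.
  all: try by apply: emeasurable_funD; exact: m_indic.
  all: try exact/measurable_EFinP/measurable_indic.
  rewrite !ge0_integralZl_EFin ?expR_ge0//; try exact/measurable_EFinP/measurable_indic.
  have int1 (B : set T) c : measurable B -> P B = c%:E ->
      (\int[P]_x (\1_B x)%:E = c%:E)%E.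
    by move=> mB <-; rewrite integral_indic// setIT.
  rewrite (int1 _ _ mW PW) (int1 _ _ mU PU) (int1 _ _ mV PV) -!EFinM -!EFinD lee_fin.
  apply: le_trans (expR_ge1Dx _).
  have e1 := expR_le_quadratic l01; have e2 := expRN_le_quadratic l0.
  have := ler_wpM2r u0 e1; have := ler_wpM2r v0 e2; lra.
have : (\int[power_measure P n]_z (\prod_(i < n) h (tnth z i))%:E <=
    (expR (l * (u - v) + 2 * l ^+ 2 * (u + v)) ^+ n)%:E)%E.
  by apply: power_integral_prod => // *; exact: expR_ge0.
rewrite -expRM_natl; apply: le_trans.
rewrite -[A in leLHS]setIT -integral_indic//; apply: ge0_le_integral => //.
- exact/measurable_EFinP/measurable_indic.
- by apply/measurable_EFinP; exact: measurable_prod_tnth.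
- move=> z _; rewrite lee_fin indicE; case: (boolP (z \in A)) => [/set_mem Az|_]; last first.
    by apply: prodr_ge0 => i _; exact: expR_ge0.
  rewrite -expR_sum -mulr_sumr; apply: le_trans (expR_ge1Dx _).
  by rewrite lerDl mulr_ge0// AUV.
Qed.

End chernoff.

(* The exponent of the Chernoff bound at l of order e^(1 - 1/kappa), the largest
   value for which the variance term is absorbed by the mean. *)
Lemma tail_exponent (R : realType) (c1 kappa e0 e u v : R) :
  let c := Num.min (1 / 2) (c1 `^ kappa^-1 / 16) in
  let l := c * e `^ (1 - kappa^-1) in
  0 < c1 -> 1 <= kappa -> 0 <= e0 -> 2 * e0 <= e -> 0 < e <= 1 ->
  u - v = e0 - e -> u + v <= (e0 / c1) `^ kappa^-1 + (e / c1) `^ kappa^-1 ->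
  0 <= l <= 1 / 2 /\ l * (u - v) + 2 * l ^+ 2 * (u + v) <= - (c * e `^ (2 - kappa^-1) / 4).
Proof.
move=> c l c10 k1 e00 e20 /andP[e_gt0 e1] uv uv_sum.
have k0 : 0 < kappa by lra.
have kV0 : 0 < kappa^-1 by rewrite invr_gt0.
have kV1 : kappa^-1 <= 1 by rewrite invf_le1.
have c1k : 0 < c1 `^ kappa^-1 by rewrite powR_gt0.
have c0 : 0 < c by rewrite lt_min divr_gt0//= divr_gt0.
have c12 : c <= 1 / 2 by rewrite ge_min lexx.
have cc : c <= c1 `^ kappa^-1 / 16 by rewrite ge_min lexx orbT.
have e_n0 : e != 0 by rewrite gt_eqF.
have ege0 : 0 <= e by exact: ltW.
have l0 : 0 <= l by rewrite mulr_ge0 ?powR_ge0// ltW.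
have l12 : l <= 1 / 2.
  apply: le_trans c12; rewrite /l ler_piMr ?(ltW c0)//.
  rewrite -[leRHS](_ : 1 `^ (1 - kappa^-1) = 1 :> R); last by rewrite powR1.
  by rewrite ge0_ler_powR ?nnegrE ?subr_ge0.
rewrite l0 l12; split => //.
have mono : (e0 / c1) `^ kappa^-1 <= (e / c1) `^ kappa^-1.
  apply: ge0_ler_powR; rewrite ?nnegrE ?(ltW kV0) ?divr_ge0 ?(ltW c10)//.
  by rewrite ler_pM2r ?invr_gt0//; lra.
have eE : c * e `^ (2 - kappa^-1) = l * e.
  have -> : 2 - kappa^-1 = (1 - kappa^-1) + 1 by ring.
  by rewrite powRD ?e_n0 ?implybT// powRr1// mulrA.
(* The 16 in [c]: the variance term is at most 4 l^2 (e / c1)^(1/kappa) <= l e / 4, half of the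
   drift l e / 2. *)
have le_e : l * (e / c1) `^ kappa^-1 <= e / 16.
  have -> : (e / c1) `^ kappa^-1 = e `^ kappa^-1 / c1 `^ kappa^-1.
    rewrite powRM ?invr_ge0 ?(ltW c10)//; congr (_ * _).
    by rewrite -powR_inv1 ?(ltW c10)// -powRrM mulN1r powRN.
  have -> : l * (e `^ kappa^-1 / c1 `^ kappa^-1) = (c / c1 `^ kappa^-1) * e.
    have {2}<- : e `^ (1 - kappa^-1) * e `^ kappa^-1 = e.
      by rewrite -powRD ?e_n0 ?implybT// subrK powRr1.
    by rewrite /l; ring.
  rewrite mulrC ler_wpM2l//.
  by rewrite ler_pdivrMr// mulrC; lra.
rewrite eE uv.
have h1 : l * (e0 - e) <= l * (- (e / 2)) by rewrite ler_wpM2l//; lra.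
have h2 : l * (u + v) <= l * (2 * (e / c1) `^ kappa^-1).
  by rewrite ler_wpM2l//; lra.
have h3 := ler_wpM2l l0 h2.
have h4 := ler_wpM2l l0 le_e.
rewrite expr2; move: h1 h3 h4.
move: (_ `^ _) => w; clear; lra.
Qed.

(** * From the margin condition to deviations of the empirical risk *)

Section empirical_risk.
Context (R : realType) (m : nat) (Q : probability ('cV[R]_m * bool)%type R)
  (f : 'cV[R]_m -> R) (Qf : regression_function Q f).
Local Notation H := (bayes_rule f).

Lemma prob_fineK (X : set ('cV[R]_m * bool)) : measurable X ->
  Q X = (fine (Q X))%:E.
Proof. by move=> mX; rewrite fineK// fin_num_measure. Qed.

Lemma measurable_setY d (T : measurableType d) (A B : set T) :
  measurable A -> measurable B -> measurable (A `+` B).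
Proof. by move=> mA mB; rewrite setY_def; apply: measurableU; exact: measurableD. Qed.

Lemma dist_f_le_sd G : measurable G -> (dist_f Q f G H <= dist_sd Q G H)%E.
Proof.
move=> mG; apply: weighted_le_marginal => //.
by apply: measurable_setY => //; exact: measurable_bayes Qf.
Qed.

Lemma dist_sd_le1 G : measurable G -> (dist_sd Q G H <= 1)%E.
Proof.
move=> mG; apply: probability_le1; rewrite -[X in measurable X]setTI.
by apply: measurable_fst => //; apply: measurable_setY => //; exact: measurable_bayes Qf.
Qed.

Lemma dist_f_ge0 G : (0 <= dist_f Q f G H)%E.
Proof. by apply: (@integral_ge0 _ _ _ (marginal Q)) => x _; rewrite lee_fin. Qed.

Lemma dist_sd_ge0 G : (0 <= dist_sd Q G H)%E.
Proof. exact: (measure_ge0 (marginal Q)). Qed.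

Lemma dist_f_fineK G : measurable G ->
  dist_f Q f G H = (fine (dist_f Q f G H))%:E /\ 0 <= fine (dist_f Q f G H) <= 1.
Proof.
move=> mG; have le1 := le_trans (dist_f_le_sd mG) (dist_sd_le1 mG).
have fin : dist_f Q f G H \is a fin_num.
  by rewrite ge0_fin_numE ?dist_f_ge0// (le_lt_trans le1)// ltry.
rewrite fineK//; split => //; move: le1 (dist_f_ge0 G).
by rewrite -(fineK fin) !lee_fin => -> ->.
Qed.

Lemma dist_sd_fineK G : measurable G -> dist_sd Q G H = (fine (dist_sd Q G H))%:E.
Proof.
move=> mG; rewrite fineK// ge0_fin_numE ?dist_sd_ge0//.
by rewrite (le_lt_trans (dist_sd_le1 mG))// ltry.
Qed.

Lemma dist_sd_margin (c1 kappa : R) G : measurable G -> 0 < c1 -> 1 <= kappa ->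
  (c1%:E * dist_sd Q G H `^ kappa <= dist_f Q f G H)%E ->
  fine (dist_sd Q G H) <= (fine (dist_f Q f G H) / c1) `^ kappa^-1.
Proof.
move=> mG c10 k1; have [-> /andP[e0 _]] := dist_f_fineK mG.
rewrite dist_sd_fineK// poweR_EFin -EFinM lee_fin /= => le_e.
have s0 : 0 <= fine (dist_sd Q G H) by apply: fine_ge0; exact: dist_sd_ge0.
have k0 : 0 < kappa by lra.
rewrite -[leLHS]powRr1// -(divff (lt0r_neq0 k0)) powRrM.
apply: ge0_ler_powR; rewrite ?nnegrE ?powR_ge0 ?invr_ge0 ?divr_ge0 ?(ltW c10) ?(ltW k0)//.
by rewrite ler_pdivlMr// mulrC.
Qed.

Lemma error_setP G (w : 'cV[R]_m * bool) :
  error_set G w <-> (w.2 != (w.1 \in G)).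
Proof.
case: w => x y; rewrite /error_set /=; split.
  by move=> [[/mem_set -> ->]|[nG ->]] //=; rewrite memNset.
case: y; case: (boolP (x \in G)) => [/set_mem Gx|/negP nG] // _; [right|left] => //.
by split => // /mem_set.
Qed.

Lemma emp_risk_error n (z : n.-tuple ('cV[R]_m * bool)) G :
  emp_risk z G = n%:R^-1 * \sum_(i < n) \1_(error_set G) (tnth z i).
Proof.
rewrite /emp_risk; congr (_ * _); apply: eq_bigr => i _; rewrite indicE.
by congr (nat_of_bool _)%:R; apply/idP/idP => [/error_setP/mem_set|/set_mem/error_setP].
Qed.

(** The Chernoff bound applies to [U], where only [G0] errs, and [V], where only [G] errs. The drift
    is the difference of excess risks, and the margin condition bounds the second moment by powers
    1/kappa of them. *)
Lemma competitor_tail n (c1 kappa : R) G0 G (A : set (n.-tuple ('cV[R]_m * bool))) :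
  0 < c1 -> 1 <= kappa ->
  measurable G0 -> G0 `<=` unit_cube -> measurable G -> G `<=` unit_cube ->
  (c1%:E * dist_sd Q G0 H `^ kappa <= dist_f Q f G0 H)%E ->
  (c1%:E * dist_sd Q G H `^ kappa <= dist_f Q f G H)%E ->
  2 * fine (dist_f Q f G0 H) <= fine (dist_f Q f G H) ->
  measurable A -> (forall z, A z -> emp_risk z G <= emp_risk z G0) ->
  (power_measure Q n A <= (expR (- (n%:R * Num.min (1 / 2) (c1 `^ kappa^-1 / 16) *
     fine (dist_f Q f G H) `^ (2 - kappa^-1) / 4)))%:E)%E.
Proof.
move=> c10 k1 mG0 G01 mG G1 marg0 marg e20 mA AG.
have k0 : 0 < kappa by rewrite (lt_le_trans ltr01).
have mE0 := measurable_error_set mG0; have mE := measurable_error_set mG.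
pose U := error_set G0 `\` error_set G; pose V := error_set G `\` error_set G0.
have mU : measurable U by exact: measurableD.
have mV : measurable V by exact: measurableD.
have UV : U `&` V = set0 by rewrite -subset0 => w [[? ?] [?]].
have [E0 /andP[e00 e01]] := dist_f_fineK mG0; have [E /andP[e0 e1]] := dist_f_fineK mG.
have sd0 := dist_sd_margin mG0 c10 k1 marg0; have sd := dist_sd_margin mG c10 k1 marg.
have r0 := excess_risk Qf mG0 G01; have r := excess_risk Qf mG G1.
rewrite E0 in r0; rewrite E in r; move: sd0 sd e20 r0 r.
set e_ := fine (dist_f Q f G H) in e0 e1 *; set e0_ := fine (dist_f Q f G0 H) in e00 e01 *.
move=> sd0 sd e20 r0 r.
have mH : measurable (error_set H) by apply: measurable_error_set; exact: measurable_bayes Qf.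
have mI : measurable (error_set G0 `&` error_set G) by exact: measurableI.
have split0 : Q (error_set G0) = (Q U + Q (error_set G0 `&` error_set G))%E by exact: measureDI.
have split1 : Q (error_set G) = (Q V + Q (error_set G0 `&` error_set G))%E.
  by rewrite setIC; exact: measureDI.
have uv : fine (Q U) - fine (Q V) = e0_ - e_.
  move: r0 r; rewrite split0 split1 (prob_fineK mU) (prob_fineK mV) (prob_fineK mI) (prob_fineK mH).
  rewrite -!EFinD /=; move: (fine (Q U)) (fine (Q V)) (fine (Q (_ `&` _))) (fine (Q _)).
  by move=> a b c d [h1] [h2]; move: h1 h2; clear; lra.
have uv_sum : fine (Q U) + fine (Q V) <=
    (e0_ / c1) `^ kappa^-1 + (e_ / c1) `^ kappa^-1.
  have : (Q U + Q V <= dist_sd Q G0 H + dist_sd Q G H)%E.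
    have <- : Q (U `|` V) = (Q U + Q V)%E by exact: measureU.
    have mY K : measurable K -> measurable ((K `+` H) `*` [set: bool]).
      move=> mK; apply: measurableX => //; apply: measurable_setY => //.
      exact: measurable_bayes Qf.
    have -> : dist_sd Q G0 H = Q ((G0 `+` H) `*` [set: bool]).
      by congr (Q _); apply/seteqP; split => [w|w []].
    have -> : dist_sd Q G H = Q ((G `+` H) `*` [set: bool]).
      by congr (Q _); apply/seteqP; split => [w|w []].
    apply: le_trans (measureU2 _ _ _); [|exact: mY|exact: mY].
    apply: le_measure; rewrite ?inE//.
    - exact: measurableU.
    - by apply: measurableU; exact: mY.
    (* Where exactly one of [G0] and [G] errs the two sets disagree, so one of them disagrees with
       the Bayes rule. *)
    move=> [x y]; rewrite /U /V /error_set !setY_def /=.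
    have := EM (G x); have := EM (G0 x); have := EM (H x).
    by case: y => /=; intuition discriminate.
  rewrite (prob_fineK mU) (prob_fineK mV) (dist_sd_fineK mG0) (dist_sd_fineK mG).
  rewrite -!EFinD lee_fin => uv_le; apply: (le_trans uv_le); exact: (lerD sd0 sd).
(* Without excess risk the power vanishes, as its exponent is nonzero, and the claim is the trivial
   bound 1. *)
have [e_0|e_n0] := eqVneq e_ 0.
  rewrite e_0 powR0 ?mulr0 ?mul0r ?oppr0 ?expR0; first exact: probability_le1.
  rewrite subr_eq0 gt_eqF// (le_lt_trans (y := 1)) ?ltr1n//.
  by rewrite invf_le1.
have e_gt0 : 0 < e_ <= 1 by rewrite lt_def e_n0 e0.
have [l01 exponent] := tail_exponent c10 k1 e00 e20 e_gt0 uv uv_sum.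
have AUV z : A z -> 0 <= \sum_(i < n) (\1_U (tnth z i) - \1_V (tnth z i) : R).
  move=> /AG; rewrite !emp_risk_error; clear; case: n z => [|n] z; first by rewrite !big_ord0.
  rewrite ler_pM2l ?invr_gt0// -subr_ge0 -sumrB => /le_trans; apply.
  apply: ler_sum => i _; rewrite /U /V !indicE !in_setD.
  by case: (_ \in error_set G0); case: (_ \in error_set G); rewrite /= ?subrr ?subr0.
apply: le_trans (power_chernoff mU mV UV mA l01 (prob_fineK mU) (prob_fineK mV) AUV) _.
rewrite lee_fin ler_expR; apply: (le_trans (ler_wpM2l (ler0n R n) exponent)).
by rewrite mulrN !mulrA.
Qed.

End empirical_risk.

(* Summing over the values of Ghat replaces the usual integration of tails: those
   with excess risk below T0 contribute T0^q, each other one its probability. *)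
Lemma erm_moment (R : realType) (m : nat) (Q : probability ('cV[R]_m * bool)%type R)
    (f : 'cV[R]_m -> R) n (c1 kappa T0 q C : R) (NN : set (set 'cV[R]_m))
    (K : finType) (dec : K -> set 'cV[R]_m) G0
    (Ghat : n.-tuple ('cV[R]_m * bool) -> set 'cV[R]_m)
    (phi : set 'cV[R]_m -> \bar R) :
  regression_function Q f -> 0 < c1 -> 1 <= kappa -> 0 <= T0 -> 0 <= q -> 0 <= C ->
  (forall G, NN G -> exists k, G = dec k) ->
  (forall G, NN G -> [/\ measurable G, G `<=` unit_cube &
     (c1%:E * dist_sd Q G (bayes_rule f) `^ kappa <= dist_f Q f G (bayes_rule f))%E]) ->
  NN G0 -> 2 * fine (dist_f Q f G0 (bayes_rule f)) <= T0 ->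
  empirical_minimizer NN Ghat ->
  (forall G, NN G -> (0 <= phi G <= (C * fine (dist_f Q f G (bayes_rule f)) `^ q)%:E)%E) ->
  (\int[power_measure Q n]_z phi (Ghat z) <=
    (C * (T0 `^ q + #|K|%:R * expR (- (n%:R * Num.min (1 / 2) (c1 `^ kappa^-1 / 16) *
       T0 `^ (2 - kappa^-1) / 4))))%:E)%E.
Proof.
move=> Qf c10 k1 T00 q0 C0 NNdec NNprop NG0 G0T [Ghatmin Ghatmeas] phiNN.
pose e G := fine (dist_f Q f G (bayes_rule f)).
have e01 G : NN G -> 0 <= e G <= 1.
  by move=> /NNprop[mG _ _]; case: (dist_f_fineK Qf mG).
pose ok k := `[< NN (dec k) /\ T0 <= e (dec k) >].
pose B k := if ok k then [set z | Ghat z = dec k] else set0.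
have mB k : measurable (B k).
  by rewrite /B; case: ifPn => // /asboolP[Nk _]; exact: Ghatmeas.
set E := expR _.
have PB k : (power_measure Q n (B k) <= E%:E)%E.
  rewrite /B; case: ifPn => [/asboolP[Nk Tk]|_]; last by rewrite measure0 lee_fin expR_ge0.
  have [mG0 G01 marg0] := NNprop _ NG0; have [mG G1 marg] := NNprop _ Nk.
  apply: le_trans (competitor_tail Qf c10 k1 mG0 G01 mG G1 marg0 marg _ (Ghatmeas _ Nk) _) _.
  - by rewrite (le_trans G0T).
  - by move=> z /= <-; have [_] := Ghatmin z; apply.
  rewrite lee_fin ler_expR lerN2 ler_pM2r ?invr_gt0// ler_wpM2l//.
    by rewrite mulr_ge0// le_min divr_ge0//= divr_ge0// powR_ge0.
  apply: ge0_ler_powR; rewrite ?nnegrE//; last by case/andP: (e01 _ Nk).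
  rewrite subr_ge0 (le_trans (y := 1)) ?ler1n// invf_le1//.
  by rewrite (lt_le_trans ltr01).
(* No measurability of [phi] is involved: [Ghat] takes finitely many values, each on a measurable
   event. *)
have mphi : measurable_fun setT (phi \o Ghat).
  move=> _ Y mY; rewrite setTI.
  rewrite (_ : _ @^-1` _ = \bigcup_(k in [set k | NN (dec k) /\ Y (phi (dec k))])
      [set z | Ghat z = dec k]); last first.
    apply/seteqP; split => z /=.
      have [/[dup] Nz /NNdec[k zk] _] := Ghatmin z => Yz.
      by exists k => //=; rewrite -zk.
    by move=> [k /= [Nk Yk] zk]; rewrite zk.
  by apply: fin_bigcup_measurable; [exact: finite_finset|move=> k [Nk _]; exact: Ghatmeas].
pose g z := ((C * T0 `^ q)%:E + \sum_(k in K) C%:E * (\1_(B k) z)%:E)%E.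
have mCB k : measurable_fun setT (fun z => C%:E * (\1_(B k) z)%:E : \bar R)%E.
  by apply: measurable_funeM; exact/measurable_EFinP/measurable_indic.
have CB0 k z : (0 <= C%:E * (\1_(B k) z)%:E :> \bar R)%E by rewrite mule_ge0.
have msum : measurable_fun setT (fun z => \sum_(k in K) C%:E * (\1_(B k) z)%:E : \bar R)%E.
  exact: emeasurable_sum.
have CT0 : 0 <= C * T0 `^ q by rewrite mulr_ge0// powR_ge0.
apply: (@le_trans _ _ (\int[power_measure Q n]_z g z)%E).
  apply: ge0_le_integral => //.
  - by move=> z _ /=; have [Nz _] := Ghatmin z; case/andP: (phiNN _ Nz).
  - by apply: emeasurable_funD.
  move=> z _; have [/[dup] Nz /NNdec[k zk] _] := Ghatmin z.
  have /andP[_ /le_trans] := phiNN _ Nz; apply; rewrite -/(e _).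
  have /andP[e0 e1] := e01 _ Nz.
  have [eT|Te] := leP (e (Ghat z)) T0.
    rewrite /g -[leLHS]adde0 leeD//; last by apply: sume_ge0.
    by rewrite lee_fin ler_wpM2l// ge0_ler_powR.
  rewrite /g (bigD1 k)//= addeCA -[leLHS]adde0 leeD//.
    rewrite indicE mem_set/=; last first.
      by rewrite /B ifT//; apply/asboolP; rewrite -zk; split => //; exact: ltW.
    rewrite mule1 lee_fin -[leRHS]mulr1 ler_wpM2l//.
    (* Excess risks are at most 1, so above the threshold their power q is simply bounded by 1. *)
    rewrite -[leRHS](_ : 1 `^ q = 1 :> R); last by rewrite powR1.
    by rewrite ge0_ler_powR ?nnegrE.
  by rewrite adde_ge0 ?lee_fin//; exact: sume_ge0.
rewrite ge0_integralD//; last by move=> z _; exact: sume_ge0.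
rewrite (integral_cst (power_measure Q n))// [X in (_ * X + _)%E]probability_setT mule1.
rewrite ge0_integral_sum//.
rewrite mulrDr EFinD leeD//.
apply: (@le_trans _ _ (\sum_(k in K) (C * E)%:E)%E).
  apply: lee_sum => k _; rewrite ge0_integralZl_EFin//; try exact/measurable_EFinP/measurable_indic.
  by rewrite integral_indic// setIT EFinM; apply: lee_wpmul2l; rewrite ?lee_fin//; exact: PB.
by rewrite sumEFin lee_fin sumr_const -[leLHS]mulr_natl [leLHS]mulrCA.
Qed.

(** * Approximation error *)

Lemma distance_unit_itv (R : realType) (p q : R) :
  0 <= p <= 1 -> 0 <= q <= 1 -> 0 <= `|p - q| <= 1.
Proof.
move=> /andP[? ?] /andP[? ?]; rewrite normr_ge0 ler_norml.
by apply/andP; split; lra.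
Qed.

Section approximation_error.
Context (R : realType) (n : nat) (Q : probability ('cV[R]_n * bool)%type R)
  (f : 'cV[R]_n -> R) (Qf : regression_function Q f).
Local Notation weighted := (weighted Q f).

Lemma le_weighted A B : measurable A -> measurable B -> A `<=` B ->
  (weighted A <= weighted B)%E.
Proof.
move=> mA mB AB; apply: ge0_subset_integral => //; last exact: measurable_weight Qf B.
Qed.

Lemma weighted_le_sum (I : finType) (F : I -> set 'cV[R]_n) A :
  measurable A -> (forall i, measurable (F i)) -> (forall x, A x -> exists i, F i x) ->
  (weighted A <= \sum_i weighted (F i))%E.
Proof.
move=> mA mF AF; pose U (s : seq I) := \big[setU/set0]_(i <- s) F i.
have mU s : measurable (U s) by apply: bigsetU_measurable.
have US s : (weighted (U s) <= \sum_(i <- s) weighted (F i))%E.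
  elim: s => [|i s IHs].
    by rewrite /U !big_nil /weighted integral_set0.
  have -> : U (i :: s) = F i `|` (U s `\` F i).
    rewrite {1}/U big_cons -/(U s).
    by apply/seteqP; split=> x /=; have := EM (F i x); tauto.
  have mD : measurable (U s `\` F i) by exact: measurableD.
  rewrite weightedU//; last by apply/disj_setPS => x [? []].
  rewrite big_cons leeD2l// (le_trans _ IHs)//; apply: le_weighted => //.
apply: (le_trans _ (US (index_enum I))); apply: le_weighted => // x /AF[i Fx].
by rewrite /U -bigcup_seq; exists i => //=; exact: mem_index_enum.
Qed.

Lemma density_marginal_le (M : R) A : density_bounded Q M -> measurable A ->
  (marginal Q A <= M%:E * lebesgue_cV A)%E.
Proof.
move=> [p [mp p0M pE]] mA; have -> : marginal Q A = _ := pE A mA.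
rewrite -integral_cst//; apply: ge0_le_integral => //.
- by move=> x _; rewrite lee_fin; case/andP: (p0M x).
- by apply: measurable_funTS; exact/measurable_EFinP.
- by move=> x _; rewrite lee_fin; case/andP: (p0M x).
Qed.

Lemma measurable_coord_itv (i : 'I_n) (l h : R) :
  measurable [set x : 'cV[R]_n | l <= x i 0 <= h].
Proof.
rewrite (_ : mkset _ = (fun x : 'cV[R]_n => x i 0) @^-1` `[l, h]%classic).
  by rewrite -[X in measurable X]setTI; exact: measurable_entry.
by apply/seteqP; split => x; rewrite /= in_itv.
Qed.

Lemma measurable_box (a b : 'cV[R]_n) : measurable (box a b).
Proof.
rewrite (_ : box a b = \bigcap_(i in [set: 'I_n]) [set x | a i 0 <= x i 0 <= b i 0]).
  by apply: fin_bigcap_measurable => // i _; exact: measurable_coord_itv.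
by apply/seteqP; split => x xi i => [_|]; exact: xi.
Qed.

Definition coord_strip (eta : R) (i : 'I_n) (c : R) : set 'cV[R]_n :=
  unit_cube `&` [set x | c - eta <= x i 0 <= c + eta].

Lemma measurable_coord_strip eta i c : measurable (coord_strip eta i c).
Proof. by apply: measurableI; [exact: measurable_unit_cube|exact: measurable_coord_itv]. Qed.

Lemma weighted_thin (M w : R) (i : 'I_n) A : density_bounded Q M -> 0 <= M -> 0 <= w ->
  measurable A -> A `<=` unit_cube ->
  (forall x y, A x -> A y -> (forall k, k != i -> x k 0 = y k 0) -> `|x i 0 - y i 0| <= 2 * w) ->
  (marginal Q A <= (M * (4 * w))%:E)%E.
Proof.
move=> QM M0 w0 mA A1 Aw; apply: (le_trans (density_marginal_le QM mA)).
rewrite EFinM lee_wpmul2l ?lee_fin// (_ : 4 * w = 2 * (2 * w)); last by ring.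
by apply: (lebesgue_cV_section (j := i)) => //; rewrite mulr_ge0.
Qed.

Lemma weighted_strip (M eta : R) i c : density_bounded Q M -> 0 <= M -> 0 <= eta ->
  (weighted (coord_strip eta i c) <= (M * (4 * eta))%:E)%E.
Proof.
move=> QM M0 eta0; have mS := measurable_coord_strip eta i c.
apply: (le_trans (weighted_le_marginal Qf mS)).
apply: (weighted_thin (i := i)) => //; first by move=> x [].
move=> x y [_ /= /andP[? ?]] [_ /= /andP[? ?]] _.
by rewrite ler_norml; apply/andP; split; lra.
Qed.

Lemma weighted_le_const (B : R) A : measurable A -> 0 <= B ->
  (forall x, A x -> `|2 * f x - 1| <= B) -> (weighted A <= B%:E * marginal Q A)%E.
Proof.
move=> mA B0 AB; rewrite -integral_cst//; apply: ge0_le_integral => //.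
- exact: measurable_weight Qf A.
Qed.

Context (u : nat) (j : 'I_u -> 'I_n) (sgn : 'I_u -> bool)
  (gamma N : 'I_u -> 'cV[R]_n.-1 -> R) (a b a' b' : 'I_u -> 'cV[R]_n)
  (theta eps eta width : R) (c0 : 'I_u -> R).
Local Notation G := (approx_union j sgn N a' b' theta c0).
Local Notation H := (exact_union j sgn gamma a b).

(* Off the strips around the faces, a point belongs to at most one box, and there
   it is misclassified only if it is within width of a boundary point of H. *)
Lemma approx_union_error (M beta B eps1 : R) :
  bayes_rule f = H -> measurable G ->
  density_bounded Q M -> 0 <= M -> 0 <= beta -> 0 <= B -> width <= eps1 -> 0 <= eta -> 0 <= width ->
  (forall nu i, 0 <= a nu i 0 /\ a nu i 0 < b nu i 0 <= 1) ->
  (forall nu1 nu2, nu1 <> nu2 ->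
     lebesgue_cV (box (a nu1) (b nu1) `&` box (a nu2) (b nu2)) = 0%E) ->
  (forall nu i, `|a nu i 0 - a' nu i 0| <= eta) ->
  (forall nu i, `|b nu i 0 - b' nu i 0| <= eta) ->
  (forall nu y, unit_cube y -> `|N nu y - gamma nu y| <= eps) ->
  0 <= theta <= 1 ->
  (forall nu, lower_end j sgn a b nu + eps < theta * lower_end j sgn a b nu + c0 nu) ->
  (forall nu, theta * upper_end j sgn a b nu + c0 nu <= upper_end j sgn a b nu - eps) ->
  (forall nu (s : R), `|s| <= 1 -> `|theta * s + c0 nu - s| + eps <= width) ->
  (0 < beta -> forall nu x, box (a nu) (b nu) x -> cube_boundary H x ->
     exists2 g, flat_class beta B g &
       forall v : R, Num.max 0 (x (j nu) 0 - eps1) <= v <=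
                 Num.min 1 (x (j nu) 0 + eps1) ->
         `|2 * f (set_coord x (j nu) v) - 1| <= g (const_mx `|v - x (j nu) 0|)) ->
  (dist_f Q f G (bayes_rule f) <=
    ((u * n * 2)%:R * (M * (4 * eta)) +
     u%:R * (Num.max B 1 * width `^ beta * (M * (4 * width))))%:E)%E.
Proof.
move=> fH mG QM M0 beta0 B0 weps1 eta0 w0 ab disj aa' bb' gN th c_lo c_up th_c0 flat.
have mH : measurable H by rewrite -fH; exact: measurable_bayes Qf.
rewrite fH; set D := G `+` H.
have mD : measurable D by exact: measurable_setY.
have D1 : D `<=` unit_cube.
  rewrite /D setY_def => x [[[x1 _] _]//|[[nu _ [_ [x1 _]]] _]//].
pose strips := \bigcup_(p in [set: ('I_u * 'I_n) * bool])
  coord_strip eta p.1.2 (if p.2 then a p.1.1 p.1.2 0 else b p.1.1 p.1.2 0).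
have mstrips : measurable strips.
  by apply: fin_bigcup_measurable => // p _; exact: measurable_coord_strip.
pose piece nu := (D `\` strips) `&` box (a nu) (b nu).
have mpiece nu : measurable (piece nu).
  by apply: measurableI; [exact: measurableD|exact: measurable_box].
pose F (k : ('I_u * 'I_n) * bool + 'I_u) := match k with
  | inl p => coord_strip eta p.1.2 (if p.2 then a p.1.1 p.1.2 0 else b p.1.1 p.1.2 0)
  | inr nu => piece nu end.
have mF k : measurable (F k).
  by case: k => [p|nu]; [exact: measurable_coord_strip|exact: mpiece].
have face x : unit_cube x -> face_strip a b eta x -> strips x.
  move=> x1 [nu [i xi]]; case: xi; rewrite ler_distl => h.
    by exists (nu, i, true).
  by exists (nu, i, false).
have DF x : D x -> exists k, F k x.
  move=> Dx; have [[p _ px]|xS] := EM (strips x); first by exists (inl p).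
  suff [nu xnu] : exists nu, box (a nu) (b nu) x by exists (inr nu).
  move: (Dx); rewrite /D setY_def => -[[[_ [nu [xnu _]]] _]|[[nu _ [xnu _]] _]]; exists nu => //.
  apply/(box_approx aa' bb' nu _) => // xface; apply: xS; apply: face => //.
  exact: D1.
apply: (le_trans (weighted_le_sum mD mF DF)).
rewrite big_sumType /= EFinD; apply: leeD.
  apply: (@le_trans _ _ (\sum_(p : ('I_u * 'I_n) * bool) (M * (4 * eta))%:E)%E).
    by apply: lee_sum => p _; exact: weighted_strip.
  by rewrite sumEFin lee_fin sumr_const !card_prod !card_ord card_bool [leRHS]mulr_natl.
apply: (@le_trans _ _ (\sum_(nu < u) (Num.max B 1 * width `^ beta * (M * (4 * width)))%:E)%E); last first.
  by rewrite sumEFin lee_fin sumr_const card_ord [leRHS]mulr_natl.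
apply: lee_sum => nu _.
have pieceE x : piece nu x -> [/\ unit_cube x, ~ face_strip a b eta x, box (a nu) (b nu) x & D x].
  move=> [[Dx xS] xD]; have x1 := D1 _ Dx.
  by split => // xface; apply: xS; exact: face.
have mis x : piece nu x -> let g := gamma nu (row' (j nu) x) in
    lower_end j sgn a b nu <= g < upper_end j sgn a b nu /\
    `|(-1) ^+ sgn nu * x (j nu) 0 - g| <= width.
  move=> /pieceE[x1 xS xD Dx].
  exact: (misclassified ab disj aa' bb' gN th c_lo c_up th_c0 x1 xS xD Dx).
(* Points of the piece on one line in direction [j nu] share the value of gamma, hence are within 2
   width of each other. *)
have marg : (marginal Q (piece nu) <= (M * (4 * width))%:E)%E.
  apply: (weighted_thin (i := j nu)) => //.
    by move=> x /pieceE[].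
  move=> x y /mis[_ xw] /mis[_ yw] xy; move: yw.
  have <- : row' (j nu) x = row' (j nu) y.
    by apply/colP => k; rewrite !mxE xy// eq_sym neq_lift.
  rewrite -(sign_norm sgn nu) mulrBr; move: xw; move: (gamma _ _) => g.
  by rewrite !ler_norml => /andP[? ?] /andP[? ?]; apply/andP; split; lra.
have max0 : 0 <= Num.max B 1 * width `^ beta by rewrite mulr_ge0 ?powR_ge0// le_max ler01 orbT.
(* For beta = 0 no flatness is available; the weighted measure is at most the marginal, and the
   maximum of [B] and 1 in the constant absorbs this case. *)
have [beta_eq0|beta_gt0] := eqVneq beta 0.
  apply: (le_trans (weighted_le_marginal Qf (mpiece nu))); apply: (le_trans marg).
  rewrite beta_eq0 powRr0 mulr1 lee_fin ler_peMl ?le_max ?lexx ?orbT//.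
  by rewrite !mulr_ge0.
rewrite EFinM; apply: le_trans (lee_wpmul2l _ marg); last by rewrite lee_fin.
apply: weighted_le_const => // x piecex.
have [x1 xS xD Dx] := pieceE _ piecex; have [gitv xw] := mis _ piecex.
have [zD zH] := misclassified_boundary ab disj aa' x1 xS xD gitv.
have b0 : 0 < beta by rewrite lt_def beta_gt0.
have [g gflat gx] := flat b0 nu _ zD zH.
set z := set_coord _ _ _ in zD zH gx.
have zj : z (j nu) 0 = (-1) ^+ sgn nu * gamma nu (row' (j nu) x) by rewrite mxE eqxx.
have xz : `|x (j nu) 0 - z (j nu) 0| <= width.
  by rewrite -(sign_norm sgn nu) mulrBr zj sign_sqr.
have z01 : 0 <= z (j nu) 0 <= 1.
  by have [a0 /andP[_ b1]] := ab nu (j nu); have /andP[z0 z1] := zD (j nu); rewrite (le_trans a0)//= (le_trans z1).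
have /andP[xj0 xj1] := x1 (j nu); have /andP[z0 z1] := z01.
(* The flatness bound at the boundary point z is evaluated at [x] itself, which lies on the same
   coordinate line within [eps1]. *)
have xset : set_coord z (j nu) (x (j nu) 0) = x.
  by apply/colP => k; rewrite !mxE; case: eqP => [->|].
have := gx (x (j nu) 0); rewrite xset ge_max le_min xj0 xj1 /=.
move: (xz); rewrite ler_distl => /andP[xz1 xz2].
have -> : z (j nu) 0 - eps1 <= x (j nu) 0 by lra.
have -> : x (j nu) 0 <= z (j nu) 0 + eps1 by lra.
move=> /(_ isT) /le_trans; apply.
apply: (le_trans (flat_class_bound b0 gflat _)).
  exact: distance_unit_itv (x1 (j nu)) z01.
apply: ler_pM; rewrite ?powR_ge0//.
  by rewrite le_max lexx.
by rewrite ge0_ler_powR ?nnegrE.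
Qed.

End approximation_error.

(** * Dyadic rounding and the approximating network *)

Section net_approximation.
Context (R : realType).

Lemma measurable_realization q p (Phi : relu_net R q p) :
  measurable_fun setT (realization Phi).
Proof.
have mW k m (W : 'M[R]_(k, m)) : measurable_fun setT (fun x : 'cV[R]_m => W *m x).
  apply: measurable_fun_mx => i l; rewrite (_ : (fun x => _) =
      fun x : 'cV[R]_m => \sum_j W i j * x j l); last by apply/funext => x; rewrite mxE.
  by apply: measurable_sum => h; apply: measurable_funM => //; exact: measurable_entry.
elim: Phi => {p} [p W|p k W b Psi IH]; first exact: mW.
apply: (measurableT_comp IH).
apply: (measurableT_comp (f := shifted_relu b)); last exact: mW.
apply: measurable_fun_mx => i l; rewrite (_ : (fun x => _) =
    fun y : 'cV[R]_k => Num.max (y i 0 - b i 0) 0); last by apply/funext => y; rewrite mxE.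
by apply: measurable_maxr => //; apply: measurable_funB => //; exact: measurable_entry.
Qed.

Lemma net_sets_measurable p L s c (G : set 'cV[R]_p) : net_sets L s c G ->
  measurable G /\ G `<=` unit_cube.
Proof.
move=> [Phi _ ->]; split; last by move=> x [].
apply: measurableI; first exact: measurable_unit_cube.
have mPhi : measurable_fun setT (fun x => realization Phi x 0 0).
  apply: (measurableT_comp (f := fun y : 'cV[R]_1 => y 0 0)); first exact: measurable_entry.
  exact: measurable_realization.
rewrite -[X in measurable X]setTI; apply: (mPhi measurableT [set 1]).
exact: measurable_set1.
Qed.

(** Rounding down stays above -1 because -1 is on the grid; likewise 0, which keeps [theta]
    nonnegative later. *)
Lemma dyadic_round_down (c : nat) (v : R) : -1 <= v <= 1 ->
  exists2 w, dyadic_weights c w & w <= v < w + 2 ^- c /\ (0 <= v -> 0 <= w).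
Proof.
move=> /andP[v1 v2]; have c0 : 0 < 2 ^+ c :> R by rewrite exprn_gt0.
pose k := Num.floor (v * 2 ^+ c).
have /andP[k1 k2] := floor_itv (v * 2 ^+ c); rewrite -/k intrD in k1 k2.
have twoE : ((2 ^ c)%:Z)%:~R = 2 ^+ c :> R by rewrite -pmulrn natrX.
exists (k%:~R / 2 ^+ c).
  exists k => //.
  have kl : (- (2 ^ c)%:Z <= k)%R.
    by rewrite floor_ge_int mulrNz twoE -mulN1r ler_pM2r.
  have ku : (k <= (2 ^ c)%:Z)%R.
    by rewrite -(ler_int R) twoE (le_trans k1)// ler_piMl// ltW.
  by lia.
split; last by move=> v0; rewrite divr_ge0 ?(ltW c0)// ler0z floor_ge0 mulr_ge0// ltW.
rewrite ler_pdivrMr// k1 /= -[X in _ + X]div1r -mulrDl ltr_pdivlMr//.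
Qed.

Lemma dyadic_weights0 c : dyadic_weights c (0 : R).
Proof. by exists 0; rewrite ?mul0r// normr0. Qed.

Lemma dyadic_weights1 c : dyadic_weights c (1 : R).
Proof.
by exists (2 ^ c)%:Z => //; rewrite -pmulrn natrX divff// expf_neq0.
Qed.

Lemma dyadic_weightsN c (w : R) : dyadic_weights c w -> dyadic_weights c (- w).
Proof. by move=> [k kc ->]; exists (- k); rewrite ?abszN// mulrNz mulNr. Qed.

Lemma dyadic_weights_mono c c' (w : R) : (c <= c')%N ->
  dyadic_weights c w -> dyadic_weights c' w.
Proof.
move=> cc' [k kc ->]; exists (k * (2 ^ (c' - c))%:Z).
  by rewrite abszM -[in leqRHS](subnKC cc') expnD leq_mul.
have -> : 2 ^+ c' = 2 ^+ c * 2 ^+ (c' - c) :> R by rewrite -exprD subnKC.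
rewrite intrM -pmulrn natrX.
have n0 m : (2 ^+ m : R) != 0 by rewrite expf_neq0.
by field; rewrite !n0.
Qed.

Lemma weights_in_mono (S S' : set R) q p (Phi : relu_net R q p) : S `<=` S' ->
  weights_in S Phi -> weights_in S' Phi.
Proof.
move=> SS'; elim: Phi => {p} [p W|p k W b Psi IH] /=.
  by move=> SW i j; exact: SS'.
by move=> [SW Sb SPsi]; split=> [i j|i j|]; [exact: SS'|exact: SS'|exact: IH].
Qed.

Lemma net_sets_mono p (L L' s s' : R) c c' (G : set 'cV[R]_p) :
  L <= L' -> s <= s' -> (c <= c')%N -> net_sets L s c G -> net_sets L' s' c' G.
Proof.
move=> LL' ss' cc' [Phi [dL sS wc] ->]; exists Phi => //; split.
- exact: le_trans LL'.
- exact: le_trans ss'.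
- by apply: weights_in_mono wc; move=> w; exact: dyadic_weights_mono.
Qed.

End net_approximation.

Lemma error_constant (R : realType) (M X W eps beta eta : R) (u r n : nat) :
  (u <= r)%N -> 0 <= M -> 0 <= X -> 0 <= W -> 0 < eps -> eta <= eps `^ (1 + beta) ->
  (u * n * 2)%:R * (M * (4 * eta)) + u%:R * (X * (W * eps) `^ beta * (M * (4 * (W * eps)))) <=
  ((r * n * 2)%:R * (M * 4) + r%:R * (X * W `^ beta * (M * (4 * W)))) * eps `^ (1 + beta).
Proof.
move=> ur M0 X0 W0 eps0 eta_eps.
have e0 : 0 <= eps `^ (1 + beta) by exact: powR_ge0.
have epsE : eps `^ (1 + beta) = eps * eps `^ beta.
  by rewrite powRD ?(gt_eqF eps0) ?implybT// powRr1// ltW.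
rewrite [leRHS]mulrDl; apply: lerD.
  apply: (@le_trans _ _ ((u * n * 2)%:R * (M * (4 * eps `^ (1 + beta))))).
    by do 3 (rewrite ler_wpM2l//).
  rewrite [leRHS](_ : _ = (r * n * 2)%:R * (M * (4 * eps `^ (1 + beta)))); last by ring.
  by rewrite ler_wpM2r ?ler_nat ?leq_mul// !mulr_ge0.
rewrite powRM ?(ltW eps0)// epsE.
rewrite [leLHS](_ : _ = u%:R * (X * W `^ beta * (M * (4 * W))) * (eps * eps `^ beta)); last by ring.
rewrite ler_wpM2r ?mulr_ge0 ?powR_ge0 ?(ltW eps0)// ler_wpM2r ?ler_nat//.
by rewrite !mulr_ge0// powR_ge0.
Qed.

(* The oriented coordinate s is compared with the network through the
   contraction s |-> theta s + c0 of [lo, hi]: its slack at the two ends makes an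
   approximation error eps harmless where gamma leaves the box. *)
Lemma threshold_weights (R : realType) (c : nat) (eps eps2 : R) :
  0 < eps -> 0 < eps2 -> (8 / eps2 + 4) * eps <= 1 -> 2 ^- c <= eps ->
  exists2 theta, dyadic_weights c theta & 0 <= theta <= 1 /\
    forall lo hi : R, -1 <= lo <= 1 -> eps2 <= hi - lo ->
    exists2 c0, dyadic_weights c c0 &
      [/\ lo + eps < theta * lo + c0, theta * hi + c0 <= hi - eps &
          forall s : R, `|s| <= 1 -> `|theta * s + c0 - s| + eps <= (16 / eps2 + 7) * eps].
Proof.
move=> eps0 eps20 eps_small.
have e8 : 0 < 8 / eps2 * eps by rewrite mulr_gt0// divr_gt0.
have -> : (16 / eps2 + 7) * eps = 2 * (8 / eps2 * eps) + 7 * eps by ring.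
move: eps_small; rewrite mulrDl; set e := 8 / eps2 * eps in e8 *.
have eE : e * eps2 = 8 * eps by rewrite /e mulrAC divfK// gt_eqF.
move: (2 ^- c) (@dyadic_round_down R c) => eta round eps_small c_eps.
(* With 1 - theta at least e = 8 eps / eps2, the contraction gains at least 8 eps across any box of
   length at least [eps2]. *)
have [|theta thc [/andP[th1 th2] th0]] := round (1 - e).
  by apply/andP; split; lra.
have {}th0 : 0 <= theta by apply: th0; lra.
have d0 : 0 <= 1 - theta by lra.
have le8 : 8 * eps <= (1 - theta) * eps2 by rewrite -eE ler_wpM2r ?(ltW eps20)//; lra.
exists theta => //; split => [|lo hi /andP[lo1 lo2] lohi].
  by apply/andP; split; lra.
have l1 := ler_wpM2l d0 lo1; have l2 := ler_wpM2l d0 lo2.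
have l3 := ler_wpM2l d0 lohi.
(* This lifts the lower end by 3 eps, of which rounding takes at most eps, and leaves 5 eps of the
   gain at the upper end. The smallness assumption on eps keeps the number in [-1, 1]. *)
have [|c0 c0c [/andP[w1 w2] _]] := round ((1 - theta) * lo + 3 * eps).
  by apply/andP; split; lra.
exists c0 => //; split => [||s]; [lra|lra|].
rewrite ler_norml => /andP[s1 s2].
have := ler_wpM2l d0 s1; have := ler_wpM2l d0 s2 => y2 y1.
by rewrite -lerBrDr ler_norml; apply/andP; split; lra.
Qed.

(** The competitor. Precision eps suffices for the contraction weights, but the corners need eps^(1
    + beta), since |2f - 1| need not be small near the faces. [K0] is the cost per fragment and
    layer of carrying the state and the hinges. *)
Lemma boundary_class_approx (R : realType) (n : nat) (F : set ('cV[R]_n.-1 -> R))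
    (Q : probability ('cV[R]_n * bool)%type R) (f : 'cV[R]_n -> R)
    (M beta B eps1 eps2 : R) (r c : nat) (L s eps : R) :
  let W := 16 / eps2 + 7 in
  let K0 := ((n.-1 + (n + n) + (n + 1) + 2) ^ 2 * 16)%N in
  let K1 := ((n + 1) * n + 2 * n + 4)%N in
  regression_function Q f -> density_bounded Q M -> 0 <= M -> 0 <= beta -> 0 <= B ->
  0 < eps2 -> boundary_class F f beta B eps1 eps2 r (bayes_rule f) ->
  (forall gamma, F gamma -> exists2 Phi : relu_net R 1 n.-1, bounded_net L s c Phi &
     (cube_sup (fun x => (realization Phi x 0 0 - gamma x)%R) <= eps%:E)%E) ->
  0 < eps -> (8 / eps2 + 4) * eps <= 1 -> W * eps <= eps1 ->
  2 ^- c <= eps -> 2 ^- c <= eps `^ (1 + beta) -> 0 <= L -> 0 <= s ->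
  exists2 G, net_sets (r%:R * (L + 4) + 2) (r%:R * (s + K0%:R * (L + 1)) + K1%:R) c G &
    (dist_f Q f G (bayes_rule f) <=
      (((r * n * 2)%:R * (M * 4) + r%:R * (Num.max B 1 * W `^ beta * (M * (4 * W)))) *
        eps `^ (1 + beta))%:E)%E.
Proof.
move=> W K0 K1 Qf QM M0 beta0 B0 eps20.
move=> [u [j [sgn [gamma [a [b [Hpart]]]]]]] [ur HE Fab HpartE [disj flat wide]] approx.
move=> eps0 eps_small W_small c_eps c_epsk L0 s0.
have r8 : 0 < eps2^-1 by rewrite invr_gt0.
have W0 : 0 < W by rewrite /W; lra.
have /choice[Phi PhiP] : forall nu, exists Phi : relu_net R 1 n.-1, bounded_net L s c Phi /\
    forall y, unit_cube y -> `|realization Phi y 0 0 - gamma nu y| <= eps.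
  move=> nu; have [Phi bnd sup] := approx _ (Fab nu).1; exists Phi; split => // y y01.
  rewrite -lee_fin; apply: le_trans sup; apply: ereal_sup_ubound.
  by exists y.
have ab nu i : 0 <= a nu i 0 /\ a nu i 0 < b nu i 0 <= 1 := (Fab nu).2 i.
pose eta : R := 2 ^- c.
have eta0 : 0 < eta by rewrite invr_gt0 exprn_gt0.
have ab01 nu i : [/\ 0 <= a nu i 0, a nu i 0 <= 1, 0 <= b nu i 0 & b nu i 0 <= 1].
  by have [a0 /andP[ltab b1]] := ab nu i; split => //; lra.
have corner (v : 'I_u -> 'cV[R]_n) : (forall nu i, 0 <= v nu i 0 <= 1) ->
    exists v' : 'I_u -> 'cV[R]_n, forall nu,
      entries_in (dyadic_weights c) (v' nu) /\ forall i, `|v nu i 0 - v' nu i 0| <= eta.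
  move=> v01; have /choice[g gP] : forall p : 'I_u * 'I_n, exists w,
      dyadic_weights c w /\ `|v p.1 p.2 0 - w| <= eta.
    move=> p; have /andP[v0 v1] := v01 p.1 p.2.
    have [|w wc [/andP[w1 w2] _]] := @dyadic_round_down R c (v p.1 p.2 0).
      by apply/andP; split; lra.
    by exists w; split => //; rewrite ger0_norm ?subr_ge0// lerBlDl ltW.
  exists (fun nu => \col_i g (nu, i)) => nu; split => [i k|i]; rewrite mxE.
    by have [] := gP (nu, i).
  by have [] := gP (nu, i).
have [a' a'P] := corner a (fun nu i => ltac:(by have [-> ->] := ab01 nu i)).
have [b' b'P] := corner b (fun nu i => ltac:(by have [_ _ -> ->] := ab01 nu i)).
have lo_hi nu : -1 <= lower_end j sgn a b nu <= 1 /\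
    eps2 <= upper_end j sgn a b nu - lower_end j sgn a b nu.
  rewrite /lower_end /upper_end; have := wide nu.
  case: (ab01 nu (j nu)); move: (a nu _ _) (b nu _ _) => u1 u2 ? ? ? ? ?.
  by case: (sgn nu); split; do ?[apply/andP; split]; lra.
have [theta thc [th01 thP]] := threshold_weights eps0 eps20 eps_small c_eps.
have /choice[c0 c0P] : forall nu, exists w, dyadic_weights c w /\
    [/\ lower_end j sgn a b nu + eps < theta * lower_end j sgn a b nu + w,
        theta * upper_end j sgn a b nu + w <= upper_end j sgn a b nu - eps &
        forall x : R, `|x| <= 1 -> `|theta * x + w - x| + eps <= W * eps].
  by move=> nu; have [h1 h2] := lo_hi nu; have [w ? ?] := thP _ _ h1 h2; exists w.
pose N nu y := realization (Phi nu) y 0 0.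
pose G := approx_union j sgn N a' b' theta c0.
have netE : G = [set x | unit_cube x /\
    realization (union_net theta j sgn Phi a' b' c0 (enum 'I_u)) x 0 0 = 1].
  apply/seteqP; split => x [x01 xG]; split => //.
    have [nu [xab xN]] := xG; apply/union_netP => //.
    by exists nu; [rewrite mem_enum|split].
  by move: xG => /union_netP-/(_ x01)[nu _ [xab xN]]; exists nu; split.
have netG : net_sets (r%:R * (L + 4) + 2) (r%:R * (s + K0%:R * (L + 1)) + K1%:R) c G.
  exists (union_net theta j sgn Phi a' b' c0 (enum 'I_u)) => //; split.
  - rewrite depth_union_net natrD lerD2r natr_sum big_enum/=.
    apply: (@le_trans _ _ (\sum_(nu < u) (L + 4))).
      by apply: ler_sum => nu _; rewrite natrD lerD2r; have [[]] := PhiP nu.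
    by rewrite sumr_const card_ord -[leLHS]mulr_natl ler_wpM2r ?ler_nat// addr_ge0.
  - have := sparsity_union_net theta j sgn Phi a' b' c0 (enum 'I_u).
    rewrite -(ler_nat R) => /le_trans; apply.
    rewrite natrD lerD2r natr_sum big_enum/=.
    apply: (@le_trans _ _ (\sum_(nu < u) (s + K0%:R * (L + 1)))).
      apply: ler_sum => nu _; have [[dL sS _] _] := PhiP nu.
      by rewrite natrD lerD// natrM ler_wpM2l// -natr1 lerD2r.
    rewrite sumr_const card_ord -[leLHS]mulr_natl ler_wpM2r ?ler_nat//.
    by rewrite addr_ge0// mulr_ge0// addr_ge0.
  - apply: weights_in_union_net; first exact: dyadic_weights0.
    + exact: dyadic_weights1.
    + exact: dyadic_weightsN.
    + exact: thc.
    move=> nu _; have [[_ _ wPhi] _] := PhiP nu.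
    by split; [|exact: (a'P nu).1|exact: (b'P nu).1|exact: (c0P nu).1].
exists G => //; have [mG _] := net_sets_measurable netG.
have fH : bayes_rule f = exact_union j sgn gamma a b.
  by rewrite HE; apply: eq_bigcupr => nu _; rewrite HpartE.
have flat' : 0 < beta -> forall nu x, box (a nu) (b nu) x ->
    cube_boundary (exact_union j sgn gamma a b) x ->
    exists2 g, flat_class beta B g & forall v : R,
      Num.max 0 (x (j nu) 0 - eps1) <= v <= Num.min 1 (x (j nu) 0 + eps1) ->
      `|2 * f (set_coord x (j nu) v) - 1| <= g (const_mx `|v - x (j nu) 0|).
  by rewrite -fH.
have We0 : 0 <= W * eps by rewrite mulr_ge0 ?ltW.
have main := approx_union_error Qf fH mG QM M0 beta0 B0 W_small (ltW eta0) We0 ab disj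
  (fun nu => (a'P nu).2) (fun nu => (b'P nu).2) (fun nu => (PhiP nu).2) th01
  (fun nu => let: conj _ (And3 h _ _) := c0P nu in h)
  (fun nu => let: conj _ (And3 _ h _) := c0P nu in h)
  (fun nu => let: conj _ (And3 _ _ h) := c0P nu in h) flat'.
apply: (le_trans main); rewrite lee_fin.
by apply: error_constant => //; [rewrite le_max ler01 orbT|exact: ltW].
Qed.

(** * Rates *)

Section rate.
Context (R : realType).

Lemma lnE_le (t x : R) : 0 < t -> 0 < x -> ln x <= ln t + x / t.
Proof.
move=> t0 x0; rewrite -lerBlDl -ln_div ?posrE//.
have := le_ln1Dx (x := x / t - 1); rewrite addrCA subrr addr0 => h.
apply: le_trans (h _) _; last by rewrite gerBl.
by rewrite ltrBrDl subrr divr_gt0.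
Qed.

(** The maximum over Z is attained at Z = y. It absorbs the factor tau_n^w into the exponentially
    small probability. *)
Lemma powR_expRN_le (y Z : R) : 0 < y -> 0 < Z -> Z `^ y * expR (- Z) <= y `^ y.
Proof.
move=> y0 Z0; rewrite /powR !gt_eqF// -expRD ler_expR.
have := ler_wpM2l (ltW y0) (lnE_le y0 Z0); rewrite mulrDr mulrC.
rewrite (mulrC y (Z / y)) divfK ?gt_eqF//; lra.
Qed.

Lemma ln_nat_near (C : R) : \forall n \near \oo, C <= ln n%:R.
Proof.
exists (Num.truncn (expR C)).+1 => // n /= nC.
have xC : expR C <= n%:R.
  by rewrite (le_trans (ltW (truncnS_gt _)))// ler_nat.
by rewrite -[C]expRK ler_ln ?posrE ?expR_gt0// (lt_le_trans (expR_gt0 C)).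
Qed.

Context (kappa rho : R) (kappa1 : 1 <= kappa) (rho0 : 0 < rho).
Local Notation D := (2 * kappa + rho - 1).

Let D1 : 1 < D. Proof. by have := kappa1; have := rho0; lra. Qed.

Definition log_tau (n : nat) : R := ln n%:R / D - 2 / rho * ln (ln n%:R).

(* effective n = n^(rho / (2 kappa + rho - 1)) is the order of the logarithm of the
   number of networks and of the exponent of the deviation bound. *)
Definition effective (n : nat) : R := expR (rho / D * ln n%:R).

Lemma tauE n : 0 < ln (n%:R : R) -> tau kappa rho n = expR (log_tau n).
Proof.
move=> l0; have n0 : n%:R != 0 :> R.
  by apply: contraTneq l0 => ->; rewrite ln0 ?ltxx.
rewrite /tau /powR (negPf n0) (gt_eqF l0) -expRN -expRD; congr expR.
by rewrite /log_tau mul1r mulrC.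
Qed.

Lemma log_tau_le n : 1 <= ln (n%:R : R) -> log_tau n <= ln n%:R / D.
Proof. by move=> l1; rewrite gerBl mulr_ge0 ?divr_ge0 ?ln_ge0// ltW. Qed.

Lemma log_tau_le_ln n : 1 <= ln (n%:R : R) -> log_tau n <= ln n%:R.
Proof.
move=> l1; apply: (le_trans (log_tau_le l1)).
by rewrite ler_pdivrMr ?(lt_trans ltr01)// ler_peMr ?(ltW D1)// (le_trans ler01).
Qed.

Lemma log_tau_near (C : R) : \forall n \near \oo, C <= log_tau n.
Proof.
(* With this tangent point the logarithmic correction costs at most half of ln n / D, up to a
   constant. *)
pose t := 4 * D / rho; have D0 := lt_trans ltr01 D1.
have t0 : 0 < t by rewrite divr_gt0 ?mulr_gt0.
near=> n.
have l1 : 1 <= ln (n%:R : R) by near: n; exact: ln_nat_near.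
have l2 : 2 * D * (C + 2 / rho * ln t) <= ln (n%:R : R) by near: n; exact: ln_nat_near.
have l0 := lt_le_trans ltr01 l1.
rewrite /log_tau lerBrDr.
have r0 : 0 <= 2 / rho by rewrite divr_ge0 ?ltW.
apply: (@le_trans _ _ (C + 2 / rho * (ln t + ln n%:R / t))).
  by rewrite lerD2l ler_wpM2l// lnE_le.
have -> : 2 / rho * (ln t + ln n%:R / t) = 2 / rho * ln t + ln n%:R / D / 2.
  by rewrite /t; field; rewrite !gt_eqF.
have : C + 2 / rho * ln t <= ln n%:R / D / 2.
  rewrite ler_pdivlMr// ler_pdivlMr//; apply: le_trans l2.
  by rewrite le_eqVlt; apply/orP; left; apply/eqP; ring.
lra.
Unshelve. all: by end_near. Qed.

(** The exponent 2 / rho in the rate cancels both logarithms of the entropy, one from the sparsity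
    and one from the size of an entry. *)
Lemma effectiveE n : 0 < ln (n%:R : R) ->
  expR (rho * log_tau n) * ln n%:R ^+ 2 = effective n.
Proof.
move=> l0; rewrite -[X in X ^+ 2]lnK ?posrE// -expRM_natl -expRD; congr expR.
by rewrite /log_tau; field; rewrite !gt_eqF// (lt_trans ltr01).
Qed.

(** The deviation exponent at excess risk tau^(-kappa) is n tau^(-(2 kappa - 1)); since tau <=
    n^(1/D), it is at least n^(1 - (2 kappa - 1)/D) = n^(rho/D). *)
Lemma effective_le_excess n : 1 <= ln (n%:R : R) ->
  effective n <= n%:R * expR (- ((2 * kappa - 1) * log_tau n)).
Proof.
move=> l1; have l0 := lt_le_trans ltr01 l1.
have n0 : 0 < (n%:R : R).
  by rewrite lt_def ler0n andbT; apply: contraTneq l0 => ->; rewrite ln0 ?ltxx.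
rewrite -[X in _ <= X * _](lnK n0) -expRD /effective ler_expR.
have k0 : 0 <= 2 * kappa - 1 by have := kappa1; lra.
have := ler_wpM2l k0 (log_tau_le l1).
have -> : rho / D * ln n%:R = ln n%:R - (2 * kappa - 1) * (ln n%:R / D).
  by field; rewrite gt_eqF// (lt_trans ltr01).
lra.
Qed.

Lemma expR_log_tau_le n (y : R) : 0 <= y -> 1 <= ln (n%:R : R) ->
  expR (y * log_tau n) <= effective n `^ (y / rho).
Proof.
move=> y0 l1; rewrite /effective -expRM ler_expR.
have := ler_wpM2l y0 (log_tau_le l1); congr (_ <= _).
by field; rewrite !gt_eqF// (lt_trans ltr01).
Qed.

End rate.

(** Every factor in the choices for one entry is exp(O(l)), even the number of slots, which grows
    like a power of n. With S entries the logarithm is of order S l, and Lam <= l gives the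
    square. *)
Lemma code_count_le (R : realType) (d L S c : nat) (A1 A2 A3 rho Lam l : R) :
  1 <= l -> 0 <= Lam <= l -> 0 <= rho -> 0 <= A1 -> 0 <= A2 -> 0 <= A3 ->
  L%:R <= A1 * l -> c%:R <= A3 * l -> S%:R <= A2 * expR (rho * Lam) * Lam ->
  (L.+1 * (L.+1 * (d + S + 1) * (d + S + 1).+1 * (2 ^ c.+1).+1) ^ S)%:R <=
  expR ((A1 + (A1 + 2 * (d%:R + 3 + A2 + rho) + A3 + 2) * A2) *
        (expR (rho * Lam) * l ^+ 2)).
Proof.
move=> l1 /andP[Lam0 Lam_l] rho0 A10 A20 A30 Ll cl Sl.
set Z := expR (rho * Lam) * l ^+ 2; set C4 := A1 + 2 * _ + A3 + 2.
have l0 : 0 <= l := le_trans ler01 l1.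
have S1_exp k : k.+1%:R <= expR k%:R :> R by rewrite -natr1 addrC expR_ge1Dx.
have eL : L.+1%:R <= expR (A1 * l) by rewrite (le_trans (S1_exp L))// ler_expR.
have eS : S%:R <= A2 * expR ((rho + 1) * l).
  apply: (le_trans Sl); rewrite -mulrA ler_wpM2l// mulrDl mul1r expRD.
  apply: ler_pM; rewrite ?expR_ge0//; first by rewrite ler_expR ler_wpM2l.
  by rewrite (le_trans Lam_l)// (le_trans _ (expR_ge1Dx l))// lerDr.
have e1 : 1 <= expR ((rho + 1) * l) by rewrite -expR0 ler_expR mulr_ge0// addr_ge0.
have eN k : (k <= d + S + 2)%N -> k%:R <= expR ((d%:R + 3 + A2 + rho) * l).
  move=> kN; apply: (@le_trans _ _ ((d%:R + 2 + A2) * expR ((rho + 1) * l))).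
    have : k%:R <= d%:R + S%:R + 2 :> R by rewrite -!natrD ler_nat.
    move/le_trans; apply.
    have : d%:R + 2 <= (d%:R + 2) * expR ((rho + 1) * l) by rewrite ler_peMr// addr_ge0.
    move: eS; move: (expR _) => e; lra.
  have dA : 0 <= d%:R + 2 + A2 by rewrite !addr_ge0.
  apply: (@le_trans _ _ (expR (d%:R + 2 + A2) * expR ((rho + 1) * l))).
    rewrite ler_wpM2r ?expR_ge0// (le_trans _ (expR_ge1Dx _))// lerDr//.
  rewrite -expRD ler_expR; have := ler_peMr dA l1; lra.
have ec : (2 ^ c.+1).+1%:R <= expR ((A3 + 2) * l).
  have e2 : 2 <= expR 1 :> R by rewrite (le_trans _ (expR_ge1Dx 1)).
  have : (2 ^ c.+1).+1%:R <= (2 ^ c.+2)%:R :> R.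
    by rewrite ler_nat [(2 ^ c.+2)%N]expnS mul2n -addnn -addn1 leq_add2l expn_gt0.
  move/le_trans; apply; rewrite natrX (le_trans (y := expR 1 ^+ c.+2))//.
    by rewrite lerXn2r ?nnegrE ?expR_ge0.
  rewrite -expRM_natl mulr1 ler_expR -addn2 natrD; lra.
have eP : (L.+1 * (d + S + 1) * (d + S + 1).+1 * (2 ^ c.+1).+1)%:R <= expR (C4 * l).
  have -> : C4 * l = A1 * l + (d%:R + 3 + A2 + rho) * l + (d%:R + 3 + A2 + rho) * l + (A3 + 2) * l.
    by rewrite /C4; ring.
  rewrite !expRD !natrM; apply: ler_pM; rewrite ?mulr_ge0//.
  apply: ler_pM; rewrite ?mulr_ge0//; last by apply: eN; rewrite -addnS.
  by apply: ler_pM => //; apply: eN; rewrite leq_add2l.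
have C40 : 0 <= C4 by rewrite /C4 !addr_ge0// mulr_ge0// !addr_ge0.
rewrite natrM natrX (le_trans (y := expR (A1 * l) * expR (C4 * l) ^+ S))//.
  by apply: ler_pM => //; rewrite ?exprn_ge0// lerXn2r ?nnegrE ?expR_ge0.
rewrite -expRM_natl -expRD ler_expR [leRHS]mulrDl.
have eR : 1 <= expR (rho * Lam) by rewrite -expR0 ler_expR mulr_ge0.
have lZ : l <= Z.
  rewrite /Z expr2 -[leLHS]mul1r; apply: ler_pM => //.
  by rewrite ler_peMr.
apply: lerD; first by rewrite ler_wpM2l.
have -> : S%:R * (C4 * l) = C4 * (S%:R * l) by ring.
rewrite -mulrA ler_wpM2l//.
apply: (@le_trans _ _ (A2 * expR (rho * Lam) * Lam * l)); first by rewrite ler_wpM2r.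
rewrite -!mulrA ler_wpM2l// ler_wpM2l ?expR_ge0// expr2 ler_wpM2r//.
Qed.

(** * Size of the networks at accuracy exp(- Lam), the inverse of tau *)

Section architecture.
Context (R : realType) (Lam : R) (Lam1 : 1 <= Lam).
Local Notation eps := (expR (- Lam)).

Lemma ln_expRN_inv : ln eps^-1 = Lam.
Proof. by rewrite -expRN opprK expRK. Qed.

Lemma ceil_bounds : Lam <= (Num.ceil Lam)%:~R <= 2 * Lam.
Proof.
have /andP[] := ceil_itv Lam; rewrite intrB => h1 ->.
by have := Lam1; lra.
Qed.

Lemma net_depth_bounds a1 : 0 < a1 ->
  a1 * Lam <= net_depth a1 eps <= 2 * a1 * Lam.
Proof.
move=> a10; rewrite /net_depth ln_expRN_inv; have /andP[c1 c2] := ceil_bounds.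
by rewrite (mulrC 2) -mulrA !ler_wpM2l// ltW.
Qed.

Lemma net_sparsityE a2 rho : net_sparsity a2 rho eps = a2 * expR (rho * Lam) * Lam.
Proof. by rewrite /net_sparsity ln_expRN_inv -expRM mulrNN (mulrC rho). Qed.

Lemma net_precision_bounds a3 a4 : (0 < a4)%N ->
  Lam <= (net_precision a3 a4 eps)%:R <= (a3%:R + 2 * a4%:R) * Lam.
Proof.
move=> a40; rewrite /net_precision ln_expRN_inv; have /andP[c1 c2] := ceil_bounds.
have cE : (`|Num.ceil Lam|%N)%:R = (Num.ceil Lam)%:~R :> R.
  by rewrite natr_absz ger0_norm// -(ler_int R) (le_trans _ c1)// (le_trans ler01).
rewrite natrD natrM cE.
have a41 : 1 <= a4%:R :> R by rewrite ler1n.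
have l0 := le_trans ler01 Lam1.
have h1 : (Num.ceil Lam)%:~R <= a4%:R * (Num.ceil Lam)%:~R :> R.
  by rewrite ler_peMl// (le_trans l0).
have h2 : a4%:R * (Num.ceil Lam)%:~R <= a4%:R * (2 * Lam) by rewrite ler_wpM2l.
have h3 : a3%:R <= a3%:R * Lam by rewrite ler_peMr.
have h4 : 0 <= a3%:R :> R by [].
by apply/andP; split; lra.
Qed.

(** Origin of [C1]: as Lam >= 1, the depth is at least [a1], so additive constants turn into
    multiples of it. *)
Lemma depth_constant (r : nat) a1 : 0 < a1 ->
  r%:R * (net_depth a1 eps + 4) + 2 <= (r%:R * (1 + 4 / a1) + 2 / a1) * net_depth a1 eps.
Proof.
move=> a10; have /andP[h1 _] := net_depth_bounds a10.
have L1 : 1 <= net_depth a1 eps / a1.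
  by rewrite ler_pdivlMr// mul1r (le_trans _ h1)// ler_peMr// ltW.
have -> : (r%:R * (1 + 4 / a1) + 2 / a1) * net_depth a1 eps =
   r%:R * (net_depth a1 eps + 4 * (net_depth a1 eps / a1)) + 2 * (net_depth a1 eps / a1).
  by ring.
by apply: lerD; [rewrite ler_wpM2l// lerD2l ler_peMr|rewrite ler_peMr].
Qed.

(** Origin of [C2]: the sparsity divided by [a2] dominates both Lam and 1, hence the depth and all
    constants. *)
Lemma sparsity_constant (r K0 K1 : nat) a1 a2 rho : 0 < a1 -> 0 < a2 -> 0 <= rho ->
  r%:R * (net_sparsity a2 rho eps + K0%:R * (net_depth a1 eps + 1)) + K1%:R <=
  (r%:R * (1 + K0%:R * (2 * a1 / a2 + 1 / a2)) + K1%:R / a2) * net_sparsity a2 rho eps.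
Proof.
move=> a10 a20 rho0; have /andP[_ h1] := net_depth_bounds a10.
set s := net_sparsity a2 rho eps; pose w := s / a2.
have l0 := le_trans ler01 Lam1.
have wE : w = expR (rho * Lam) * Lam.
  by rewrite /w /s net_sparsityE mulrC !mulrA mulVf ?mul1r// gt_eqF.
have Lw : Lam <= w.
  by rewrite wE ler_peMl// -expR0 ler_expR mulr_ge0.
have w1 : 1 <= w by rewrite (le_trans Lam1).
have -> : (r%:R * (1 + K0%:R * (2 * a1 / a2 + 1 / a2)) + K1%:R / a2) * s =
   r%:R * (s + K0%:R * (2 * a1 * w + w)) + K1%:R * w by rewrite /w; ring.
apply: lerD; last by rewrite ler_peMr.
rewrite ler_wpM2l// lerD2l ler_wpM2l// lerD// (le_trans h1)//.
by rewrite ler_wpM2l// mulr_ge0// ltW.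
Qed.

(** From 2 >= e^(1/2): 2^(-C3 c) <= exp(-C3 c / 2) <= exp(-kappa Lam), whence the requirement C3 >=
    2 kappa. *)
Lemma precision_constant (C3 c : nat) (kappa : R) : 0 <= kappa ->
  2 * kappa <= C3%:R -> Lam <= c%:R -> 2 ^- (C3 * c) <= eps `^ kappa.
Proof.
move=> k0 kC Lc; rewrite -expRM mulNr expRN lef_pV2 ?posrE ?exprn_gt0 ?expR_gt0//.
have e2 : expR (1 / 2) <= 2 :> R.
  by have := @expR_le_quadratic R (1 / 2); rewrite expr2; lra.
apply: (@le_trans _ _ (expR (1 / 2) ^+ (C3 * c))); last first.
  by rewrite lerXn2r ?nnegrE ?expR_ge0.
rewrite -expRM_natl ler_expR natrM.
have := ler_pM k0 (le_trans ler01 Lam1) (_ : kappa <= C3%:R / 2) Lc.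
by rewrite mulrC; lra.
Qed.

End architecture.

(** The threshold term yields K^w exactly. In the other one, exp(C5 Z) candidates against deviations
    exp(-(C5 + 1) Z) leave exp(-Z), which beats tau^w <= Z^(w/rho). *)
Lemma moment_rate (R : realType) (kappa rho K C5 C c q w : R) (n card : nat) :
  let T0 := (K * expR (- log_tau kappa rho n)) `^ kappa in
  1 <= kappa -> 0 < rho -> 1 <= ln (n%:R : R) -> 1 <= K -> 0 <= C -> 0 < c -> 0 < w ->
  q * kappa = w -> C5 + 1 <= c * K / 4 ->
  card%:R <= expR (C5 * effective kappa rho n) ->
  tau kappa rho n `^ w *
    (C * (T0 `^ q + card%:R * expR (- (n%:R * c * T0 `^ (2 - kappa^-1) / 4)))) <=
  C * (K `^ w + (w / rho) `^ (w / rho)).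
Proof.
move=> T0 k1 rho0 l1 K1 C0 c0 w0 qk C5K cardC.
have l0 := lt_le_trans ltr01 l1; have K0 := lt_le_trans ltr01 K1.
set Lam := log_tau kappa rho n in T0 *; set Z := effective kappa rho n in cardC *.
have kn0 : kappa != 0 by rewrite gt_eqF// (lt_le_trans ltr01).
have Kn0 : K != 0 by rewrite gt_eqF.
rewrite tauE// -/Lam -expRM mulrCA ler_wpM2l// mulrDr.
have T0q (y : R) : T0 `^ y = K `^ (kappa * y) * expR (- (kappa * y * Lam)).
  rewrite /T0 -powRrM powRM ?expR_ge0 ?(ltW K0)// -expRM; congr (_ * expR _).
  by rewrite mulNr mulrC.
apply: lerD.
  rewrite T0q (mulrC kappa) qk mulrCA -expRD (mulrC Lam) subrr expR0 mulr1 lexx//.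
have kk : kappa * (2 - kappa^-1) = 2 * kappa - 1 by rewrite mulrBr divff// mulrC.
have dev : (C5 + 1) * Z <= n%:R * c * T0 `^ (2 - kappa^-1) / 4.
  have Ze := effective_le_excess k1 rho0 l1; rewrite -/Z -/Lam in Ze.
  have Z0 : 0 <= Z by exact: expR_ge0.
  apply: (@le_trans _ _ (c * K / 4 * (n%:R * expR (- ((2 * kappa - 1) * Lam))))).
    apply: (le_trans (ler_wpM2r Z0 C5K)); rewrite ler_wpM2l//.
    by rewrite divr_ge0// mulr_ge0// ltW.
  rewrite T0q kk.
  (* A factor K in the threshold thus multiplies the deviation exponent by at least K. *)
  have KK : K <= K `^ (2 * kappa - 1).
    by rewrite -[leLHS]powRr1 ?(ltW K0)// ler_powR//; lra.
  have -> : n%:R * c * (K `^ (2 * kappa - 1) * expR (- ((2 * kappa - 1) * Lam))) / 4 =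
    c * K `^ (2 * kappa - 1) / 4 * (n%:R * expR (- ((2 * kappa - 1) * Lam))) by ring.
  rewrite ler_wpM2r ?mulr_ge0 ?expR_ge0// ler_wpM2r// ler_wpM2l// ltW//.
have y0 : 0 < w / rho by rewrite divr_gt0.
have Zgt0 : 0 < Z by exact: expR_gt0.
apply: le_trans (powR_expRN_le y0 Zgt0).
apply: ler_pM; rewrite ?mulr_ge0 ?expR_ge0//.
  by rewrite mulrC; apply: expR_log_tau_le => //; exact: ltW.
apply: (@le_trans _ _ (expR (C5 * Z) * expR (- ((C5 + 1) * Z)))).
  by apply: ler_pM; rewrite ?expR_ge0// ler_expR lerN2.
by rewrite -expRD ler_expR; lra.
Qed.

Lemma net_sets_code (R : realType) p (L s : R) c : 0 <= L -> 0 <= s ->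
  let L' := Num.truncn L in let S := Num.truncn s in let N := (p + S + 1)%N in
  exists (K : finType) (dec : K -> set 'cV[R]_p),
    (forall G, net_sets L s c G -> exists k, G = dec k) /\
    #|K| = (L'.+1 * (L'.+1 * N * N.+1 * (2 ^ c.+1).+1) ^ S)%N.
Proof.
move=> L0 s0 L' S N; exists (code_type L' N c S), (@decode R p L' N c S); split; last first.
  exact: card_code_type.
move=> _ [Phi [dL sS wc] ->].
apply: net_sets_decode => //.
- by rewrite truncn_ge_nat.
- by rewrite truncn_ge_nat.
- by rewrite /N -addnA leq_addr.
- by rewrite /N addnAC leq_addl.
- by rewrite /N addn1.
Qed.

Lemma rho_max_gt0 (R : realType) r (t : nat -> nat) (beta : nat -> R) :
  (0 < r)%N -> (0 < t 0%N)%N -> (forall i, (i < r)%N -> 0 < beta i) ->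
  0 < rho_max r t beta.
Proof.
move=> r0 t0 beta0.
have := le_bigmax 0 (fun i : 'I_r => (t i)%:R / beta_star r beta i) (Ordinal r0).
apply: lt_le_trans; rewrite divr_gt0 ?ltr0n// mulr_gt0 ?beta0//.
rewrite big_nat_cond; apply: prodr_gt0 => i /andP[/andP[_ ir] _].
by rewrite lt_min ltr01 beta0.
Qed.

Lemma limn_esup_lty (R : realType) (v : (\bar R)^nat) (C : R) :
  (\forall n \near \oo, (v n <= C%:E)%E) -> (limn_esup v < +oo)%E.
Proof.
move=> [m _ vC]; apply: (@le_lt_trans _ _ C%:E); last exact: ltry.
rewrite limn_esup_lim; apply: lime_le; first exact: is_cvg_esups.
exists m => // n /= mn; apply: ge_ereal_sup => _ [k /= nk <-].
by apply: vC => /=; exact: leq_trans nk.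
Qed.

Theorem corollary3p10 (R : realType) (r2 : nat) (t d : nat -> nat)
  (beta1 : R) (beta2 : nat -> R) (B1 B2 : R)
  (r2_gt0 : (0 < r2)%N)
  (t_gt0 : forall i, (i < r2)%N -> (0 < t i)%N)
  (d_gt0 : forall i, (i <= r2)%N -> (0 < d i)%N)
  (beta1_ge0 : 0 <= beta1)
  (beta2_gt0 : forall i, (i < r2)%N -> 0 < beta2 i)
  (B1_gt0 : 0 < B1) (B2_gt0 : 0 < B2)
  (d_last : d r2 = 1%N)
  (t_head : (t 0%N < d 0%N)%N)
  (t_le_d : forall i, (0 < i < r2)%N -> (t i <= d i)%N)
  (QQ : set (probability ('cV[R]_(d 0%N) * bool)%type R))
  (f : probability ('cV[R]_(d 0%N) * bool)%type R -> 'cV[R]_(d 0%N) -> R)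
  (QQ_support : forall Q, QQ Q -> Q (unit_cube `*` [set: bool]) = 1%E)
  (f_regression : forall Q, QQ Q -> regression_function Q (f Q))
  (hyp_a : exists2 M : R, 1 < M & forall Q, QQ Q -> density_bounded Q M)
  (hyp_b : exists (r1 : nat) (eps1 eps2 : R),
    [/\ (0 < r1)%N, 0 < eps1, 0 < eps2 &
      forall Q, QQ Q ->
        boundary_class (comp_class r2 t beta2 B2 (pred_head d)) (f Q)
          beta1 B1 eps1 eps2 r1 (bayes_rule (f Q))])
  (hyp_c : exists2 c1 : R, 0 < c1 &
    forall Q, QQ Q -> forall (n : nat) G, net_sets n%:R n%:R n G ->
      (c1%:E * dist_sd Q G (bayes_rule (f Q)) `^ (1 + beta1)
         <= dist_f Q (f Q) G (bayes_rule (f Q)))%E)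
  (a1 a2 : R) (a3 a4 : nat)
  (a1_gt0 : 0 < a1) (a2_gt0 : 0 < a2) (a3_gt0 : (0 < a3)%N)
  (a4_gt0 : (0 < a4)%N)
  (approximation : exists2 eps0 : R, 0 < eps0 &
    forall gamma, comp_class r2 t beta2 B2 (pred_head d) gamma ->
    forall eps : R, 0 < eps < eps0 ->
      exists2 Phi : relu_net R 1 (pred_head d 0%N),
        bounded_net (net_depth a1 eps)
          (net_sparsity a2 (rho_max r2 t beta2) eps)
          (net_precision a3 a4 eps) Phi &
        (cube_sup (fun x => (realization Phi x 0 0 - gamma x)%R) <= eps%:E)%E) :
  let kappa := 1 + beta1 in
  let rho := rho_max r2 t beta2 in
  let tau_ := tau kappa rho in
  exists (C1 C2 : R) (C3 : nat),
    [/\ 0 < C1, 0 < C2, (0 < C3)%N &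
    let NN n := net_sets (C1 * net_depth a1 (tau_ n)^-1)
                  (C2 * net_sparsity a2 rho (tau_ n)^-1)
                  (C3 * net_precision a3 a4 (tau_ n)^-1)%N in
    forall Ghat : forall n,
      n.-tuple ('cV[R]_(d 0%N) * bool) -> set 'cV[R]_(d 0%N),
    (\forall n \near \oo, empirical_minimizer (NN n) (Ghat n)) ->
    forall p : R, 1 <= p ->
      (limn_esup (fun n => ereal_sup
        [set (tau_ n `^ (p * kappa))%:E *
             \int[power_measure Q n]_z
               (dist_f Q (f Q) (Ghat n z) (bayes_rule (f Q))) `^ p
         | Q in QQ]) < +oo)%E /\
      (limn_esup (fun n => ereal_sup
        [set (tau_ n `^ p)%:E *
             \int[power_measure Q n]_z
               (dist_sd Q (Ghat n z) (bayes_rule (f Q))) `^ p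
         | Q in QQ]) < +oo)%E].
Proof.
move=> kappa rho tau_.
have rho0 : 0 < rho by apply: rho_max_gt0 => //; exact: t_gt0.
have kappa1 : 1 <= kappa by rewrite /kappa lerDl.
have kappa0 : 0 < kappa := lt_le_trans ltr01 kappa1.
have [M M1 dens] := hyp_a; have M0 : 0 <= M by rewrite ltW// (lt_trans ltr01).
have [r1 [eps1 [eps2 [r1_gt0 eps1_gt0 eps2_gt0 bayes]]]] := hyp_b.
have [c1 c1_gt0 margin] := hyp_c.
have [eps0 eps0_gt0 approx] := approximation.
pose D := d 0%N.
pose W : R := 16 / eps2 + 7.
pose K0 := ((D.-1 + (D + D) + (D + 1) + 2) ^ 2 * 16)%N.
pose K1 := ((D + 1) * D + 2 * D + 4)%N.
pose C1 : R := r1%:R * (1 + 4 / a1) + 2 / a1.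
pose C2 : R := r1%:R * (1 + K0%:R * (2 * a1 / a2 + 1 / a2)) + K1%:R / a2.
pose C3 := (Num.truncn (2 * kappa)).+1.
have r1_gt0' : 0 < r1%:R :> R by rewrite ltr0n.
have C1_gt0 : 0 < C1.
  by rewrite ltr_wpDl ?divr_gt0// mulr_ge0 ?ler0n// addr_ge0// divr_ge0// ltW.
have C2_gt0 : 0 < C2.
  rewrite ltr_wpDr ?divr_ge0 ?(ltW a2_gt0)// mulr_gt0// ltr_wpDr//.
  by rewrite mulr_ge0// addr_ge0// !divr_ge0 ?mulr_ge0 ?(ltW a1_gt0) ?(ltW a2_gt0).
have C3_kappa : 2 * kappa <= C3%:R by rewrite ltW// truncnS_gt.
exists C1, C2, C3; split => // NN Ghat ermin p p1.
have p0 : 0 < p := lt_le_trans ltr01 p1.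
pose A : R := (r1 * D * 2)%:R * (M * 4) + r1%:R * (Num.max B1 1 * W `^ beta1 * (M * (4 * W))).
pose c : R := Num.min (1 / 2) (c1 `^ kappa^-1 / 16).
have c_gt0 : 0 < c by rewrite lt_min divr_gt0//= divr_gt0// powR_gt0.
pose A1 := C1 * (2 * a1); pose A2 := C2 * a2; pose A3 : R := C3%:R * (a3%:R + 2 * a4%:R).
pose C5 := A1 + (A1 + 2 * (D%:R + 3 + A2 + rho) + A3 + 2) * A2.
(* The second entry lets deviations beat the number of networks, the third makes twice the bias
   smaller than the threshold. *)
pose K := Num.max 1 (Num.max (4 * (C5 + 1) / c) (2 * A)).
have K_ge1 : 1 <= K by rewrite le_max lexx.
have K_c : C5 + 1 <= c * K / 4.
  have : 4 * (C5 + 1) / c <= K by rewrite !le_max lexx orbT.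
  by rewrite ler_pdivrMr// ler_pdivlMr//; lra.
have K_A : 2 * A <= K by rewrite !le_max lexx !orbT.
have W0 : 0 < W by rewrite ltr_wpDl// divr_ge0// ltW.
(* Below this accuracy the contraction weights exist, the misclassified points stay within the
   flatness radius [eps1], and the assumed network approximation applies. *)
pose thr := Num.min (1 / (8 / eps2 + 4)) (Num.min (eps1 / W) (eps0 / 2)).
have e8 : 0 < 8 / eps2 + 4 by rewrite ltr_wpDl// divr_ge0// ltW.
have thr_gt0 : 0 < thr by rewrite !lt_min !divr_gt0.
pose T0 n : R := (K * expR (- log_tau kappa rho n)) `^ kappa.
pose Q_bound (q C : R) n (phi : probability ('cV[R]_D * bool)%type R -> set 'cV[R]_D -> \bar R) :=
  forall Q, QQ Q ->
    (forall G, NN n G -> (0 <= phi Q G <= (C * fine (dist_f Q (f Q) G (bayes_rule (f Q))) `^ q)%:E)%E).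
have NN_measurable n G : NN n G -> measurable G by move=> /net_sets_measurable[].
have NN_margin Q n G : QQ Q -> NN n G ->
    (c1%:E * dist_sd Q G (bayes_rule (f Q)) `^ kappa <= dist_f Q (f Q) G (bayes_rule (f Q)))%E.
  move=> QQn; rewrite /NN; set L := C1 * _; set s := C2 * _; set cc := (C3 * _)%N => Gnet.
  (* The margin hypothesis speaks of equal bounds for depth, sparsity and precision; [m] exceeds all
     three. *)
  pose m := ((Num.truncn L).+1 + (Num.truncn s).+1 + cc)%N.
  apply: (margin Q QQn m); apply: net_sets_mono Gnet.
  - by rewrite (le_trans (ltW (truncnS_gt _)))// ler_nat /m -addnA leq_addr.
  - by rewrite (le_trans (ltW (truncnS_gt _)))// ler_nat /m addnAC leq_addl.
  - by rewrite /m leq_addl.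
(* Both claims are instances: q = p and w = p kappa for [dist_f], q = p / kappa and w = p for
   [dist_sd]. *)
have moment (q w C : R) phi : 0 <= C -> 0 < w -> 0 <= q -> q * kappa = w ->
    (forall n, Q_bound q C n phi) ->
    \forall n \near \oo, forall Q, QQ Q ->
      ((tau_ n `^ w)%:E * \int[power_measure Q n]_z phi Q (Ghat n z) <=
       (C * (K `^ w + (w / rho) `^ (w / rho)))%:E)%E.
  move=> C0 w0 q0 qw phiP.
  (* The sample size is taken large before [Q] is introduced, which gives uniformity over [QQ]. *)
  near=> n => Q QQn.
  have l1 : 1 <= ln (n%:R : R) by near: n; exact: ln_nat_near.
  have Lam1 : 1 <= log_tau kappa rho n by near: n; exact: log_tau_near.
  have Lam_thr : - ln thr <= log_tau kappa rho n by near: n; exact: log_tau_near.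
  have min_n : empirical_minimizer (NN n) (Ghat n) by near: n.
  have l0 := lt_le_trans ltr01 l1.
  have tauN : (tau_ n)^-1 = expR (- log_tau kappa rho n) by rewrite /tau_ tauE// expRN.
  set Lam := log_tau kappa rho n in Lam1 Lam_thr tauN.
  have Lam0 := le_trans ler01 Lam1.
  have Lam_l : Lam <= ln n%:R by exact: log_tau_le_ln.
  pose eps := expR (- Lam).
  have eps_gt0 : 0 < eps by exact: expR_gt0.
  have eps_thr : eps <= thr by rewrite -[thr]lnK ?posrE// ler_expR lerNl.
  have eps_small : (8 / eps2 + 4) * eps <= 1.
    by rewrite mulrC -ler_pdivlMr// (le_trans eps_thr)// ge_min lexx.
  have eps_W : W * eps <= eps1.
    by rewrite mulrC -ler_pdivlMr// (le_trans eps_thr)// !ge_min lexx orbT.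
  have eps_lt0 : eps < eps0.
    have : eps <= eps0 / 2 by rewrite (le_trans eps_thr)// !ge_min lexx !orbT.
    by move: eps0_gt0; lra.
  pose L := net_depth a1 eps; pose s := net_sparsity a2 rho eps.
  pose cc := net_precision a3 a4 eps.
  have NNE : NN n = net_sets (C1 * L) (C2 * s) (C3 * cc)%N by rewrite /NN tauN.
  have /andP[L_lo L_hi] := net_depth_bounds Lam1 a1_gt0.
  have /andP[cc_lo cc_hi] := net_precision_bounds Lam1 a3 a4_gt0.
  have sE : s = a2 * expR (rho * Lam) * Lam by exact: net_sparsityE.
  have L0 : 0 <= L by apply: le_trans L_lo; rewrite mulr_ge0// ltW.
  have s0 : 0 <= s by rewrite sE !mulr_ge0 ?expR_ge0// ltW.
  have depth_le := depth_constant Lam1 r1 a1_gt0.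
  have sparsity_le := sparsity_constant Lam1 r1 K0 K1 a1_gt0 a2_gt0 (ltW rho0).
  have prec_k : 2 ^- (C3 * cc) <= eps `^ kappa.
    by apply: (precision_constant Lam1 (ltW kappa0)).
  have prec_1 : 2 ^- (C3 * cc) <= eps.
    apply: (le_trans prec_k); rewrite -expRM ler_expR mulNr lerN2.
    by rewrite ler_peMr.
  have [G0 G0net G0err] : exists2 G0, NN n G0 &
      (dist_f Q (f Q) G0 (bayes_rule (f Q)) <= (A * eps `^ kappa)%:E)%E.
    have [|G0 G0net G0err] := boundary_class_approx (c := (C3 * cc)%N) (L := L) (s := s) (eps := eps)
      (f_regression Q QQn) (dens Q QQn) M0 beta1_ge0 (ltW B1_gt0) eps2_gt0 (bayes Q QQn)
      _ eps_gt0 eps_small eps_W prec_1 prec_k L0 s0.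
      move=> gamma Fgamma; have [|Phi [dPhi sPhi wPhi] err] := approx gamma Fgamma eps.
        by rewrite eps_gt0.
      (* The given network has precision [cc]; its weights also lie on the finer grid of precision
         C3 cc. *)
      exists Phi => //; split => //; apply: weights_in_mono wPhi.
      by move=> w'; apply: dyadic_weights_mono; rewrite /C3 mulSn leq_addr.
    by exists G0 => //; rewrite NNE; apply: net_sets_mono G0net.
  have NNprop G : NN n G -> [/\ measurable G, G `<=` unit_cube &
      (c1%:E * dist_sd Q G (bayes_rule (f Q)) `^ kappa <=
       dist_f Q (f Q) G (bayes_rule (f Q)))%E].
    move=> NNG; have [mG G1] := net_sets_measurable NNG; split => //.
    exact: NN_margin NNG.
  have C1L : 0 <= C1 * L by rewrite mulr_ge0// ltW.
  have C2s : 0 <= C2 * s by rewrite mulr_ge0// ltW.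
  have [Kc [dec [decP cardE]]] := @net_sets_code R D (C1 * L) (C2 * s) (C3 * cc) C1L C2s.
  have card_le : #|Kc|%:R <= expR (C5 * effective kappa rho n) :> R.
    rewrite cardE -effectiveE//; apply: code_count_le => //.
    - by rewrite Lam0.
    - exact: ltW.
    - by rewrite mulr_ge0 ?mulr_ge0 ?(ltW C1_gt0) ?(ltW a1_gt0).
    - by rewrite mulr_ge0 ?(ltW C2_gt0) ?(ltW a2_gt0).
    - by rewrite mulr_ge0// addr_ge0// mulr_ge0.
    - rewrite (le_trans (y := C1 * L)) ?truncn_le// /A1 -mulrA ler_wpM2l ?(ltW C1_gt0)//.
      by rewrite (le_trans L_hi)// ler_wpM2l// mulr_ge0// ltW.
    - rewrite natrM /A3 -mulrA ler_wpM2l//.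
      by rewrite (le_trans cc_hi)// ler_wpM2l// addr_ge0// mulr_ge0.
    - by rewrite (le_trans (y := C2 * s)) ?truncn_le// sE /A2 !mulrA.
  have G0T : 2 * fine (dist_f Q (f Q) G0 (bayes_rule (f Q))) <= T0 n.
    have [mG0 _ _] := NNprop _ G0net.
    have [E _] := dist_f_fineK (f_regression Q QQn) mG0.
    move: G0err; rewrite E lee_fin => G0err.
    rewrite /T0 powRM ?expR_ge0 ?(le_trans ler01)// -/Lam -/eps.
    have e0 : 0 <= eps `^ kappa by exact: powR_ge0.
    apply: (@le_trans _ _ (2 * A * eps `^ kappa)); first by rewrite -mulrA ler_wpM2l.
    rewrite ler_wpM2r// (le_trans K_A)// -[leLHS]powRr1 ?(le_trans ler01)//.
    by rewrite ler_powR.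
  have [T0_ge0 NNdec] : 0 <= T0 n /\ forall G, NN n G -> exists k, G = dec k.
    by split; [exact: powR_ge0|rewrite NNE].
  have erm := erm_moment (f_regression Q QQn) c1_gt0 kappa1 T0_ge0 q0 C0 NNdec NNprop
    G0net G0T min_n (phiP n Q QQn).
  have rate := moment_rate kappa1 rho0 l1 K_ge1 C0 c_gt0 w0 qw K_c card_le.
  apply: (@le_trans _ _ ((tau_ n `^ w)%:E * (C * (T0 n `^ q + #|Kc|%:R *
      expR (- (n%:R * c * T0 n `^ (2 - kappa^-1) / 4))))%:E)%E).
    by rewrite lee_wpmul2l// lee_fin powR_ge0.
  by rewrite -EFinM lee_fin.
split.
- apply: (@limn_esup_lty _ _ (1 * (K `^ (p * kappa) + (p * kappa / rho) `^ (p * kappa / rho)))).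
  have pk0 : 0 < p * kappa by rewrite mulr_gt0.
  have [|n0 _ n0P] := moment p (p * kappa) 1
    (fun Q G => dist_f Q (f Q) G (bayes_rule (f Q)) `^ p)%E ler01 pk0 (ltW p0) erefl.
    move=> n Q QQn G NNG; rewrite poweR_ge0 mul1r.
    have [-> _] := dist_f_fineK (f_regression Q QQn) (NN_measurable _ _ NNG).
    by rewrite poweR_EFin /= lexx.
  by exists n0 => // n /n0P nP; apply: ge_ereal_sup => _ [Q QQn <-]; exact: nP.
(* This constant comes from raising the margin bound d_Delta <= (d_f / c1)^(1/kappa) to the power
   p. *)
- have Cc0 : 0 <= c1 `^ (- (p / kappa)) by exact: powR_ge0.
  apply: (@limn_esup_lty _ _ (c1 `^ (- (p / kappa)) * (K `^ p + (p / rho) `^ (p / rho)))).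
  have q0 : 0 <= p / kappa by rewrite divr_ge0// ltW.
  have qk : p / kappa * kappa = p by rewrite divfK// gt_eqF.
  have [|n0 _ n0P] := moment (p / kappa) p (c1 `^ (- (p / kappa)))
    (fun Q G => dist_sd Q G (bayes_rule (f Q)) `^ p)%E Cc0 p0 q0 qk.
    move=> n Q QQn G NNG; rewrite poweR_ge0/=.
    have mG := NN_measurable _ _ NNG.
    have sd := dist_sd_margin (f_regression Q QQn) mG c1_gt0 kappa1 (NN_margin _ _ _ QQn NNG).
    have [_ /andP[e0 _]] := dist_f_fineK (f_regression Q QQn) mG.
    rewrite (dist_sd_fineK (f_regression Q QQn) mG) poweR_EFin lee_fin.
    have s0 : 0 <= fine (dist_sd Q G (bayes_rule (f Q))) by rewrite fine_ge0// dist_sd_ge0.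
    apply: (@le_trans _ _ (((fine (dist_f Q (f Q) G (bayes_rule (f Q))) / c1) `^ kappa^-1) `^ p)).
      by rewrite ge0_ler_powR ?nnegrE ?powR_ge0 ?(ltW p0).
    rewrite -powRrM powRM ?invr_ge0 ?(ltW c1_gt0)// (mulrC kappa^-1).
    have -> : c1^-1 = c1 `^ (-1) by rewrite powR_inv1// ltW.
    by rewrite -powRrM mulN1r [leLHS]mulrC.
  by exists n0 => // n /n0P nP; apply: ge_ereal_sup => _ [Q QQn <-]; exact: nP.
Unshelve. all: by end_near.
Qed.
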